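(* Suppose $\Omega$ is a smooth domain in $\mathbb R^2$ and $u$ is a solution in $\Omega$ of the Poisson equation $$\Delta u=\sum_{|\alpha|\le N}\sum_{j=1}^{N_\alpha}b^\alpha_j D^\alpha\delta_{x^\alpha_j},$$ that is, $$u(x)=u_0(x)+\sum_{|\alpha|\le N}\sum_{j=1}^{N_\alpha}b^\alpha_j D^\alpha\Gamma(x-x^\alpha_j),$$ where $N,N_\alpha\in\mathbb N$, $b_j^\alpha\in\mathbb R$, $x_j^\alpha\in\Omega$ for $j=1,\dots,N_\alpha$, $u_0$ is a harmonic function on $\bar\Omega$, and $\Gamma$ is the fundamental solution of the Laplace equation in $\mathbb R^2$. Let $p=|Du|^2$ and $q=\partial p/\partial\nu$, and assume that $p>0$ on $\partial\Omega$. Then $$-\frac1{2\pi}\int_{\partial\Omega}\frac{q}{2p}\,d\tau\le\sum_{|\alpha|\le N}(|\alpha|+1)N_\alpha.$$ Moreover, equality holds if $p$ does not vanish in $\Omega$.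
   Context: The sums run over multiindices $\alpha=(\alpha_1,\alpha_2)\in(\mathbb N\cup\{0\})^2$ with $|\alpha|=\alpha_1+\alpha_2\le N$, and $D^\alpha=\frac{\partial^{\alpha_1}}{\partial x_1^{\alpha_1}}\frac{\partial^{\alpha_2}}{\partial x_2^{\alpha_2}}$. $\delta_x$ is the Dirac delta function supported at $x$. $\Gamma$ satisfies $\Delta\Gamma=\delta_0$, i.e. $\Gamma(x)=\frac1{2\pi}\log|x|$. $Du$ is the gradient of $u$ and $|Du|$ its Euclidean norm. $\partial/\partial\nu$ is the derivative in the direction of the outward unit normal $\nu$ to $\partial\Omega$, and $d\tau$ is the arc length element on $\partial\Omega$.
   Formalization: The English fails for unbounded Ω (exterior of the unit disc, u = Re z²) and, for equality, with zero coefficients (b = 0, u_0 = x_1) or repeated points; so Ω is assumed bounded and, for equality only, all b_j^α are nonzero and the points x_j^α pairwise distinct. *)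

(* Defs.v *)
From Stdlib Require Export Reals.
From Coquelicot Require Export Coquelicot.
Open Scope R_scope.

Definition enorm (z : R * R) : R := sqrt (fst z ^ 2 + snd z ^ 2).

Definition closure (S : R * R -> Prop) (z : R * R) : Prop :=
  forall V : R * R -> Prop, locally z V -> exists w, V w /\ S w.

Definition boundary (S : R * R -> Prop) (z : R * R) : Prop :=
  closure S z /\ closure (fun w => ~ S w) z.

Definition connected (S : R * R -> Prop) : Prop :=
  forall U V : R * R -> Prop, open U -> open V ->
    (forall z, S z -> U z \/ V z) ->
    (exists z, S z /\ U z) -> (exists z, S z /\ V z) ->
    exists z, S z /\ U z /\ V z.

(* P holds in an open neighbourhood of the closure of S. *)
Definition near_closure (S : R * R -> Prop) (P : R * R -> Prop) : Prop :=
  forall z, closure S z -> locally z P.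

Definition tangent (g : R -> R * R) (t : R) : R * R :=
  (Derive (fun s => fst (g s)) t, Derive (fun s => snd (g s)) t).

(* The unit normal to the right of the direction of motion: it is the outward
   one on curves that keep the domain on their left. *)
Definition normal (g : R -> R * R) (t : R) : R * R :=
  (snd (tangent g t) / enorm (tangent g t),
   - fst (tangent g t) / enorm (tangent g t)).

(* Omega is a bounded domain whose boundary is the disjoint union of the smooth
   Jordan curves g 1, ..., g m, each of period 1 and traversed with Omega on its
   left.  The last clause says both that [normal] points outwards and that Omega
   lies on one side only of its boundary. *)
Record smooth_domain (Omega : R * R -> Prop) (m : nat) (g : nat -> R -> R * R)
  : Prop := {
  sd_open : open Omega;
  sd_nonempty : exists z, Omega z;
  sd_connected : connected Omega;
  sd_bounded : exists M, forall z, Omega z -> enorm z <= M;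
  sd_boundary : forall z, boundary Omega z <->
    exists k t, (1 <= k <= m)%nat /\ z = g k t;
  sd_smooth : forall k, (1 <= k <= m)%nat -> forall i t,
    ex_derive_n (fun s => fst (g k s)) i t /\
    ex_derive_n (fun s => snd (g k s)) i t;
  sd_regular : forall k, (1 <= k <= m)%nat -> forall t,
    tangent (g k) t <> (0, 0);
  sd_periodic : forall k, (1 <= k <= m)%nat -> forall t, g k (t + 1) = g k t;
  sd_simple : forall k l s t, (1 <= k <= m)%nat -> (1 <= l <= m)%nat ->
    0 <= s < 1 -> 0 <= t < 1 -> g k s = g l t -> k = l /\ s = t;
  sd_outward : forall k, (1 <= k <= m)%nat -> forall t,
    exists eps, 0 < eps /\ forall s, 0 < s < eps ->
      Omega (fst (g k t) - s * fst (normal (g k) t),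
             snd (g k t) - s * snd (normal (g k) t)) /\
      ~ closure Omega (fst (g k t) + s * fst (normal (g k) t),
                       snd (g k t) + s * snd (normal (g k) t))
}.

(* Integral over the curves g 1, ..., g m with respect to arc length; F k t is
   the value of the integrand at the point g k t. *)
Definition arc_integral (m : nat) (g : nat -> R -> R * R) (F : nat -> R -> R)
  : R :=
  sum_n_m (fun k => RInt (fun t => F k t * enorm (tangent (g k) t)) 0 1) 1 m.

Definition harmonic_near_closure (Omega : R * R -> Prop) (h : R -> R -> R)
  : Prop :=
  near_closure Omega (fun z =>
    ex_diff_n h 2 (fst z) (snd z) /\
    partial_derive 2 0 h (fst z) (snd z)
      + partial_derive 0 2 h (fst z) (snd z) = 0).

Definition Gamma (x y : R) : R := / (2 * PI) * ln (enorm (x, y)).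

Definition order (alpha : nat * nat) : nat := (fst alpha + snd alpha)%nat.

Definition D (alpha : nat * nat) (f : R -> R -> R) : R -> R -> R :=
  partial_derive (fst alpha) (snd alpha) f.

Definition sum_multi (N : nat) (F : nat * nat -> R) : R :=
  sum_n (fun a1 => sum_n (fun a2 => F (a1, a2)) (N - a1)) N.

Definition source_index (N : nat) (n : nat * nat -> nat)
  (alpha : nat * nat) (j : nat) : Prop :=
  (order alpha <= N)%nat /\ (1 <= j <= n alpha)%nat.

Definition source (N : nat) (n : nat * nat -> nat)
  (x : nat * nat -> nat -> R * R) (z : R * R) : Prop :=
  exists alpha j, source_index N n alpha j /\ z = x alpha j.

Definition source_potential (N : nat) (n : nat * nat -> nat)
  (b : nat * nat -> nat -> R) (x : nat * nat -> nat -> R * R) (z : R * R) : R :=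
  sum_multi N (fun alpha =>
    sum_n_m (fun j => b alpha j *
      D alpha Gamma (fst z - fst (x alpha j)) (snd z - snd (x alpha j)))
      1 (n alpha)).

Definition grad (u : R -> R -> R) (z : R * R) : R * R :=
  (Derive (fun s => u s (snd z)) (fst z), Derive (fun s => u (fst z) s) (snd z)).

Definition grad_sq (u : R -> R -> R) (z : R * R) : R := enorm (grad u z) ^ 2.

Definition dir_derive (f : R * R -> R) (z v : R * R) : R :=
  Derive (fun s => f (fst z + s * fst v, snd z + s * snd v)) 0.

(* Main.v *)
(** Where u is not singular, F = u_x - i u_y is holomorphic and p = |F|^2, so that
    q / (2 p) is the normal derivative of log |F| and the integral of q / (2 p)
    over the boundary is the imaginary part of the integral of F'/F.  The gradient
    of D^alpha Gamma (x - a) is a nonzero multiple of 1 / (z - a)^(|alpha| + 1), so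
    multiplying F by the product of the (z - x_j)^(|alpha| + 1) gives a holomorphic
    G, and the argument principle yields
      - 1/(2 pi) int q / (2 p) = sum (|alpha| + 1) N_alpha - #{zeros of G in Omega}.

    The argument principle needs Cauchy's theorem for Omega.  Dixon's argument
    reduces it to the winding number of the boundary being 0 off the closure of
    Omega.  A point off the boundary sees its nearest boundary point along the
    normal, the winding number is constant on that segment, and it jumps by 1
    across a boundary curve: hence it takes one value on Omega and that value
    minus 1 outside, and it tends to 0 at infinity. *)

Require Import Defs.
From Stdlib Require Import Reals ZArith Lra Lia Psatz ClassicalEpsilon List FinFun.
From Coquelicot Require Import Coquelicot.
Import ListNotations.
Open Scope R_scope.

(** * Curves in the complex plane *)

(** The logarithm is not the real part of a single-valued function, but its complex gradient 1 / (2
    pi z) is holomorphic, and from then on every derivative of Gamma is the real part of some c /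
    z^k. This is where the exponent |alpha| + 1 comes from.

    The bound may be strict for two reasons: F may vanish in Omega, and where coefficients vanish or
    sources coincide the pole of F may have smaller order than was counted, so that G vanishes
    there. Zeros of G record both, and the equality case has to exclude both.

    Zeros are treated by factoring instead of power series: factors z - a are split off one at a
    time, and a list with repetitions stands for zeros with multiplicity. That this stops is a
    compactness argument about arbitrarily long lists.

    The obstacle for the winding number is that [sd_outward] is pointwise: its eps depends on the
    boundary point and speaks of one normal only. Hence each point is joined to its own nearest
    boundary point, and the jump is computed at that single foot. *)

Lemma lt_Rmin (a b c : R) : a < Rmin b c -> a < b /\ a < c.
Proof. intros H. apply Rmin_Rgt_l in H. exact H. Qed.

Lemma Cmod_sub_sym (a b : C) : Cmod (a - b) = Cmod (b - a).
Proof. rewrite <- Cmod_opp; f_equal; ring. Qed.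

Lemma Cmod_sub_triangle (a b c : C) : Cmod (a - c) <= Cmod (a - b) + Cmod (b - c).
Proof. replace (a - c)%C with ((a - b) + (b - c))%C by ring; apply Cmod_triangle. Qed.

Lemma Cmod_sub_le (a b : C) : Cmod (a - b) <= Cmod a + Cmod b.
Proof. unfold Cminus; rewrite <- (Cmod_opp b); apply Cmod_triangle. Qed.

Lemma Cmod_sub_ge (a b : C) : Cmod a - Cmod b <= Cmod (a - b).
Proof.
  assert (H := Cmod_triangle (a - b) b).
  replace (a - b + b)%C with a in H by ring; lra.
Qed.

Lemma Cmod_le_Rabs (z : C) : Cmod z <= Rabs (fst z) + Rabs (snd z).
Proof.
  destruct z as [x y]; unfold Cmod; simpl fst; simpl snd.
  apply Rsqr_incr_0_var.
  - rewrite Rsqr_sqrt by nra. unfold Rsqr.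
    assert (H1 := Rabs_pos x); assert (H2 := Rabs_pos y).
    assert (E1 : x ^ 2 = Rabs x ^ 2) by now rewrite pow2_abs.
    assert (E2 : y ^ 2 = Rabs y ^ 2) by now rewrite pow2_abs.
    rewrite E1, E2; nra.
  - assert (H1 := Rabs_pos x); assert (H2 := Rabs_pos y); lra.
Qed.

Lemma fst_le_Cmod (z : C) : Rabs (fst z) <= Cmod z.
Proof. eapply Rle_trans; [apply Rmax_l | apply Rmax_Cmod]. Qed.

Lemma snd_le_Cmod (z : C) : Rabs (snd z) <= Cmod z.
Proof. eapply Rle_trans; [apply Rmax_r | apply Rmax_Cmod]. Qed.

Lemma norm_C (z : C) : @norm R_AbsRing C_R_NormedModule z = Cmod z.
Proof. symmetry; apply Cmod_norm. Qed.

(** Balls of the product uniformity on [C] are squares. Neighbourhoods are restated with discs so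
    that all estimates can be made in [Cmod]. *)
Definition near (z : C) (P : C -> Prop) : Prop :=
  exists d, 0 < d /\ forall w, Cmod (w - z) < d -> P w.

Lemma locally_Cmod (z : C) (P : C -> Prop) : @locally C_UniformSpace z P <-> near z P.
Proof.
  split.
  - intros [e He]. exists e; split; [apply cond_pos|].
    intros w Hw. apply He.
    assert (H1 := fst_le_Cmod (w - z)); assert (H2 := snd_le_Cmod (w - z)).
    split; (eapply Rle_lt_trans; [|exact Hw]); [exact H1 | exact H2].
  - intros (d & Hd & H). assert (Hd2 : 0 < d / 2) by lra.
    exists (mkposreal _ Hd2). intros w [H1 H2]. apply H.
    eapply Rle_lt_trans; [apply Cmod_le_Rabs|].
    change (Rabs (fst w - fst z) < d / 2) in H1.
    change (Rabs (snd w - snd z) < d / 2) in H2.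
    change (Rabs (fst w - fst z) + Rabs (snd w - snd z) < d). lra.
Qed.

Lemma Cmod_center (z : C) : Cmod (z - z) = 0.
Proof. replace (z - z)%C with (RtoC 0) by ring. apply Cmod_0. Qed.

Lemma near_self z P : near z P -> P z.
Proof. intros (d & Pd & D). apply D. now rewrite Cmod_center. Qed.

Lemma near_imp z (P Q : C -> Prop) : (forall w, P w -> Q w) -> near z P -> near z Q.
Proof. intros H (d & Pd & D). exists d; auto. Qed.

Lemma near_all z (P : C -> Prop) : (forall w, P w) -> near z P.
Proof. intros H. exists 1. split; [lra|auto]. Qed.

Lemma near_and z P Q : near z P -> near z Q -> near z (fun w => P w /\ Q w).
Proof.
  intros (d & Pd & D) (e & Pe & E). exists (Rmin d e). split; [now apply Rmin_pos|].
  intros w Hw. apply lt_Rmin in Hw. split; [apply D|apply E]; apply Hw.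
Qed.

Lemma near_near z P : near z P -> near z (fun w => near w P).
Proof.
  intros (d & Pd & D). exists d. split; [auto|]. intros w Hw. exists (d - Cmod (w - z))%R.
  split; [lra|]. intros v Hv. apply D. assert (T := Cmod_sub_triangle v w z). lra.
Qed.

Lemma near_ne (z a : C) : z <> a -> near z (fun w => w <> a).
Proof.
  intros N. exists (Cmod (z - a)). split; [now apply Cmod_gt_0, Cminus_eq_contra|].
  intros w Hw ->. rewrite Cmod_sub_sym in Hw. lra.
Qed.

Lemma continuous_Cmod (U : UniformSpace) (f : U -> C) (t : U) :
  @continuous U C_UniformSpace f t <->
  forall e, 0 < e -> locally t (fun s => Cmod (f s - f t) < e).
Proof.
  split.
  - intros H e He. apply (H (fun w => Cmod (w - f t) < e)).
    apply locally_Cmod. exists e; auto.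
  - intros H P HP. apply locally_Cmod in HP. destruct HP as (d & Hd & HP).
    assert (L := H d Hd). unfold filtermap. revert L. apply filter_imp. intros s; apply HP.
Qed.
Lemma scal_C (x : R) (z : C) : @scal R_AbsRing C_R_NormedModule x z = (RtoC x * z)%C.
Proof. apply scal_R_Cmult. Qed.

Notation Cder f t l := (@is_derive R_AbsRing C_R_NormedModule f t l).
Notation Ccont f t := (@continuous R_UniformSpace C_UniformSpace f t).
Notation Cint f a b := (@RInt C_R_CompleteNormedModule f a b).

Lemma Cder_Cmod (f : R -> C) (t : R) (l : C) :
  Cder f t l <-> forall e, 0 < e -> exists d, 0 < d /\ forall s, Rabs (s - t) < d ->
     Cmod (f s - f t - (s - t)%R * l) <= e * Rabs (s - t).
Proof.
  split.
  - intros [_ H] e He.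
    destruct (H t (fun P HP => HP) (mkposreal e He)) as [d Hd].
    exists d; split; [apply cond_pos|]. intros s Hs.
    specialize (Hd s Hs). rewrite norm_C in Hd.
    rewrite scal_C in Hd. exact Hd.
  - intros H. split; [apply is_linear_scal_l|].
    intros y Hy. assert (E := is_filter_lim_locally_unique (K:=R_AbsRing) (V:=R_NormedModule) t y Hy). rewrite <- E.
    intros e. destruct (H e (cond_pos e)) as (d & Hd & Hs).
    exists (mkposreal d Hd). intros s Hst. rewrite norm_C, scal_C. apply (Hs s Hst).
Qed.

Lemma Cder_pair (f : R -> C) (t : R) (l : C) :
  Cder f t l <->
  is_derive (fun s => fst (f s)) t (fst l) /\ is_derive (fun s => snd (f s)) t (snd l).
Proof.
  split.
  - intros H. rewrite Cder_Cmod in H.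
    split; apply is_derive_Reals; intros e He;
      destruct (H (e / 2)%R ltac:(lra)) as (d & Hd & Hs);
      exists (mkposreal d Hd); intros h Hh Hhd;
      assert (Hs' := Hs (t + h)%R ltac:(replace (t + h - t) with h by ring; exact Hhd));
      replace (t + h - t) with h in Hs' by ring;
      (assert (HA : Rabs h > 0) by now apply Rabs_pos_lt).
    + assert (H1 := fst_le_Cmod (f (t + h)%R - f t - RtoC h * l)).
      replace (fst (f (t + h)%R - f t - RtoC h * l)%C) with
        (((fst (f (t + h)) - fst (f t)) / h - fst l) * h)%R in H1 by (simpl; field; auto).
      rewrite Rabs_mult in H1.
      apply Rmult_lt_reg_r with (Rabs h); [lra|].
      eapply Rle_lt_trans; [exact H1|].
      eapply Rle_lt_trans; [exact Hs'|]. nra.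
    + assert (H1 := snd_le_Cmod (f (t + h)%R - f t - RtoC h * l)).
      replace (snd (f (t + h)%R - f t - RtoC h * l)%C) with
        (((snd (f (t + h)) - snd (f t)) / h - snd l) * h)%R in H1 by (simpl; field; auto).
      rewrite Rabs_mult in H1.
      apply Rmult_lt_reg_r with (Rabs h); [lra|].
      eapply Rle_lt_trans; [exact H1|].
      eapply Rle_lt_trans; [exact Hs'|]. nra.
  - intros [H1 H2]. apply Cder_Cmod. intros e He.
    apply is_derive_Reals in H1; apply is_derive_Reals in H2.
    destruct (H1 (e / 2)%R ltac:(lra)) as [d1 D1].
    destruct (H2 (e / 2)%R ltac:(lra)) as [d2 D2].
    exists (Rmin d1 d2). split; [apply Rmin_pos; apply cond_pos|].
    intros s Hs.
    destruct (Req_dec s t) as [->|Hne].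
    { replace (f t - f t - (t - t)%R * l)%C with (RtoC 0).
      - rewrite Cmod_0, Rminus_diag, Rabs_R0. lra.
      - rewrite Rminus_diag. ring. }
    assert (Hh : s - t <> 0) by lra.
    assert (HA := Rabs_pos_lt _ Hh).
    assert (E1 := D1 (s - t)%R Hh (Rlt_le_trans _ _ _ Hs (Rmin_l _ _))).
    assert (E2 := D2 (s - t)%R Hh (Rlt_le_trans _ _ _ Hs (Rmin_r _ _))).
    replace (t + (s - t)) with s in E1, E2 by ring.
    eapply Rle_trans; [apply Cmod_le_Rabs|].
    replace (fst (f s - f t - (s - t)%R * l)%C) with
      (((fst (f s) - fst (f t)) / (s - t) - fst l) * (s - t))%R by (simpl; field; auto).
    replace (snd (f s - f t - (s - t)%R * l)%C) with
      (((snd (f s) - snd (f t)) / (s - t) - snd l) * (s - t))%R by (simpl; field; auto).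
    rewrite !Rabs_mult. nra.
Qed.

Lemma continuous_pair (U : UniformSpace) (f : U -> C) (x : U) :
  @continuous U C_UniformSpace f x <->
  continuous (fun s => fst (f s)) x /\ continuous (fun s => snd (f s)) x.
Proof.
  split.
  - intros H. split.
    + apply (continuous_comp f fst); [exact H|]. destruct (f x); apply continuous_fst.
    + apply (continuous_comp f snd); [exact H|]. destruct (f x); apply continuous_snd.
  - intros [H1 H2]. apply continuous_Cmod. intros e He.
    assert (He2 : 0 < e / 2) by lra.
    assert (L1 := H1 (ball (fst (f x)) (mkposreal _ He2)) (locally_ball _ _)).
    assert (L2 := H2 (ball (snd (f x)) (mkposreal _ He2)) (locally_ball _ _)).
    unfold filtermap in L1, L2.
    assert (L := filter_and _ _ L1 L2). revert L. apply filter_imp. intros s [B1 B2].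
    eapply Rle_lt_trans; [apply Cmod_le_Rabs|].
    change (Rabs (fst (f s) - fst (f x)) < e / 2) in B1.
    change (Rabs (snd (f s) - snd (f x)) < e / 2) in B2.
    change (Rabs (fst (f s) - fst (f x)) + Rabs (snd (f s) - snd (f x)) < e). lra.
Qed.

Section ContinuousC.
Context {U : UniformSpace}.
Implicit Types f g : U -> C.
Notation cont f x := (@continuous U C_UniformSpace f x).

Lemma cont_plus f g x : cont f x -> cont g x -> cont (fun s => (f s + g s)%C) x.
Proof.
  rewrite !continuous_pair; intros [A B] [A' B']; split; simpl.
  - apply (continuous_plus (V := R_NormedModule)); assumption.
  - apply (continuous_plus (V := R_NormedModule)); assumption.
Qed.

Lemma cont_minus f g x : cont f x -> cont g x -> cont (fun s => (f s - g s)%C) x.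
Proof.
  rewrite !continuous_pair; intros [A B] [A' B']; split; simpl.
  - apply (continuous_minus (V := R_NormedModule)); assumption.
  - apply (continuous_minus (V := R_NormedModule)); assumption.
Qed.

Lemma cont_mult f g x : cont f x -> cont g x -> cont (fun s => (f s * g s)%C) x.
Proof.
  rewrite !continuous_pair; intros [A B] [A' B']; split; simpl.
  - apply (continuous_minus (V := R_NormedModule) (fun s => fst (f s) * fst (g s))%R
      (fun s => snd (f s) * snd (g s))%R);
      apply (continuous_mult (K := R_AbsRing)); assumption.
  - apply (continuous_plus (V := R_NormedModule) (fun s => fst (f s) * snd (g s))%R
      (fun s => snd (f s) * fst (g s))%R);
      apply (continuous_mult (K := R_AbsRing)); assumption.
Qed.

Lemma cont_RtoC (r : U -> R) x : continuous r x -> cont (fun s => RtoC (r s)) x.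
Proof. intros H; apply continuous_pair; split; [exact H | apply continuous_const]. Qed.

Lemma cont_inv f x : cont f x -> f x <> 0 -> cont (fun s => / f s)%C x.
Proof.
  intros H Hn. assert (P := proj1 (Cmod_gt_0 _) Hn).
  apply continuous_Cmod. intros e He. rewrite continuous_Cmod in H.
  set (m := Cmod (f x)) in *.
  (* The first bound keeps |f s| above m / 2, the second then makes |f s - f x| / (|f s| m) smaller
     than e. *)
  assert (Hm : 0 < Rmin (m / 2) (e * (m * m / 2))).
  { apply Rmin_pos; [lra|]. apply Rmult_lt_0_compat; nra. }
  generalize (H _ Hm). apply filter_imp. intros s Hs.
  destruct (lt_Rmin _ _ _ Hs) as [A1 A2].
  assert (A3 := Cmod_sub_ge (f x) (f s)). rewrite Cmod_sub_sym in A3. fold m in A3.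
  assert (Hs0 : f s <> 0) by (apply Cmod_gt_0; lra).
  replace (/ f s - / f x)%C with ((f x - f s) / (f s * f x))%C by (field; auto).
  rewrite Cmod_div, Cmod_mult by (now apply Cmult_neq_0). fold m.
  rewrite Cmod_sub_sym. apply Rmult_lt_reg_r with (Cmod (f s) * m)%R; [nra|].
  unfold Rdiv; rewrite Rmult_assoc, Rinv_l by nra. rewrite Rmult_1_r.
  eapply Rlt_le_trans; [exact A2|]. apply Rmult_le_compat_l; nra.
Qed.

Lemma cont_div f g x : cont f x -> cont g x -> g x <> 0 -> cont (fun s => f s / g s)%C x.
Proof. intros; apply cont_mult; [|apply cont_inv]; assumption. Qed.

Lemma cont_cauchy_kernel f g w k x : cont g x -> cont f x -> g x <> w ->
  cont (fun s => f s / (g s - w) ^ k)%C x.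
Proof.
  intros Hg Hf N. apply cont_div; [exact Hf| |apply Cpow_nz, Cminus_eq_contra, N].
  induction k; simpl; [apply continuous_const|].
  apply cont_mult; [apply cont_minus; [exact Hg|apply continuous_const]|exact IHk].
Qed.
End ContinuousC.

Lemma Cder_ext (f g : R -> C) t (l : C) : (forall s, f s = g s) -> Cder f t l -> Cder g t l.
Proof. intros E; apply is_derive_ext; exact E. Qed.

Lemma Cder_val (f : R -> C) t (l l' : C) : l = l' -> Cder f t l -> Cder f t l'.
Proof. intros ->; auto. Qed.

Lemma Cder_const (c : C) t : Cder (fun _ => c) t (RtoC 0).
Proof. apply (is_derive_const (V := C_R_NormedModule)). Qed.

Lemma Cder_plus (f g : R -> C) t (l k : C) : Cder f t l -> Cder g t k -> Cder (fun s => f s + g s)%C t (l + k)%C.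
Proof. intros; apply (is_derive_plus (V := C_R_NormedModule)); assumption. Qed.

Lemma Cder_minus (f g : R -> C) t (l k : C) : Cder f t l -> Cder g t k -> Cder (fun s => f s - g s)%C t (l - k)%C.
Proof. intros; apply (is_derive_minus (V := C_R_NormedModule)); assumption. Qed.

Lemma Cder_mult (f g : R -> C) t (l k : C) : Cder f t l -> Cder g t k ->
  Cder (fun s => f s * g s)%C t (l * g t + f t * k)%C.
Proof.
  rewrite !Cder_pair; intros [A B] [A' B']; split; simpl.
  - evar_last.
    { apply (is_derive_minus (V := R_NormedModule) (fun s => fst (f s) * fst (g s))%R
      (fun s => snd (f s) * snd (g s))%R); apply (is_derive_mult (K := R_AbsRing));
      first [eassumption | intros; apply Rmult_comm]. }
    unfold minus, plus, opp, mult; simpl; ring.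
  - evar_last.
    { apply (is_derive_plus (V := R_NormedModule) (fun s => fst (f s) * snd (g s))%R
      (fun s => snd (f s) * fst (g s))%R); apply (is_derive_mult (K := R_AbsRing));
      first [eassumption | intros; apply Rmult_comm]. }
    unfold minus, plus, opp, mult; simpl; ring.
Qed.

Lemma Cder_RtoC (r : R -> R) t l : is_derive r t l -> Cder (fun s => RtoC (r s)) t (RtoC l).
Proof. intros H; apply Cder_pair; split; simpl; [exact H|]. exact (is_derive_const (V := R_NormedModule) 0 t). Qed.

Lemma Cder_cont (f : R -> C) t (l : C) : Cder f t l -> Ccont f t.
Proof. intros H. apply (ex_derive_continuous (V := C_R_NormedModule)). now exists l. Qed.

Lemma ex_Cint (f : R -> C) a b : (forall t, Rmin a b <= t <= Rmax a b -> Ccont f t) ->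
  @ex_RInt C_R_NormedModule f a b.
Proof. apply (ex_RInt_continuous (V := C_R_CompleteNormedModule)). Qed.

Lemma ex_Cint_le (f : R -> C) a b : a <= b -> (forall t, a <= t <= b -> Ccont f t) ->
  @ex_RInt C_R_NormedModule f a b.
Proof. intros Hab H. apply ex_Cint. rewrite Rmin_left, Rmax_right by exact Hab. exact H. Qed.

(** Integrals in [C_R_NormedModule] are linear over the reals, so a complex factor is moved out by
    treating real and imaginary parts separately. *)
Lemma is_Cint_mult (c : C) (f : R -> C) a b l :
  @is_RInt C_R_NormedModule f a b l -> @is_RInt C_R_NormedModule (fun t => c * f t)%C a b (c * l)%C.
Proof.
  intros H.
  assert (H1 := is_RInt_fct_extend_fst (U:=R_NormedModule) (V:=R_NormedModule) f a b l H).
  assert (H2 := is_RInt_fct_extend_snd (U:=R_NormedModule) (V:=R_NormedModule) f a b l H).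
  apply (is_RInt_fct_extend_pair (U:=R_NormedModule) (V:=R_NormedModule)); simpl.
  - apply (is_RInt_minus (V := R_NormedModule) (fun t => fst c * fst (f t))%R (fun t => snd c * snd (f t))%R);
    apply (is_RInt_scal (V := R_NormedModule)); assumption.
  - apply (is_RInt_plus (V := R_NormedModule) (fun t => fst c * snd (f t))%R (fun t => snd c * fst (f t))%R);
    apply (is_RInt_scal (V := R_NormedModule)); assumption.
Qed.

Lemma Cint_correct f a b : @ex_RInt C_R_NormedModule f a b -> @is_RInt C_R_NormedModule f a b (Cint f a b).
Proof. apply (RInt_correct (V := C_R_CompleteNormedModule)). Qed.

Lemma Cint_unique f a b l : @is_RInt C_R_NormedModule f a b l -> Cint f a b = l.
Proof. apply (is_RInt_unique (V := C_R_CompleteNormedModule)). Qed.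

Lemma Cint_mult c f a b : @ex_RInt C_R_NormedModule f a b ->
  Cint (fun t => c * f t)%C a b = (c * Cint f a b)%C.
Proof. intros H; apply Cint_unique, is_Cint_mult, Cint_correct, H. Qed.

Lemma Cint_plus f g a b : @ex_RInt C_R_NormedModule f a b -> @ex_RInt C_R_NormedModule g a b ->
  Cint (fun t => f t + g t)%C a b = (Cint f a b + Cint g a b)%C.
Proof. apply (RInt_plus (V := C_R_CompleteNormedModule)). Qed.

Lemma Cint_minus f g a b : @ex_RInt C_R_NormedModule f a b -> @ex_RInt C_R_NormedModule g a b ->
  Cint (fun t => f t - g t)%C a b = (Cint f a b - Cint g a b)%C.
Proof. apply (RInt_minus (V := C_R_CompleteNormedModule)). Qed.

Lemma Cint_ext (f g : R -> C) a b : a <= b -> (forall t, a <= t <= b -> f t = g t) -> Cint f a b = Cint g a b.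
Proof.
  intros Hab H. apply (RInt_ext (V := C_R_CompleteNormedModule)).
  rewrite Rmin_left, Rmax_right by lra. intros t Ht; apply H; lra.
Qed.

Lemma Cint_bound (f : R -> C) a b M : a <= b -> @ex_RInt C_R_NormedModule f a b ->
  (forall t, a <= t <= b -> Cmod (f t) <= M) -> Cmod (Cint f a b) <= (b - a) * M.
Proof.
  intros Hab He H. rewrite <- norm_C.
  apply (norm_RInt_le_const (V := C_R_NormedModule) f); auto.
  - intros t Ht; rewrite norm_C; auto.
  - now apply Cint_correct.
Qed.

Lemma Cint_der (f f' : R -> C) a b : a <= b ->
  (forall t, a <= t <= b -> Cder f t (f' t)) -> (forall t, a <= t <= b -> Ccont f' t) ->
  Cint f' a b = (f b - f a)%C.
Proof.
  intros Hab H1 H2. apply Cint_unique.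
  apply (is_RInt_derive (V := C_R_CompleteNormedModule));
    rewrite Rmin_left, Rmax_right by lra; assumption.
Qed.

Lemma RtoC_nz (r : R) : r <> 0 -> RtoC r <> 0.
Proof. intros H E. apply H. now apply RtoC_inj. Qed.

(* [ring] and [field] do not see that the carrier of [C_R_NormedModule] is C. *)
Ltac Ceq := match goal with |- @eq _ ?a ?b => change (@eq C a b) end.

(** * Complex differentiability *)

Definition is_Cderive (f : C -> C) (z l : C) : Prop :=
  forall e, 0 < e -> near z (fun w => Cmod (f w - f z - l * (w - z)) <= e * Cmod (w - z)).

Lemma Cderive_unique f z l k : is_Cderive f z l -> is_Cderive f z k -> l = k.
Proof.
  intros Hl Hk. apply Ceq_minus, Cmod_eq_0. apply Rle_antisym; [|apply Cmod_ge_0].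
  apply Rnot_lt_le. intros Hlt.
  (* One test point z + d suffices: two errors, each at most |l - k| d / 4, would have to add up to
     |l - k| d. *)
  destruct (Hl (Cmod (l - k) / 4)%R ltac:(lra)) as (d1 & P1 & D1).
  destruct (Hk (Cmod (l - k) / 4)%R ltac:(lra)) as (d2 & P2 & D2).
  set (d := Rmin d1 d2 / 2).
  assert (Pd : 0 < d) by (unfold d; assert (0 < Rmin d1 d2) by (apply Rmin_pos; auto); lra).
  assert (d < d1) by (unfold d in *; assert (Q := Rmin_l d1 d2); lra).
  assert (d < d2) by (unfold d in *; assert (Q := Rmin_r d1 d2); lra).
  assert (E : Cmod (z + RtoC d - z) = d).
  { replace (z + RtoC d - z)%C with (RtoC d) by ring. rewrite Cmod_R, Rabs_pos_eq; lra. }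
  assert (A1 := D1 (z + RtoC d)%C ltac:(lra)).
  assert (A2 := D2 (z + RtoC d)%C ltac:(lra)).
  rewrite E in A1, A2.
  assert (T := Cmod_sub_le (f (z + RtoC d)%C - f z - k * (z + RtoC d - z))
                (f (z + RtoC d)%C - f z - l * (z + RtoC d - z))).
  replace (f (z + RtoC d)%C - f z - k * (z + RtoC d - z) -
      (f (z + RtoC d)%C - f z - l * (z + RtoC d - z)))%C with ((l - k) * RtoC d)%C in T by ring.
  rewrite Cmod_mult, Cmod_R, (Rabs_pos_eq d) in T by lra. nra.
Qed.

Lemma Cderive_ext f g z l : near z (fun w => f w = g w) ->
  is_Cderive f z l -> is_Cderive g z l.
Proof.
  intros E H e He. rewrite <- (near_self _ _ E).
  apply (near_imp z (fun w => f w = g w /\ Cmod (f w - f z - l * (w - z)) <= e * Cmod (w - z))).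
  - intros w [<- Hw]. exact Hw.
  - apply near_and; [exact E|exact (H e He)].
Qed.

Lemma Cderive_curve f z l (c : R -> C) t v : is_Cderive f z l -> c t = z -> Cder c t v ->
  Cder (fun s => f (c s)) t (l * v)%C.
Proof.
  intros Hf E Hc. subst z. rewrite Cder_Cmod in *. intros e He.
  (* [K] is a Lipschitz constant of c at t, because the error of c is at most |s - t|; [L] is
     positive and exceeds |l|, so |l| times the error of c stays below e / 2 |s - t|. *)
  set (K := (Cmod v + 1)%R). assert (HK : 0 < K) by (unfold K; assert (Q := Cmod_ge_0 v); lra).
  destruct (Hf (e / 2 / K)%R ltac:(repeat apply Rdiv_lt_0_compat; lra)) as (d1 & P1 & D1).
  set (L := (Cmod l + 1)%R). assert (HL : 0 < L) by (unfold L; assert (Q := Cmod_ge_0 l); lra).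
  assert (Pm : 0 < Rmin 1 (e / 2 / L)) by (apply Rmin_pos; [lra | repeat apply Rdiv_lt_0_compat; lra]).
  destruct (Hc _ Pm) as (d2 & P2 & D2).
  exists (Rmin d2 (d1 / K)). split; [apply Rmin_pos; [|apply Rdiv_lt_0_compat]; lra|].
  intros s Hs.
  destruct (lt_Rmin _ _ _ Hs) as [Hs2 Hs1].
  assert (A := D2 s Hs2).
  assert (M1 := Rmin_l 1 (e / 2 / L)). assert (M2 := Rmin_r 1 (e / 2 / L)).
  assert (PA := Rabs_pos (s - t)).
  assert (B : Cmod (c s - c t) <= K * Rabs (s - t)).
  { replace (c s - c t)%C with ((c s - c t - (s - t)%R * v) + (s - t)%R * v)%C by ring.
    eapply Rle_trans; [apply Cmod_triangle|]. rewrite Cmod_mult, Cmod_R. unfold K. nra. }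
  assert (HB : Cmod (c s - c t) < d1).
  { eapply Rle_lt_trans; [exact B|]. apply (Rmult_lt_compat_l K) in Hs1; [|lra].
    replace (K * (d1 / K))%R with d1 in Hs1 by (field; lra). exact Hs1. }
  assert (A1 := D1 _ HB).
  replace (f (c s) - f (c t) - (s - t)%R * (l * v))%C with
    ((f (c s) - f (c t) - l * (c s - c t)) + l * (c s - c t - (s - t)%R * v))%C by ring.
  eapply Rle_trans; [apply Cmod_triangle|]. rewrite Cmod_mult.
  assert (X1 : e / 2 / K * Cmod (c s - c t) <= e / 2 * Rabs (s - t)).
  { replace (e / 2 * Rabs (s - t))%R with (e / 2 / K * (K * Rabs (s - t)))%R by (field; lra).
    apply Rmult_le_compat_l; [|exact B]. left; repeat apply Rdiv_lt_0_compat; lra. }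
  assert (X2 : Cmod l * Cmod (c s - c t - (s - t)%R * v) <= e / 2 * Rabs (s - t)).
  { apply Rle_trans with (L * (e / 2 / L * Rabs (s - t)))%R.
    - apply Rmult_le_compat; try apply Cmod_ge_0; [unfold L; lra|].
      eapply Rle_trans; [exact A|]. apply Rmult_le_compat_r; lra.
    - right; field; lra. }
  lra.
Qed.

(* Complex differentiability with a locally uniform quadratic error term: all
   estimates under integral signs then hold with explicit constants, and no
   compactness argument is needed. *)
Definition Hol (f f' : C -> C) (z : C) : Prop :=
  exists r M, 0 < r /\ 0 <= M /\ forall w w', Cmod (w - z) < r -> Cmod (w' - z) < r ->
    Cmod (f w' - f w - f' w * (w' - w)) <= M * Cmod (w' - w) ^ 2.

Definition holo (f : C -> C) (z : C) : Prop := exists f', Hol f f' z.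

(** Choice makes the derivative a total function, so that F'/F can be written down without proofs;
    the value is meaningful where a complex derivative exists. *)
Definition der (f : C -> C) (z : C) : C := epsilon (inhabits (RtoC 0)) (fun l => is_Cderive f z l).

Lemma Hol_local f f' z : Hol f f' z ->
  near z (fun w => Hol f f' w).
Proof.
  intros (r & M & Pr & PM & H). exists r; split; [auto|]. intros w Hw.
  exists (r - Cmod (w - z))%R, M. repeat split; [lra|auto|].
  intros v v' Hv Hv'. apply H.
  - assert (Q := Cmod_sub_triangle v w z); lra.
  - assert (Q := Cmod_sub_triangle v' w z); lra.
Qed.

Lemma Hol_Cderive f f' z : Hol f f' z -> is_Cderive f z (f' z).
Proof.
  intros (r & M & Pr & PM & H) e He.
  assert (Q : 0 < e / (M + 1)) by (apply Rdiv_lt_0_compat; lra).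
  exists (Rmin r (e / (M + 1))). split; [now apply Rmin_pos|].
  intros w Hw. destruct (lt_Rmin _ _ _ Hw) as [W1 W2].
  eapply Rle_trans; [apply H; [rewrite Cmod_center; lra | exact W1]|].
  apply (Rmult_lt_compat_r (M + 1)) in W2; [|lra].
  replace (e / (M + 1) * (M + 1))%R with e in W2 by (field; lra).
  assert (P := Cmod_ge_0 (w - z)). nra.
Qed.

Lemma Hol_ext f f' g g' z : near z (fun w => f w = g w /\ f' w = g' w) ->
  Hol f f' z -> Hol g g' z.
Proof.
  intros (d & Pd & E) (r & M & Pr & PM & H).
  exists (Rmin d r), M. repeat split; [now apply Rmin_pos|auto|].
  intros w w' Hw Hw'.
  destruct (lt_Rmin _ _ _ Hw) as [W1 W2].
  destruct (lt_Rmin _ _ _ Hw') as [W1' W2'].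
  destruct (E w W1) as [<- <-]. destruct (E w' W1') as [<- _]. now apply H.
Qed.

Lemma Cderive_der f z l : is_Cderive f z l -> der f z = l.
Proof.
  intros H. apply (Cderive_unique f z); [|exact H].
  unfold der. apply epsilon_spec. now exists l.
Qed.

Lemma Hol_der f f' z : Hol f f' z -> der f z = f' z.
Proof. intros H; apply Cderive_der, Hol_Cderive, H. Qed.

Lemma holo_der f z : holo f z -> Hol f (der f) z.
Proof.
  intros [f' H]. destruct (Hol_local _ _ _ H) as (d & Pd & D).
  apply (Hol_ext f f'); [|exact H]. exists d; split; [auto|].
  intros w Hw; split; [auto|]. symmetry; apply Hol_der; auto.
Qed.

Lemma holo_ext f g z : near z (fun w => f w = g w) ->
  holo f z -> holo g z.
Proof.
  intros (d & Pd & D) [f' H]. exists f'. apply (Hol_ext f f'); [|auto].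
  exists d; split; auto.
Qed.

(** Exchanging w and w' in the quadratic estimate and adding the two shows that (f' w' - f' w) (w' -
    w) is O(|w' - w|^2), so f' is Lipschitz. Then f' is bounded and f is Lipschitz, and one constant
    serves for everything. *)
Lemma Hol_nice f f' z : Hol f f' z ->
  exists r M, 0 < r /\ 0 < M /\
    (forall w, Cmod (w - z) < r -> Cmod (f w) <= M /\ Cmod (f' w) <= M) /\
    forall w w', Cmod (w - z) < r -> Cmod (w' - z) < r ->
    Cmod (f w' - f w) <= M * Cmod (w' - w) /\
    Cmod (f' w' - f' w) <= M * Cmod (w' - w) /\
    Cmod (f w' - f w - f' w * (w' - w)) <= M * Cmod (w' - w) ^ 2.
Proof.
  intros (r0 & M & Pr0 & PM & H0).
  (* Radius at most 1 gives |w' - w| <= 2, which lets the quadratic term be absorbed in a linear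
     one. *)
  set (r := Rmin r0 1). assert (Pr : 0 < r) by (apply Rmin_pos; lra).
  assert (r1 : r <= 1) by apply Rmin_r. assert (rr : r <= r0) by apply Rmin_l.
  assert (H : forall w w', Cmod (w - z) < r -> Cmod (w' - z) < r ->
    Cmod (f w' - f w - f' w * (w' - w)) <= M * Cmod (w' - w) ^ 2)
    by (intros; apply H0; lra).
  assert (L' : forall w w', Cmod (w - z) < r -> Cmod (w' - z) < r ->
    Cmod (f' w' - f' w) <= 2 * M * Cmod (w' - w)).
  { intros w w' Hw Hw'.
    destruct (Ceq_dec w' w) as [->|Hne].
    { rewrite !Cmod_center. lra. }
    assert (Hn : 0 < Cmod (w' - w)) by (apply Cmod_gt_0; now apply Cminus_eq_contra).
    apply Rmult_le_reg_r with (Cmod (w' - w)); [auto|].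
    rewrite <- Cmod_mult.
    replace ((f' w' - f' w) * (w' - w))%C with
      ((f w' - f w - f' w * (w' - w)) + (f w - f w' - f' w' * (w - w')))%C by ring.
    eapply Rle_trans; [apply Cmod_triangle|].
    assert (A1 := H w w' Hw Hw'). assert (A2 := H w' w Hw' Hw).
    rewrite (Cmod_sub_sym w w') in A2. nra. }
  assert (Hz : Cmod (z - z) < r) by (rewrite Cmod_center; lra).
  set (B' := (Cmod (f' z) + 2 * M)%R).
  assert (PB' : 0 <= B') by (unfold B'; assert (Q := Cmod_ge_0 (f' z)); lra).
  assert (Bd' : forall w, Cmod (w - z) < r -> Cmod (f' w) <= B').
  { intros w Hw. assert (A := L' z w Hz Hw). assert (A2 := Cmod_sub_ge (f' w) (f' z)).
    unfold B'. assert (Q := Cmod_ge_0 (w - z)). nra. }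
  assert (L : forall w w', Cmod (w - z) < r -> Cmod (w' - z) < r ->
    Cmod (f w' - f w) <= (B' + 2 * M) * Cmod (w' - w)).
  { intros w w' Hw Hw'. assert (A := H w w' Hw Hw').
    replace (f w' - f w)%C with ((f w' - f w - f' w * (w' - w)) + f' w * (w' - w))%C by ring.
    eapply Rle_trans; [apply Cmod_triangle|]. rewrite Cmod_mult.
    assert (Q := Bd' w Hw). assert (Q2 := Cmod_ge_0 (w' - w)).
    assert (Q3 : Cmod (w' - w) <= 2).
    { assert (T := Cmod_sub_triangle w' z w). rewrite (Cmod_sub_sym z w) in T. lra. }
    assert (M * Cmod (w' - w) ^ 2 <= 2 * M * Cmod (w' - w)).
    { replace (2 * M * Cmod (w' - w))%R with (M * (2 * Cmod (w' - w)))%R by ring.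
      apply Rmult_le_compat_l; nra. }
    nra. }
  exists r, (Cmod (f z) + B' + 4 * M + 1)%R.
  assert (Q := Cmod_ge_0 (f z)).
  repeat split; [auto|lra| | | | |].
  - assert (A := L z w Hz H1). assert (A2 := Cmod_sub_ge (f w) (f z)).
    assert (Q2 := Cmod_ge_0 (w - z)). nra.
  - assert (A := Bd' w H1). lra.
  - eapply Rle_trans; [apply L; auto|]. apply Rmult_le_compat_r; [apply Cmod_ge_0 | lra].
  - eapply Rle_trans; [apply L'; auto|]. apply Rmult_le_compat_r; [apply Cmod_ge_0 | lra].
  - eapply Rle_trans; [apply H; auto|]. apply Rmult_le_compat_r; [apply pow2_ge_0 | lra].
Qed.

Lemma Hol_const c z : Hol (fun _ => c) (fun _ => RtoC 0) z.
Proof.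
  exists 1, 0. repeat split; try lra. intros w w' _ _.
  replace (c - c - 0 * (w' - w))%C with (RtoC 0) by ring. rewrite Cmod_0. nra.
Qed.

Lemma Hol_id z : Hol (fun w => w) (fun _ => RtoC 1) z.
Proof.
  exists 1, 0. repeat split; try lra. intros w w' _ _.
  replace (w' - w - 1 * (w' - w))%C with (RtoC 0) by ring. rewrite Cmod_0. nra.
Qed.

Lemma Hol_plus f f' g g' z : Hol f f' z -> Hol g g' z ->
  Hol (fun w => f w + g w)%C (fun w => f' w + g' w)%C z.
Proof.
  intros (r & M & Pr & PM & H) (r' & M' & Pr' & PM' & H').
  exists (Rmin r r'), (M + M')%R. repeat split; [now apply Rmin_pos|lra|].
  intros w w' Hw Hw'.
  destruct (lt_Rmin _ _ _ Hw) as [W1 W2].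
  destruct (lt_Rmin _ _ _ Hw') as [W1' W2'].
  replace (f w' + g w' - (f w + g w) - (f' w + g' w) * (w' - w))%C with
   ((f w' - f w - f' w * (w' - w)) + (g w' - g w - g' w * (w' - w)))%C by ring.
  eapply Rle_trans; [apply Cmod_triangle|]. rewrite Rmult_plus_distr_r.
  apply Rplus_le_compat; auto.
Qed.

Lemma Hol_mult f f' g g' z : Hol f f' z -> Hol g g' z ->
  Hol (fun w => f w * g w)%C (fun w => f' w * g w + f w * g' w)%C z.
Proof.
  intros Hf Hg.
  destruct (Hol_nice _ _ _ Hf) as (r & M & Pr & PM & B & H).
  destruct (Hol_nice _ _ _ Hg) as (r' & M' & Pr' & PM' & B' & H').
  exists (Rmin r r'), (3 * M * M')%R. repeat split; [now apply Rmin_pos|nra|].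
  intros w w' Hw Hw'.
  destruct (lt_Rmin _ _ _ Hw) as [W1 W2].
  destruct (lt_Rmin _ _ _ Hw') as [W1' W2'].
  destruct (H w w' W1 W1') as (X1 & _ & X3). destruct (H' w w' W2 W2') as (Y1 & _ & Y3).
  destruct (B w' W1') as [B1 _]. destruct (B' w W2) as [B2 B3].
  replace (f w' * g w' - f w * g w - (f' w * g w + f w * g' w) * (w' - w))%C with
   (f w' * (g w' - g w - g' w * (w' - w)) + g w * (f w' - f w - f' w * (w' - w))
    + (f w' - f w) * (g' w * (w' - w)))%C by ring.
  eapply Rle_trans; [apply Cmod_triangle|].
  eapply Rle_trans; [apply Rplus_le_compat_r, Cmod_triangle|]. rewrite !Cmod_mult.
  assert (Q := Cmod_ge_0 (w' - w)). set (h := Cmod (w' - w)) in *.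
  assert (K1 : Cmod (f w') * Cmod (g w' - g w - g' w * (w' - w)) <= M * (M' * h ^ 2))
    by (apply Rmult_le_compat; auto using Cmod_ge_0).
  assert (K2 : Cmod (g w) * Cmod (f w' - f w - f' w * (w' - w)) <= M' * (M * h ^ 2))
    by (apply Rmult_le_compat; auto using Cmod_ge_0).
  assert (K3 : Cmod (f w' - f w) * (Cmod (g' w) * h) <= (M * h) * (M' * h)).
  { apply Rmult_le_compat; auto using Cmod_ge_0.
    - apply Rmult_le_pos; auto using Cmod_ge_0.
    - apply Rmult_le_compat_r; auto. }
  nra.
Qed.

Lemma Hol_inv f f' z : Hol f f' z -> f z <> 0 ->
  Hol (fun w => / f w)%C (fun w => - f' w / (f w * f w))%C z.
Proof.
  intros Hf Hz.
  destruct (Hol_nice _ _ _ Hf) as (r & M & Pr & PM & B & H).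
  assert (Pz := proj1 (Cmod_gt_0 _) Hz).
  set (c := (Cmod (f z) / 2)%R). assert (Pc : 0 < c) by (unfold c; lra).
  (* Within c / M of z the function moves by less than c = |f z| / 2, hence |f| >= c there. *)
  set (r1 := Rmin r (c / M)). assert (P1 : 0 < r1) by (apply Rmin_pos; [auto|now apply Rdiv_lt_0_compat]).
  assert (Hlow : forall w, Cmod (w - z) < r1 -> Cmod (w - z) < r /\ c <= Cmod (f w)).
  { intros w Hw. destruct (lt_Rmin _ _ _ Hw) as [W1 W2]. split; [auto|].
    destruct (H z w ltac:(rewrite Cmod_center; lra) W1) as (X & _ & _).
    apply (Rmult_lt_compat_l M) in W2; [|auto].
    replace (M * (c / M))%R with c in W2 by (field; lra).
    assert (T := Cmod_sub_ge (f z) (f w)). rewrite Cmod_sub_sym in T. unfold c in *. lra. }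
  exists r1, (2 * M * M / (c * c * c))%R. split; [auto|]. split.
  { left. apply Rdiv_lt_0_compat; [nra|]. repeat apply Rmult_lt_0_compat; lra. }
  intros w w' Hw Hw'.
  destruct (Hlow w Hw) as [W C1]. destruct (Hlow w' Hw') as [W' C2].
  assert (N1 : f w <> 0) by (apply Cmod_gt_0; lra).
  assert (N2 : f w' <> 0) by (apply Cmod_gt_0; lra).
  destruct (H w w' W W') as (X1 & _ & X3). destruct (B w W) as [B1 B2].
  replace (/ f w' - / f w - - f' w / (f w * f w) * (w' - w))%C with
   ((f' w * (w' - w) * (f w' - f w) - f w * (f w' - f w - f' w * (w' - w))) / (f w' * (f w * f w)))%C
   by (field; auto).
  assert (Q := Cmod_ge_0 (w' - w)). 
  rewrite Cmod_div, !Cmod_mult by (repeat apply Cmult_neq_0; auto).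
  apply Rle_trans with ((2 * M * M * Cmod (w' - w) ^ 2) * / (c * c * c))%R; [|right; unfold Rdiv; ring].
  apply Rmult_le_compat; [apply Cmod_ge_0| | |].
  - left; apply Rinv_0_lt_compat; repeat apply Rmult_lt_0_compat; lra.
  - eapply Rle_trans; [apply Cmod_sub_le|]. rewrite !Cmod_mult.
    set (h := Cmod (w' - w)) in *.
    assert (K1 : Cmod (f' w) * h * Cmod (f w' - f w) <= (M * h) * (M * h)).
    { apply Rmult_le_compat; auto using Cmod_ge_0.
      - apply Rmult_le_pos; auto using Cmod_ge_0.
      - apply Rmult_le_compat_r; auto. }
    assert (K2 : Cmod (f w) * Cmod (f w' - f w - f' w * (w' - w)) <= M * (M * h ^ 2))
      by (apply Rmult_le_compat; auto using Cmod_ge_0).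
    nra.
  - apply Rinv_le_contravar; [repeat apply Rmult_lt_0_compat; lra|].
    assert (c * c <= Cmod (f w) * Cmod (f w)) by (apply Rmult_le_compat; lra).
    assert (0 <= c * c) by nra.
    replace (c * c * c)%R with (c * (c * c))%R by ring. apply Rmult_le_compat; lra.
Qed.

Lemma holo_const c z : holo (fun _ => c) z.
Proof. exists (fun _ => RtoC 0); apply Hol_const. Qed.
Lemma holo_id z : holo (fun w => w) z.
Proof. exists (fun _ => RtoC 1); apply Hol_id. Qed.
Lemma holo_plus f g z : holo f z -> holo g z -> holo (fun w => f w + g w)%C z.
Proof. intros [f' F] [g' G]; eexists; apply Hol_plus; eassumption. Qed.
Lemma holo_mult f g z : holo f z -> holo g z -> holo (fun w => f w * g w)%C z.
Proof. intros [f' F] [g' G]; eexists; apply Hol_mult; eassumption. Qed.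
Lemma holo_inv f z : holo f z -> f z <> 0 -> holo (fun w => / f w)%C z.
Proof. intros [f' F] N; eexists; apply Hol_inv; eassumption. Qed.
Lemma holo_minus f g z : holo f z -> holo g z -> holo (fun w => f w - g w)%C z.
Proof.
  intros F G. apply (holo_ext (fun w => f w + (-1)%R * g w)%C).
  - exists 1; split; [lra|]. intros w _. ring.
  - apply holo_plus; [auto|]. apply holo_mult; [apply holo_const|auto].
Qed.
Lemma holo_div f g z : holo f z -> holo g z -> g z <> 0 -> holo (fun w => f w / g w)%C z.
Proof. intros F G N. apply (holo_mult f (fun w => / g w)%C); [|apply holo_inv]; auto. Qed.
Lemma holo_pow f k z : holo f z -> holo (fun w => f w ^ k)%C z.
Proof. intros F; induction k; simpl; [apply holo_const | apply holo_mult; auto]. Qed.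

Lemma Cderive_cont f z l : is_Cderive f z l -> @continuous C_UniformSpace C_UniformSpace f z.
Proof.
  intros H. apply (continuous_Cmod C_UniformSpace). intros e He.
  destruct (H 1 ltac:(lra)) as (d & Pd & D).
  apply locally_Cmod. set (K := (Cmod l + 2)%R). assert (Q := Cmod_ge_0 l).
  exists (Rmin d (e / K)). split.
  { apply Rmin_pos; [auto|]. apply Rdiv_lt_0_compat; unfold K; lra. }
  intros w Hw. destruct (lt_Rmin _ _ _ Hw) as [W1 W2].
  apply (Rmult_lt_compat_l K) in W2; [|unfold K; lra].
  replace (K * (e / K))%R with e in W2 by (field; unfold K; lra).
  assert (A := D w W1).
  replace (f w - f z)%C with ((f w - f z - l * (w - z)) + l * (w - z))%C by ring.
  eapply Rle_lt_trans; [apply Cmod_triangle|]. rewrite Cmod_mult.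
  assert (Q1 := Cmod_ge_0 (w - z)). unfold K in W2. nra.
Qed.

Lemma holo_cont f z : holo f z -> @continuous C_UniformSpace C_UniformSpace f z.
Proof. intros [f' H]. eapply Cderive_cont, Hol_Cderive, H. Qed.

Lemma Hol_der_cont f f' z : Hol f f' z -> @continuous C_UniformSpace C_UniformSpace f' z.
Proof.
  intros H. apply (continuous_Cmod C_UniformSpace). intros e He.
  destruct (Hol_nice _ _ _ H) as (r & M & Pr & PM & _ & L).
  apply locally_Cmod. exists (Rmin r (e / M)). split.
  { apply Rmin_pos; [auto|]. apply Rdiv_lt_0_compat; lra. }
  intros w Hw. destruct (lt_Rmin _ _ _ Hw) as [W1 W2].
  apply (Rmult_lt_compat_l M) in W2; [|lra].
  replace (M * (e / M))%R with e in W2 by (field; lra).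
  destruct (L z w ltac:(rewrite Cmod_center; lra) W1) as (_ & X & _). lra.
Qed.

Lemma cont_comp {U : UniformSpace} (f : C -> C) (c : U -> C) t :
  @continuous C_UniformSpace C_UniformSpace f (c t) ->
  @continuous U C_UniformSpace c t -> @continuous U C_UniformSpace (fun s => f (c s)) t.
Proof. intros Hf Hc. apply (continuous_comp c f); assumption. Qed.

(** * Cauchy-type integrals and winding numbers *)

Lemma Cint_const k a b : Cint (fun _ => k) a b = ((b - a)%R * k)%C.
Proof.
  rewrite (RInt_const (V := C_R_CompleteNormedModule)). apply scal_C.
Qed.

Lemma Ccont_bounded (f : R -> C) a b : (forall t, a <= t <= b -> Ccont f t) ->
  exists M, 0 < M /\ forall t, a <= t <= b -> Cmod (f t) <= M.
Proof.
  intros H.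
  destruct (bounded_continuity (V := C_R_NormedModule) f a b) as [M HM].
  - intros t Ht. exact (H t Ht).
  - exists (Rmax M 1). split; [assert (Q := Rmax_r M 1); lra|].
    intros t Ht. assert (A := HM t Ht). rewrite norm_C in A.
    assert (Q := Rmax_l M 1). lra.
Qed.

(** Compactness enters through the boundedness of the continuous function 1 / (f - z). *)
Lemma Ccont_away (f : R -> C) a b z : (forall t, a <= t <= b -> Ccont f t) ->
  (forall t, a <= t <= b -> f t <> z) ->
  exists d, 0 < d /\ forall t, a <= t <= b -> d <= Cmod (f t - z).
Proof.
  intros Hc Hz.
  destruct (Ccont_bounded (fun t => / (f t - z))%C a b) as (M & PM & HM).
  - intros t Ht. apply cont_inv; [|apply Cminus_eq_contra; auto].
    apply cont_minus; [auto | apply continuous_const].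
  - exists (/ M)%R. split; [now apply Rinv_0_lt_compat|].
    intros t Ht. assert (A := HM t Ht).
    assert (N : (f t - z)%C <> 0) by (apply Cminus_eq_contra; auto).
    rewrite Cmod_inv in A by auto. apply Cmod_gt_0 in N.
    rewrite <- (Rinv_inv (Cmod (f t - z))). apply Rinv_le_contravar; [|auto].
    now apply Rinv_0_lt_compat.
Qed.

(** The quadratic error bound is uniform in t, so it survives integration over [0, 1] with the same
    constant. *)
Lemma Hol_param (K K' : R -> C -> C) (z : C) (r M : R) : 0 < r -> 0 <= M ->
  (forall t w, 0 <= t <= 1 -> Cmod (w - z) < r ->
     Ccont (fun s => K s w) t /\ Ccont (fun s => K' s w) t) ->
  (forall t w w', 0 <= t <= 1 -> Cmod (w - z) < r -> Cmod (w' - z) < r ->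
     Cmod (K t w' - K t w - K' t w * (w' - w)) <= M * Cmod (w' - w) ^ 2) ->
  Hol (fun w => Cint (fun t => K t w) 0 1) (fun w => Cint (fun t => K' t w) 0 1) z.
Proof.
  intros Pr PM Hc HK. exists r, M. repeat split; auto.
  assert (I : forall w, Cmod (w - z) < r -> @ex_RInt C_R_NormedModule (fun t => K t w) 0 1).
  { intros w Hw. apply ex_Cint_le; [lra|].
    intros t Ht. exact (proj1 (Hc t w Ht Hw)). }
  assert (I' : forall w, Cmod (w - z) < r -> @ex_RInt C_R_NormedModule (fun t => K' t w) 0 1).
  { intros w Hw. apply ex_Cint_le; [lra|].
    intros t Ht. exact (proj2 (Hc t w Ht Hw)). }
  intros w w' Hw Hw'.
  set (h := (w' - w)%C).
  replace (Cint (fun t => K t w') 0 1 - Cint (fun t => K t w) 0 1 -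
     Cint (fun t => K' t w) 0 1 * h)%C with
     (Cint (fun t => K t w' - K t w - h * K' t w)%C 0 1).
  - replace (M * Cmod h ^ 2)%R with ((1 - 0) * (M * Cmod h ^ 2))%R by ring.
    apply Cint_bound; [lra| |].
    + apply ex_Cint_le; [lra|]. intros t Ht.
      apply cont_minus; [apply cont_minus|].
      * exact (proj1 (Hc t w' Ht Hw')).
      * exact (proj1 (Hc t w Ht Hw)).
      * apply cont_mult; [apply continuous_const | exact (proj2 (Hc t w Ht Hw))].
    + intros t Ht. rewrite (Cmult_comm h). apply HK; auto.
  - rewrite Cint_minus, Cint_minus, Cint_mult; auto; [Ceq; ring| |].
    + apply (ex_RInt_minus (V := C_R_NormedModule)); auto.
    + destruct (I' w Hw) as [l Hl]. exists (h * l)%C. now apply is_Cint_mult.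
Qed.

Definition cauchy_int (g phi : R -> C) (k : nat) (w : C) : C :=
  Cint (fun t => phi t / (g t - w) ^ k)%C 0 1.

(** Applied with a = 1 / (g t - w'), b = 1 / (g t - w) and h = w' - w, for which a - b = a b h. Thus
    1 / (g t - w)^k has w-derivative k / (g t - w)^(k+1) with a quadratic error that depends only on
    the bound d for |a| and |b|. *)
Lemma pow_kernel_estimate k d : 0 < d -> exists M, 0 <= M /\ forall a b h : C,
  Cmod a <= d -> Cmod b <= d -> (a - b)%C = (a * b * h)%C ->
  Cmod (a ^ k - b ^ k - RtoC (INR k) * b ^ S k * h) <= M * Cmod h ^ 2.
Proof.
  intros Pd. induction k as [|k (M & PM & IH)].
  - exists 0. split; [lra|]. intros a b h _ _ _. simpl.
    replace (1 - 1 - 0 * (b * 1) * h)%C with (RtoC 0) by ring. rewrite Cmod_0. lra.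
  - exists (d * M + (INR k + 1) * d ^ S (S (S k)))%R. assert (Pk := pos_INR k).
    assert (Pp : 0 <= d ^ S (S (S k))) by (apply pow_le; lra).
    split; [apply Rplus_le_le_0_compat; apply Rmult_le_pos; lra|]. intros a b h Ha Hb E.
    replace (a ^ S k - b ^ S k - RtoC (INR (S k)) * b ^ S (S k) * h)%C with
      (a * (a ^ k - b ^ k - RtoC (INR k) * b ^ S k * h)
       + (RtoC (INR k + 1) * (a * b ^ S (S k))) * (h * h))%C.
    + eapply Rle_trans; [apply Cmod_triangle|].
      rewrite Cmod_mult, (Cmod_mult _ (h * h)), (Cmod_mult h), Rmult_plus_distr_r, Rmult_assoc.
      replace (Cmod h * Cmod h)%R with (Cmod h ^ 2)%R by ring.
      assert (Q := pow2_ge_0 (Cmod h)). apply Rplus_le_compat.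
      * apply Rmult_le_compat; auto using Cmod_ge_0.
      * apply Rmult_le_compat_r; [exact Q|].
        rewrite !Cmod_mult, Cmod_R, Cmod_pow, (Rabs_pos_eq (INR k + 1)) by lra.
        apply Rmult_le_compat_l; [lra|]. change (d ^ S (S (S k))) with (d * d ^ S (S k)).
        apply Rmult_le_compat; auto using Cmod_ge_0; [apply pow_le, Cmod_ge_0|].
        apply pow_incr. split; [apply Cmod_ge_0|exact Hb].
    (* The third summand vanishes by [E]; once it is added, the remaining equality is a polynomial
       identity. *)
    + transitivity (a * (a ^ k - b ^ k - RtoC (INR k) * b ^ S k * h)
        + (RtoC (INR k + 1) * (a * b ^ S (S k))) * (h * h)
        + (b ^ k + RtoC (INR k + 1) * b ^ S k * h) * ((a - b) - a * b * h))%C;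
        [rewrite E; ring|]. rewrite S_INR, RtoC_plus. simpl Cpow. ring.
Qed.

Section CauchyType.
Variables (g phi : R -> C) (z : C).
Hypothesis Hg : forall t, 0 <= t <= 1 -> Ccont g t.
Hypothesis Hphi : forall t, 0 <= t <= 1 -> Ccont phi t.
Hypothesis Hz : forall t, 0 <= t <= 1 -> g t <> z.

Lemma cauchy_int_data : exists d B, 0 < d /\ 0 < B /\ (forall t, 0 <= t <= 1 -> Cmod (phi t) <= B) /\
  forall t w, 0 <= t <= 1 -> Cmod (w - z) < d -> d <= Cmod (g t - w).
Proof.
  destruct (Ccont_away g 0 1 z Hg Hz) as (d & Pd & D).
  destruct (Ccont_bounded phi 0 1 Hphi) as (B & PB & HB).
  exists (d / 2)%R, B. repeat split; auto; [lra|].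
  intros t w Ht Hw. assert (A := D t Ht). assert (T := Cmod_sub_triangle (g t) w z). lra.
Qed.

Lemma cauchy_int_Hol_pow k :
  Hol (cauchy_int g phi k) (fun w => RtoC (INR k) * cauchy_int g phi (S k) w)%C z.
Proof.
  destruct cauchy_int_data as (d & B & Pd & PB & HB & HD).
  destruct (pow_kernel_estimate k (/ d)) as (M & PM & HM); [now apply Rinv_0_lt_compat|].
  assert (Ker : forall j t w, 0 <= t <= 1 -> Cmod (w - z) < d -> Ccont (fun s => phi s / (g s - w) ^ j)%C t).
  { intros j t w Ht Hw. apply cont_cauchy_kernel; auto. intros E.
    assert (Q := HD t w Ht Hw). rewrite E, Cmod_center in Q. lra. }
  apply (Hol_ext (cauchy_int g phi k) (fun w => Cint (fun t => RtoC (INR k) * (phi t / (g t - w) ^ S k))%C 0 1)).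
  { exists d; split; [auto|]. intros w Hw; split; [auto|]. apply Cint_mult.
    apply ex_Cint_le; [lra|]. intros t Ht. auto. }
  apply (Hol_param (fun t w => phi t / (g t - w) ^ k)%C (fun t w => RtoC (INR k) * (phi t / (g t - w) ^ S k))%C z d
     (B * M) Pd).
  - apply Rmult_le_pos; lra.
  - intros t w Ht Hw. split; [auto|]. apply cont_mult; [apply continuous_const|auto].
  - intros t w w' Ht Hw Hw'.
    assert (Q := HD t w Ht Hw). assert (Q' := HD t w' Ht Hw').
    assert (N : (g t - w)%C <> 0) by (apply Cmod_gt_0; lra).
    assert (N' : (g t - w')%C <> 0) by (apply Cmod_gt_0; lra).
    replace (phi t / (g t - w') ^ k - phi t / (g t - w) ^ k - RtoC (INR k) * (phi t / (g t - w) ^ S k) * (w' - w))%C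
      with (phi t * ((/ (g t - w')) ^ k - (/ (g t - w)) ^ k - RtoC (INR k) * (/ (g t - w)) ^ S k * (w' - w)))%C
      by (rewrite !Cpow_inv by auto; unfold Cdiv; ring).
    rewrite Cmod_mult, Rmult_assoc. apply Rmult_le_compat; auto using Cmod_ge_0.
    apply HM; [rewrite Cmod_inv by auto; apply Rinv_le_contravar; lra ..|field; auto].
Qed.

Lemma cauchy_int_Hol : Hol (cauchy_int g phi 1) (cauchy_int g phi 2) z.
Proof.
  apply (Hol_ext (cauchy_int g phi 1) (fun w => RtoC (INR 1) * cauchy_int g phi 2 w)%C); [|apply cauchy_int_Hol_pow].
  apply near_all. intros w. split; [reflexivity|]. simpl. ring.
Qed.
End CauchyType.

Record closed_path (g g' : R -> C) : Prop := {
  cp_der : forall t, 0 <= t <= 1 -> Cder g t (g' t);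
  cp_cont : forall t, 0 <= t <= 1 -> Ccont g' t;
  cp_closed : g 0 = g 1 }.

Definition off (g : R -> C) (w : C) : Prop := forall t, 0 <= t <= 1 -> g t <> w.

(* Not normalised: [wind g g' w] is 2 pi i times the winding number. *)
Definition wind (g g' : R -> C) (w : C) : C := cauchy_int g g' 1 w.

Section Winding.
Variables g g' : R -> C.
Hypothesis Hg : closed_path g g'.

Lemma cp_gcont t : 0 <= t <= 1 -> Ccont g t.
Proof. intros Ht; eapply Cder_cont, (cp_der _ _ Hg); auto. Qed.

Lemma path_exact (F F' : C -> C) : (forall t, 0 <= t <= 1 -> is_Cderive F (g t) (F' (g t))) ->
  (forall t, 0 <= t <= 1 -> Ccont (fun s => F' (g s)) t) ->
  Cint (fun t => F' (g t) * g' t)%C 0 1 = RtoC 0.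
Proof.
  intros H Hc. rewrite (Cint_der (fun t => F (g t))).
  - rewrite (cp_closed _ _ Hg). Ceq; ring.
  - lra.
  - intros t Ht. eapply Cderive_curve; [apply H; auto|auto|]. now apply (cp_der _ _ Hg).
  - intros t Ht. apply cont_mult; [auto|now apply (cp_cont _ _ Hg)].
Qed.

(** On the curve g' / (g - w)^2 is the derivative of -1 / (g - w), and the curve is closed. The
    integral is the w-derivative of [wind], which is therefore locally constant. *)
Lemma wind_der_0 w : off g w -> cauchy_int g g' 2 w = 0.
Proof.
  intros Hw. unfold cauchy_int.
  rewrite <- (path_exact (fun x => - / (x - w))%C (fun x => / (x - w) ^ 2)%C).
  - apply Cint_ext; [lra|]. intros t Ht. unfold Cdiv. Ceq; ring.
  - intros t Ht. assert (N : (g t - w)%C <> 0) by (apply Cminus_eq_contra; auto).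
    assert (H : Hol (fun x => (-1)%R * / (x - w))%C (fun x => (0 * / (x - w)) + (-1)%R * (- (1 + 0) / ((x - w) * (x - w))))%C (g t)).
    { apply (Hol_mult (fun _ => RtoC (-1)) (fun _ => RtoC 0) (fun x => / (x - w))%C
        (fun x => (- (1 + 0) / ((x - w) * (x - w))))%C); [apply Hol_const|].
      apply (Hol_inv (fun x => x - w)%C (fun _ => 1 + 0)%C); auto.
      apply (Hol_plus (fun x => x) (fun _ => RtoC 1) (fun _ => - w)%C (fun _ => RtoC 0));
        [apply Hol_id | apply Hol_const]. }
    apply Hol_Cderive in H. cbv beta in H.
    replace (/ (g t - w) ^ 2)%C with (0 * / (g t - w) + (-1)%R * (- (1 + 0) / ((g t - w) * (g t - w))))%C
      by (simpl; field; auto).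
    eapply Cderive_ext; [|exact H]. exists 1; split; [lra|]. intros v _. cbv beta. ring.
  - intros t Ht. apply cont_inv.
    + simpl. assert (Hc : Ccont (fun s => g s - w)%C t)
        by (apply cont_minus; [now apply cp_gcont | apply continuous_const]).
      apply cont_mult; [auto|]. apply cont_mult; [auto|apply continuous_const].
    + apply Cpow_nz, Cminus_eq_contra; auto.
Qed.

Lemma wind_Cderive w : off g w -> is_Cderive (wind g g') w 0.
Proof.
  intros Hw. rewrite <- (wind_der_0 w Hw). apply (Hol_Cderive (wind g g') (cauchy_int g g' 2)).
  exact (cauchy_int_Hol g g' w cp_gcont (cp_cont _ _ Hg) Hw).
Qed.

Lemma wind_segment w1 w2 : (forall s, 0 <= s <= 1 -> off g (w1 + RtoC s * (w2 - w1))%C) ->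
  wind g g' w1 = wind g g' w2.
Proof.
  intros H.
  assert (E : wind g g' (w1 + RtoC 0 * (w2 - w1))%C = wind g g' (w1 + RtoC 1 * (w2 - w1))%C).
  { apply (eq_is_derive (V := C_R_NormedModule) (fun s => wind g g' (w1 + RtoC s * (w2 - w1))%C) 0 1); [|lra].
    intros s Hs. 
    apply (Cder_val _ _ (RtoC 0 * (w2 - w1))%C); [transitivity (RtoC 0); [Ceq; ring | reflexivity]|].
    apply (Cderive_curve (wind g g') (w1 + RtoC s * (w2 - w1))%C 0 (fun s => w1 + RtoC s * (w2 - w1))%C s (w2 - w1)%C); [apply wind_Cderive, H, Hs|reflexivity|].
    apply (Cder_val _ _ (0 + (RtoC 1 * (w2 - w1) + RtoC s * 0))%C); [ring|].
    apply Cder_plus; [apply Cder_const|]. apply Cder_mult; [|apply Cder_const].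
    apply Cder_RtoC. apply (is_derive_id (K := R_AbsRing)). }
  replace (w1 + 0 * (w2 - w1))%C with w1 in E by ring.
  replace (w1 + 1 * (w2 - w1))%C with w2 in E by ring. exact E.
Qed.
End Winding.

(** * Circles and their winding number *)

Definition circ (c : C) (r : R) (t : R) : C :=
  (c + (r * cos (2 * PI * t), r * sin (2 * PI * t))%R)%C.
Definition circ' (c : C) (r : R) (t : R) : C :=
  ((- (2 * PI * r * sin (2 * PI * t)), 2 * PI * r * cos (2 * PI * t))%R : C).

Lemma circ_mod c r t : 0 <= r -> Cmod (circ c r t - c) = r.
Proof.
  intros Hr. unfold circ.
  replace (c + (r * cos (2 * PI * t), r * sin (2 * PI * t))%R - c)%C with
    ((r * cos (2 * PI * t), r * sin (2 * PI * t))%R : C).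
  2:{ apply injective_projections; simpl; ring. }
  unfold Cmod; simpl fst; simpl snd.
  replace ((r * cos (2 * PI * t)) ^ 2 + (r * sin (2 * PI * t)) ^ 2)%R with (r ^ 2).
  - now apply sqrt_pow2.
  - assert (H := sin2_cos2 (2 * PI * t)). unfold Rsqr in H.
    replace (r ^ 2)%R with (r ^ 2 * (sin (2 * PI * t) * sin (2 * PI * t) + cos (2 * PI * t) * cos (2 * PI * t)))%R
      by (rewrite H; ring). ring.
Qed.

Lemma circ'_eq c r t : circ' c r t = (2 * PI * Ci * (circ c r t - c))%C.
Proof.
  unfold circ, circ'. apply injective_projections; simpl; ring.
Qed.

Lemma circ_ne c r w t : 0 < r -> Cmod (w - c) < r -> circ c r t <> w.
Proof. intros Hr Hw E. assert (A := circ_mod c r t ltac:(lra)). rewrite E in A. lra. Qed.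

Lemma circ_off c r w : 0 < r -> Cmod (w - c) < r -> off (circ c r) w.
Proof. intros Hr Hw t _. now apply circ_ne. Qed.

Lemma circ_Cder c r t : Cder (circ c r) t (circ' c r t).
Proof. apply Cder_pair. unfold circ, circ'; simpl. split; auto_derive; auto; ring. Qed.

Lemma circ_cont c r t : Ccont (circ c r) t.
Proof. exact (Cder_cont _ _ _ (circ_Cder c r t)). Qed.

Lemma circ'_cont c r t : Ccont (circ' c r) t.
Proof.
  apply continuous_pair. unfold circ'; simpl. split;
      apply (ex_derive_continuous (V := R_NormedModule)); auto_derive; auto.
Qed.

Lemma circ_path c r : closed_path (circ c r) (circ' c r).
Proof.
  split.
  - intros; apply circ_Cder.
  - intros; apply circ'_cont.
  - unfold circ. rewrite !Rmult_0_r, !Rmult_1_r, cos_0, sin_0, cos_2PI, sin_2PI. reflexivity.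
Qed.

(** At the centre the integrand is the constant 2 pi i, and the segment from the centre to w does
    not meet the circle. *)
Lemma circ_wind c r w : 0 < r -> Cmod (w - c) < r -> wind (circ c r) (circ' c r) w = (2 * PI * Ci)%C.
Proof.
  intros Hr Hw. rewrite <- (wind_segment _ _ (circ_path c r) c w).
  - unfold wind, cauchy_int. rewrite (Cint_ext _ (fun _ => 2 * PI * Ci)%C); [|lra|].
    + rewrite Cint_const. replace (1 - 0)%R with 1 by ring. Ceq; ring.
    + intros t Ht. rewrite circ'_eq. assert (A := circ_mod c r t ltac:(lra)).
      simpl. Ceq; field. apply Cmod_gt_0; lra.
  - intros s Hs. apply circ_off; auto.
    replace (c + s * (w - c) - c)%C with (s * (w - c))%C by ring.
    rewrite Cmod_mult, Cmod_R, Rabs_pos_eq by lra.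
    assert (Q := Cmod_ge_0 (w - c)). nra.
Qed.

(** * Cauchy's formula on a disc *)

Lemma Cint_fst f a b : @ex_RInt C_R_NormedModule f a b -> fst (Cint f a b) = RInt (fun t => fst (f t)) a b.
Proof.
  intros H. symmetry. apply is_RInt_unique.
  apply (is_RInt_fct_extend_fst (U:=R_NormedModule) (V:=R_NormedModule) f a b).
  now apply Cint_correct.
Qed.
Lemma Cint_snd f a b : @ex_RInt C_R_NormedModule f a b -> snd (Cint f a b) = RInt (fun t => snd (f t)) a b.
Proof.
  intros H. symmetry. apply is_RInt_unique.
  apply (is_RInt_fct_extend_snd (U:=R_NormedModule) (V:=R_NormedModule) f a b).
  now apply Cint_correct.
Qed.

Lemma real_param (K K' : R -> R -> R) x d : 0 < d ->
  (forall u t, Rabs (u - x) < d -> is_derive (fun u => K u t) u (K' u t)) ->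
  (forall t, 0 <= t <= 1 -> continuity_2d_pt K' x t) ->
  (forall u, Rabs (u - x) < d -> ex_RInt (fun t => K u t) 0 1) ->
  is_derive (fun u => RInt (fun t => K u t) 0 1) x (RInt (fun t => K' x t) 0 1).
Proof.
  intros Pd HK Hc HI.
  rewrite (RInt_ext (fun t => K' x t) (fun t => Derive (fun u => K u t) x)).
  - apply is_derive_RInt_param.
    + exists (mkposreal d Pd). intros u Hu t _. exists (K' u t). now apply HK.
    + rewrite Rmin_left, Rmax_right by lra. intros t Ht.
      apply (continuity_2d_pt_ext_loc K'); [|auto].
      exists (mkposreal d Pd). intros u v Hu _. symmetry. apply is_derive_unique. now apply HK.
    + exists (mkposreal d Pd). intros u Hu. now apply HI.
  - intros t _. symmetry. apply is_derive_unique. apply HK.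
    rewrite Rminus_diag, Rabs_R0; auto.
Qed.

Lemma Cder_param (K K' : R -> R -> C) x d : 0 < d ->
  (forall u t, Rabs (u - x) < d -> Cder (fun u => K u t) u (K' u t)) ->
  (forall t, 0 <= t <= 1 ->
    @continuous (prod_UniformSpace R_UniformSpace R_UniformSpace) C_UniformSpace
      (fun v => K' (fst v) (snd v)) (x, t)) ->
  (forall u t, Rabs (u - x) < d -> 0 <= t <= 1 -> Ccont (fun t => K u t) t) ->
  Cder (fun u => Cint (fun t => K u t) 0 1) x (Cint (fun t => K' x t) 0 1).
Proof.
  intros Pd HK Hc HI.
  assert (IK : forall u, Rabs (u - x) < d -> @ex_RInt C_R_NormedModule (fun t => K u t) 0 1).
  { intros u Hu. apply ex_Cint_le; [lra|]. intros t Ht; now apply HI. }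
  assert (IK' : @ex_RInt C_R_NormedModule (fun t => K' x t) 0 1).
  { apply ex_Cint_le; [lra|]. intros t Ht.
    apply (continuous_comp_2 (fun _ : R => x) (fun t : R => t) (fun a b => K' a b));
      [apply continuous_const | apply continuous_id | now apply Hc]. }
  apply Cder_pair. split.
  - rewrite Cint_fst by auto.
    apply (is_derive_ext_loc (V := R_NormedModule) (fun u => RInt (fun t => fst (K u t)) 0 1)).
    { exists (mkposreal d Pd). intros u Hu. rewrite Cint_fst; auto. }
    apply (real_param (fun u t => fst (K u t)) (fun u t => fst (K' u t)) x d Pd).
    + intros u t Hu. now apply Cder_pair, HK.
    + intros t Ht. apply continuity_2d_pt_filterlim.
      assert (A := Hc t Ht). apply continuous_pair in A. apply A.
    + intros u Hu. destruct (IK u Hu) as [l Hl]. exists (fst l).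
      now apply (is_RInt_fct_extend_fst (U:=R_NormedModule) (V:=R_NormedModule)) in Hl.
  - rewrite Cint_snd by auto.
    apply (is_derive_ext_loc (V := R_NormedModule) (fun u => RInt (fun t => snd (K u t)) 0 1)).
    { exists (mkposreal d Pd). intros u Hu. rewrite Cint_snd; auto. }
    apply (real_param (fun u t => snd (K u t)) (fun u t => snd (K' u t)) x d Pd).
    + intros u t Hu. now apply Cder_pair, HK.
    + intros t Ht. apply continuity_2d_pt_filterlim.
      assert (A := Hc t Ht). apply continuous_pair in A. apply A.
    + intros u Hu. destruct (IK u Hu) as [l Hl]. exists (snd l).
      now apply (is_RInt_fct_extend_snd (U:=R_NormedModule) (V:=R_NormedModule)) in Hl.
Qed.

Lemma two_pi_i_nz : (2 * PI * Ci)%C <> 0.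
Proof.
  repeat apply Cmult_neq_0.
  - apply RtoC_nz; lra.
  - apply RtoC_nz. assert (Q := PI_RGT_0); lra.
  - apply Ci_nz.
Qed.

Section CauchyFormula.
Variables (f f' : C -> C) (c : C) (r R0 : R) (w : C).
Hypothesis Hr : 0 < r < R0.
Hypothesis Hf : forall z, Cmod (z - c) < R0 -> is_Cderive f z (f' z).
Hypothesis Hf' : forall z, Cmod (z - c) < R0 -> @continuous C_UniformSpace C_UniformSpace f' z.
Hypothesis Hw : Cmod (w - c) < r.

Let p (s t : R) : C := (w + RtoC s * (circ c r t - w))%C.

Lemma ray_in_disc s t : 0 <= s <= 1 -> Cmod (p s t - c) <= r.
Proof using Hr Hw.
  intros Hs. unfold p.
  replace (w + s * (circ c r t - w) - c)%C with
    (RtoC (1 - s) * (w - c) + RtoC s * (circ c r t - c))%C by (rewrite RtoC_minus; ring).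
  eapply Rle_trans; [apply Cmod_triangle|]. rewrite !Cmod_mult, !Cmod_R, circ_mod by lra.
  rewrite !Rabs_pos_eq by lra. nra.
Qed.

(** Derivatives at s = 0 and s = 1 are two-sided, so s must be allowed to leave [0, 1]. A ray from w
    to the circle is at most 2 r long, so changing s by [dd] moves its point by at most R0 - r. *)
Let dd := ((R0 - r) / (2 * r))%R.

Lemma ray_in_disc_near s u t : 0 <= s <= 1 -> Rabs (u - s) < dd -> Cmod (p u t - c) < R0.
Proof using Hr Hw.
  intros Hs Hu. assert (A := ray_in_disc s t Hs).
  assert (T := Cmod_sub_triangle (p u t) (p s t) c).
  replace (p u t - p s t)%C with (RtoC (u - s) * (circ c r t - w))%C in T
    by (unfold p; rewrite RtoC_minus; ring).
  rewrite Cmod_mult, Cmod_R in T.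
  assert (B : Cmod (circ c r t - w) <= 2 * r).
  { assert (T2 := Cmod_sub_triangle (circ c r t) c w). rewrite circ_mod, (Cmod_sub_sym c w) in T2; lra. }
  assert (E : dd * (2 * r) = R0 - r) by (unfold dd; field; lra).
  assert (Q := Rabs_pos (u - s)). assert (Q2 := Cmod_ge_0 (circ c r t - w)).
  nra.
Qed.

Lemma ray_der s t : Cder (fun u => p u t) s (circ c r t - w)%C.
Proof using.
  unfold p. apply (Cder_val _ _ (0 + (RtoC 1 * (circ c r t - w) + RtoC s * 0))%C); [ring|].
  apply Cder_plus; [apply Cder_const|]. apply Cder_mult; [|apply Cder_const].
  apply Cder_RtoC. apply (is_derive_id (K := R_AbsRing)).
Qed.

Lemma ray_der_t s t : Cder (fun v => p s v) t (RtoC s * circ' c r t)%C.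
Proof using.
  unfold p. apply (Cder_val _ _ (0 + (0 * (circ c r t - w) + RtoC s * (circ' c r t - 0)))%C); [ring|].
  apply Cder_plus; [apply Cder_const|]. apply (Cder_mult (fun _ => RtoC s)); [apply Cder_const|].
  apply Cder_minus; [apply circ_Cder | apply Cder_const].
Qed.

Lemma circ_nz t : (circ c r t - w)%C <> 0.
Proof using Hr Hw.
  apply Cminus_eq_contra, circ_ne; lra.
Qed.

(* For 0 <= s <= 1 the circle contracted by s towards w stays in the disc;
   A does not depend on s, A 1 is the Cauchy integral and A 0 is f w times the
   winding number. *)
Let A (s : R) : C := Cint (fun t => f (p s t) * circ' c r t / (circ c r t - w))%C 0 1.

Lemma A_der s : 0 <= s <= 1 -> Cder A s (Cint (fun t => f' (p s t) * circ' c r t)%C 0 1).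
Proof using Hr Hf Hf' Hw.
  intros Hs. unfold A.
  assert (Pd : 0 < dd) by (unfold dd; apply Rdiv_lt_0_compat; lra).
  apply (Cder_param (fun s t => f (p s t) * circ' c r t / (circ c r t - w))%C
     (fun s t => f' (p s t) * circ' c r t)%C s dd Pd).
  - intros u t Hu.
    apply (Cder_val _ _ ((f' (p u t) * (circ c r t - w)) * (circ' c r t / (circ c r t - w)) + f (p u t) * 0)%C).
    { field. apply circ_nz. }
    apply (Cder_ext (fun u => f (p u t) * (circ' c r t / (circ c r t - w)))%C).
    { intros v. unfold Cdiv. Ceq. ring. }
    apply (Cder_mult (fun u => f (p u t))); [|apply Cder_const].
    eapply Cderive_curve; [apply Hf; exact (ray_in_disc_near s u t Hs Hu) | reflexivity | apply ray_der].
  - intros t Ht. apply cont_mult.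
    + apply (cont_comp f'); [apply Hf'; simpl; eapply Rle_lt_trans; [now apply ray_in_disc|lra]|].
      unfold p. apply cont_plus; [apply continuous_const|]. apply cont_mult.
      * apply cont_RtoC, continuous_fst.
      * apply cont_minus; [|apply continuous_const].
        apply (continuous_comp snd (circ c r)); [apply continuous_snd|].
        apply circ_cont.
    + apply (continuous_comp snd (circ' c r)); [apply continuous_snd|]. apply circ'_cont.
  - intros u t Hu Ht. apply cont_div; [|apply cont_minus; [|apply continuous_const]|apply circ_nz].
    + apply cont_mult; [|apply circ'_cont].
      assert (H1 : Cmod (p u t - c) < R0) by exact (ray_in_disc_near s u t Hs Hu).
      apply (cont_comp f); [eapply Cderive_cont, Hf; auto|].
      eapply Cder_cont, ray_der_t.
    + apply circ_cont.
Qed.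

(** s times the integrand is the t-derivative of f (p s t), which takes the same value at t = 0 and
    t = 1. For s = 0 the factor cannot be divided out, but there the integrand is f' w times the
    derivative of the circle. *)
Lemma A_der_0 s : 0 <= s <= 1 -> Cint (fun t => f' (p s t) * circ' c r t)%C 0 1 = RtoC 0.
Proof using Hr Hf Hf' Hw.
  intros Hs.
  assert (Hc : forall t, Ccont (fun t => f' (p s t) * circ' c r t)%C t).
  { intros t. apply cont_mult; [|apply circ'_cont].
    apply (cont_comp f'); [apply Hf'; eapply Rle_lt_trans; [now apply ray_in_disc|lra]|].
    eapply Cder_cont, ray_der_t. }
  destruct (Req_dec s 0) as [->|Hn].
  - rewrite (Cint_ext _ (fun t => f' w * circ' c r t)%C); [|lra|].
    + rewrite Cint_mult.
      * rewrite (Cint_der (circ c r)); [|lra|intros; apply circ_Cder|intros; apply circ'_cont].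
        rewrite (cp_closed _ _ (circ_path c r)). Ceq; ring.
      * apply ex_Cint; intros; apply circ'_cont.
    + intros t Ht. unfold p. replace (w + 0 * (circ c r t - w))%C with w by ring. reflexivity.
  - assert (E : (RtoC s * Cint (fun t => f' (p s t) * circ' c r t)%C 0 1)%C = 0).
    { rewrite <- Cint_mult by (apply ex_Cint; intros; apply Hc).
      rewrite (Cint_der (fun t => f (p s t))); [|lra| |].
      - unfold p. rewrite (cp_closed _ _ (circ_path c r)). Ceq; ring.
      - intros t Ht. apply (Cder_val _ _ (f' (p s t) * (RtoC s * circ' c r t))%C); [ring|].
        eapply Cderive_curve; [apply Hf; eapply Rle_lt_trans; [now apply ray_in_disc|lra] | reflexivity | apply ray_der_t].
      - intros t Ht. apply cont_mult; [apply continuous_const|apply Hc]. }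
    set (I := Cint _ 0 1) in *.
    destruct (Ceq_dec I 0) as [H|H]; [exact H|]. exfalso.
    revert E. apply Cmult_neq_0; [now apply RtoC_nz|exact H].
Qed.

Lemma cauchy_formula_C1_aux : cauchy_int (circ c r) (fun t => f (circ c r t) * circ' c r t)%C 1 w = (2 * PI * Ci * f w)%C.
Proof using Hr Hf Hf' Hw.
  assert (E : A 0 = A 1).
  { apply (eq_is_derive (V := C_R_NormedModule) A 0 1); [|lra]. intros s Hs.
    assert (H := A_der s Hs). rewrite (A_der_0 s Hs) in H. exact H. }
  unfold A in E. unfold cauchy_int.
  rewrite (Cint_ext _ (fun t => f (p 1 t) * circ' c r t / (circ c r t - w))%C); [|lra|].
  - rewrite <- E.
    rewrite (Cint_ext _ (fun t => f w * (circ' c r t / (circ c r t - w) ^ 1))%C); [|lra|].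
    + rewrite Cint_mult.
      * change (f w * wind (circ c r) (circ' c r) w = 2 * PI * Ci * f w)%C.
        rewrite circ_wind by lra. ring.
      * apply ex_Cint. intros t _. apply cont_cauchy_kernel; [apply circ_cont|apply circ'_cont|apply circ_ne; lra].
    + intros t Ht. unfold p. replace (w + 0 * (circ c r t - w))%C with w by ring.
      rewrite Cpow_1_r. unfold Cdiv. Ceq; ring.
  - intros t Ht. unfold p. replace (w + 1 * (circ c r t - w))%C with (circ c r t) by ring.
    rewrite Cpow_1_r. reflexivity.
Qed.
End CauchyFormula.

Section CauchyHolo.
Variables (f : C -> C) (c : C) (r R0 : R).
Hypothesis Hr : 0 < r < R0.

(** The density on the circle whose Cauchy integral is f; it includes the factor 1 / (2 pi i). *)
Definition cphi (f : C -> C) (c : C) (r : R) (t : R) : C :=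
  (f (circ c r t) * circ' c r t / (2 * PI * Ci))%C.

Lemma cphi_cont t : (forall z, Cmod (z - c) < R0 -> @continuous C_UniformSpace C_UniformSpace f z) ->
  Ccont (cphi f c r) t.
Proof using Hr.
  intros H. apply cont_div; [|apply continuous_const|apply two_pi_i_nz].
  apply cont_mult; [|apply circ'_cont]. apply (cont_comp f).
  - apply H. rewrite circ_mod; lra.
  - apply circ_cont.
Qed.

Lemma cauchy_formula_C1 (f' : C -> C) w :
  (forall z, Cmod (z - c) < R0 -> is_Cderive f z (f' z)) ->
  (forall z, Cmod (z - c) < R0 -> @continuous C_UniformSpace C_UniformSpace f' z) ->
  Cmod (w - c) < r ->
  f w = cauchy_int (circ c r) (cphi f c r) 1 w.
Proof using Hr.
  intros Hf Hf' Hw.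
  assert (E := cauchy_formula_C1_aux f f' c r R0 w Hr Hf Hf' Hw). unfold cauchy_int in *.
  rewrite (Cint_ext _ (fun t => / (2 * PI * Ci) * (f (circ c r t) * circ' c r t / (circ c r t - w) ^ 1))%C); [|lra|].
  - rewrite Cint_mult.
    + rewrite E. Ceq. field. split; [apply Ci_nz|]. apply RtoC_nz. assert (Q := PI_RGT_0); lra.
    + apply ex_Cint. intros t _. apply cont_cauchy_kernel; [apply circ_cont| |apply circ_ne; lra].
      apply cont_mult; [|apply circ'_cont]. apply (cont_comp f); [|apply circ_cont].
      eapply Cderive_cont, Hf. rewrite circ_mod; lra.
  - intros t Ht. unfold cphi, Cdiv. Ceq; ring.
Qed.

Lemma cauchy_formula w : (forall z, Cmod (z - c) < R0 -> holo f z) -> Cmod (w - c) < r ->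
  f w = cauchy_int (circ c r) (cphi f c r) 1 w.
Proof using Hr.
  intros H Hw. apply (cauchy_formula_C1 (der f)); auto.
  - intros z Hz. apply Hol_Cderive, holo_der; auto.
  - intros z Hz. eapply Hol_der_cont, holo_der; auto.
Qed.
End CauchyHolo.

(** Cauchy's formula was proved from a continuous derivative alone, and a Cauchy integral has the
    locally uniform quadratic error of [Hol]. This is the passage from C^1 data, such as the
    gradient of a harmonic function, to [holo]. *)
Lemma C1_holo (f f' : C -> C) c R0 : 0 < R0 ->
  (forall z, Cmod (z - c) < R0 -> is_Cderive f z (f' z)) ->
  (forall z, Cmod (z - c) < R0 -> @continuous C_UniformSpace C_UniformSpace f' z) ->
  holo f c.
Proof.
  intros PR Hf Hf'. set (r := (R0 / 2)%R). assert (Hr : 0 < r < R0) by (unfold r; lra).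
  apply (holo_ext (cauchy_int (circ c r) (cphi f c r) 1)).
  - exists r; split; [lra|]. intros w Hw. symmetry. eapply cauchy_formula_C1; eauto.
  - eexists. apply cauchy_int_Hol.
    + intros; apply circ_cont.
    + intros t _. apply (cphi_cont f c r R0 Hr). intros z Hz. eapply Cderive_cont, Hf; auto.
    + apply circ_off; [lra|]. rewrite Cmod_center; lra.
Qed.

Lemma holo_near f z : holo f z -> near z (fun w => holo f w).
Proof.
  intros [f' H]. destruct (Hol_local _ _ _ H) as (d & Pd & D).
  exists d; split; [auto|]. intros w Hw. exists f'; auto.
Qed.

Lemma holo_cauchy_int f c : holo f c -> exists r, 0 < r /\
  (forall t, Ccont (cphi f c r) t) /\ (forall w, Cmod (w - c) < 2 * r -> holo f w) /\
  (forall w, Cmod (w - c) < r -> f w = cauchy_int (circ c r) (cphi f c r) 1 w) /\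
  (forall w, Cmod (w - c) < r -> der f w = cauchy_int (circ c r) (cphi f c r) 2 w).
Proof.
  intros H. destruct (holo_near _ _ H) as (R0 & PR & HR).
  set (r := (R0 / 2)%R). assert (Hr : 0 < r < R0) by (unfold r; lra).
  assert (Hc : forall t, Ccont (cphi f c r) t).
  { intros t. apply (cphi_cont f c r R0 Hr). intros z Hz. apply holo_cont; auto. }
  assert (E : forall w, Cmod (w - c) < r -> f w = cauchy_int (circ c r) (cphi f c r) 1 w).
  { intros w Hw. eapply cauchy_formula; eauto. }
  exists r. split; [lra|]. split; [exact Hc|]. split; [|split; [exact E|]].
  - intros w Hw. apply HR. unfold r in Hw. lra.
  - intros w Hw.
    apply Cderive_der. eapply Cderive_ext; [|eapply Hol_Cderive, cauchy_int_Hol].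
    + exists (r - Cmod (w - c))%R. split; [lra|]. intros v Hv. symmetry. apply E.
      assert (T := Cmod_sub_triangle v w c). lra.
    + intros; apply circ_cont.
    + auto.
    + apply circ_off; lra.
Qed.

(** The derivative is again a Cauchy integral, with exponent 2, and such integrals are
    differentiable for every exponent. *)
Lemma holo_derivative f z : holo f z -> holo (der f) z.
Proof.
  intros H. destruct (holo_cauchy_int f z H) as (r & Pr & Hc & _ & _ & E).
  apply (holo_ext (cauchy_int (circ z r) (cphi f z r) 2)).
  - exists r; split; [auto|]. intros w Hw. symmetry; auto.
  - eexists. apply cauchy_int_Hol_pow; auto.
    + intros; apply circ_cont.
    + apply circ_off; [lra|]. rewrite Cmod_center; lra.
Qed.

(** Removable singularity. Since f a = 0, subtracting Cauchy's formulas at w and at a, with 1 / (c -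
    w) - 1 / (c - a) = (w - a) / ((c - w) (c - a)) for c on the circle, exhibits the quotient near a
    as the Cauchy integral [psi]. Away from a it is an ordinary division. *)
Lemma holo_divide f a : holo f a -> f a = 0 ->
  exists f1, (forall z, holo f z -> holo f1 z) /\ f1 a = der f a /\ forall z, f z = ((z - a) * f1 z)%C.
Proof.
  intros H Ha. destruct (holo_cauchy_int f a H) as (r & Pr & Hc & Hh & E & E').
  set (psi := cauchy_int (circ a r) (fun t => cphi f a r t / (circ a r t - a))%C 1).
  assert (Na : forall t, (circ a r t - a)%C <> 0).
  { intros t. apply Cmod_gt_0. rewrite circ_mod; lra. }
  assert (Hpc : forall t, Ccont (fun t => cphi f a r t / (circ a r t - a))%C t).
  { intros t. apply cont_div; auto. apply cont_minus; [apply circ_cont|apply continuous_const]. }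
  assert (Hpsi : forall w, Cmod (w - a) < r -> f w = ((w - a) * psi w)%C).
  { intros w Hw. replace (f w) with (f w - f a)%C by (rewrite Ha; ring).
    assert (Nw : forall t, (circ a r t - w)%C <> 0) by (intros t; now apply Cminus_eq_contra, circ_ne).
    assert (IC : forall (v : C) ph, Cmod (v - a) < r -> (forall t, Ccont ph t) ->
      @ex_RInt C_R_NormedModule (fun t => ph t / (circ a r t - v) ^ 1)%C 0 1).
    { intros v ph Hv Hph. apply ex_Cint. intros t _.
      apply cont_cauchy_kernel; [apply circ_cont|apply Hph|now apply circ_ne]. }
    assert (Haa : Cmod (a - a) < r) by (rewrite Cmod_center; lra).
    rewrite (E w Hw), (E a) by (rewrite Cmod_center; lra). unfold psi, cauchy_int.
    rewrite <- Cint_mult, <- Cint_minus; auto.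
    apply Cint_ext; [lra|]. intros t Ht. Ceq. simpl. field. auto. }
  exists (fun z => if Ceq_dec z a then psi a else f z / (z - a))%C.
  assert (Ez : forall z, f z = ((z - a) * (if Ceq_dec z a then psi a else f z / (z - a)))%C).
  { intros z. destruct (Ceq_dec z a) as [->|N].
    - rewrite Ha. ring.
    - field. now apply Cminus_eq_contra. }
  assert (Hhp : Hol psi (cauchy_int (circ a r) (fun t => cphi f a r t / (circ a r t - a))%C 2) a).
  { apply cauchy_int_Hol; auto.
    + intros; apply circ_cont.
    + apply circ_off; [lra|]. rewrite Cmod_center; lra. }
  split; [|split; [|exact Ez]].
  - intros z Hz. destruct (Ceq_dec z a) as [->|N].
    + apply (holo_ext psi); [|eexists; exact Hhp].
      exists r; split; [auto|]. intros w Hw. destruct (Ceq_dec w a) as [->|N]; [auto|].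
      rewrite (Hpsi w Hw). field. now apply Cminus_eq_contra.
    + apply (holo_ext (fun z => f z / (z - a))%C).
      * assert (P := proj1 (Cmod_gt_0 _) (Cminus_eq_contra _ _ N)).
        exists (Cmod (z - a)); split; [auto|]. intros w Hw. destruct (Ceq_dec w a) as [->|N']; [|auto].
        rewrite Cmod_sub_sym in Hw. lra.
      * apply holo_div; auto.
        -- apply holo_minus; [apply holo_id|apply holo_const].
        -- now apply Cminus_eq_contra.
  - destruct (Ceq_dec a a) as [_|N]; [|congruence].
    symmetry. apply Cderive_der. eapply Cderive_ext; [exists r; split; [exact Pr|]; intros w Hw; symmetry; apply Hpsi; auto|].
    assert (K := Hol_mult (fun w => w - a)%C (fun _ => 1 + 0)%C psi _ a
      (Hol_plus (fun x => x) (fun _ => RtoC 1) (fun _ => - a)%C (fun _ => RtoC 0) a (Hol_id a) (Hol_const _ a)) Hhp).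
    apply Hol_Cderive in K. cbv beta in K.
    replace (psi a) with ((1 + 0) * psi a +
      (a - a) * cauchy_int (circ a r) (fun t => cphi f a r t / (circ a r t - a)) 2 a)%C by ring.
    exact K.
Qed.

Lemma cphi_bound f c r B t : 0 < r -> Cmod (f (circ c r t)) <= B ->
  Cmod (cphi f c r t) <= r * B.
Proof.
  intros Hr HB. unfold cphi. rewrite circ'_eq.
  replace (f (circ c r t) * (2 * PI * Ci * (circ c r t - c)) / (2 * PI * Ci))%C with
    ((circ c r t - c) * f (circ c r t))%C.
  - rewrite Cmod_mult, circ_mod by lra. apply Rmult_le_compat_l; [lra|exact HB].
  - field. split; [apply Ci_nz|]. apply RtoC_nz. assert (Q := PI_RGT_0); lra.
Qed.

(** A maximum principle read off from Cauchy's formula. The loss r / (r - |w - c|) comes from the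
    distance of w to the circle; it is 1 at the centre and bounded on smaller concentric discs. *)
Lemma disc_bound f c r R0 B w : 0 < r < R0 -> (forall z, Cmod (z - c) < R0 -> holo f z) ->
  (forall t, 0 <= t <= 1 -> Cmod (f (circ c r t)) <= B) -> Cmod (w - c) < r ->
  Cmod (f w) <= r / (r - Cmod (w - c)) * B.
Proof.
  intros Hr Hf HB Hw.
  rewrite (cauchy_formula f c r R0 Hr w Hf Hw). unfold cauchy_int.
  replace (r / (r - Cmod (w - c)) * B)%R with ((1 - 0) * (r / (r - Cmod (w - c)) * B))%R by ring.
  assert (Nw : forall t, r - Cmod (w - c) <= Cmod (circ c r t - w)).
  { intros t. assert (T := Cmod_sub_triangle (circ c r t) w c). rewrite circ_mod in T; lra. }
  apply Cint_bound; [lra| |].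
  - apply ex_Cint. intros t _. apply cont_cauchy_kernel; [apply circ_cont| |apply circ_ne; lra].
    apply (cphi_cont f c r R0 Hr). intros z Hz. apply holo_cont; auto.
  - intros t Ht. assert (Q := Nw t). rewrite Cpow_1_r.
    rewrite Cmod_div by (apply Cmod_gt_0; lra).
    replace (r / (r - Cmod (w - c)) * B)%R with ((r * B) / (r - Cmod (w - c)))%R by (field; lra).
    assert (K := cphi_bound f c r B t ltac:(lra) (HB t Ht)).
    apply Rmult_le_compat; auto using Cmod_ge_0.
    + left; apply Rinv_0_lt_compat; lra.
    + apply Rinv_le_contravar; lra.
Qed.

(** On a large circle around w the bound K / |z| is small, and [disc_bound] loses nothing at the
    centre. *)
Lemma liouville (h : C -> C) K M : (forall z, holo h z) -> 
  (forall z, M < Cmod z -> Cmod (h z) <= K / Cmod z) -> forall w, h w = 0.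
Proof.
  intros Hh HK w. apply Cmod_eq_0. apply Rle_antisym; [|apply Cmod_ge_0].
  apply Rnot_lt_le. intros Hlt.
  (* Points of the circle have modulus at least r - |w|, which exceeds both |M| and |K| / |h w|; the
     latter contradicts |h w| <= |K| / (r - |w|). *)
  set (r := (Cmod w + Rabs M + Rabs K / Cmod (h w) + 1)%R).
  assert (Q1 := Cmod_ge_0 w). assert (Q2 := Rabs_pos M). assert (Q3 := Rabs_pos K).
  assert (Q4 := Rle_abs M). assert (Q5 := Rle_abs K).
  assert (Q6 : 0 <= Rabs K / Cmod (h w)).
  { apply Rmult_le_pos; [lra|]. left; now apply Rinv_0_lt_compat. }
  assert (Pr : 0 < r) by (unfold r; lra).
  set (d := (r - Cmod w)%R). assert (Pd : 0 < d) by (unfold d, r; lra).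
  assert (B := disc_bound h w r (r + 1) (Rabs K / d) w ltac:(lra) (fun z _ => Hh z)).
  assert (Hc : Cmod (h w) <= r / (r - Cmod (w - w)) * (Rabs K / d)).
  { apply B; [|rewrite Cmod_center; lra].
    intros t Ht. assert (Hz := circ_mod w r t ltac:(lra)). set (z := circ w r t) in *.
    assert (T2 := Cmod_sub_ge (z - w) (- w)).
    replace (z - w - - w)%C with z in T2 by ring. rewrite Cmod_opp, Hz in T2.
    fold d in T2.
    eapply Rle_trans; [apply HK; unfold d, r in T2; lra|].
    apply Rle_trans with (Rabs K / Cmod z)%R.
    - apply Rmult_le_compat_r; [left; apply Rinv_0_lt_compat; lra|lra].
    - apply Rmult_le_compat_l; [lra|]. apply Rinv_le_contravar; lra. }
  rewrite Cmod_center, Rminus_0_r in Hc.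
  replace (r / r * (Rabs K / d))%R with (Rabs K / d)%R in Hc by (field; lra).
  assert (Hd : Rabs K / Cmod (h w) < d) by (unfold d, r; lra).
  apply (Rmult_lt_compat_r (Cmod (h w))) in Hd; [|auto].
  replace (Rabs K / Cmod (h w) * Cmod (h w))%R with (Rabs K) in Hd by (field; lra).
  apply (Rmult_le_compat_r d) in Hc; [|lra].
  replace (Rabs K / d * d)%R with (Rabs K) in Hc by (field; lra). lra.
Qed.

(** * Cauchy's theorem *)

Fixpoint csum (F : nat -> C) (m : nat) : C :=
  match m with O => RtoC 0 | S m' => (csum F m' + F m)%C end.

Lemma csum_ext F G m : (forall k, (1 <= k <= m)%nat -> F k = G k) -> csum F m = csum G m.
Proof.
  induction m; intros H; [reflexivity|]. simpl. rewrite IHm, (H (S m)); auto; try lia.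
  intros; apply H; lia.
Qed.
Lemma csum_plus F G m : csum (fun k => F k + G k)%C m = (csum F m + csum G m)%C.
Proof. induction m; simpl; [ring|]. rewrite IHm. ring. Qed.
Lemma csum_minus F G m : csum (fun k => F k - G k)%C m = (csum F m - csum G m)%C.
Proof. induction m; simpl; [ring|]. rewrite IHm. ring. Qed.
Lemma csum_mult c F m : csum (fun k => c * F k)%C m = (c * csum F m)%C.
Proof. induction m; simpl; [ring|]. rewrite IHm. ring. Qed.
Lemma csum_0 m : csum (fun k => RtoC 0) m = 0.
Proof. induction m; simpl; [ring|]. rewrite IHm. ring. Qed.
Lemma csum_holo (F : nat -> C -> C) m z : (forall k, (1 <= k <= m)%nat -> holo (F k) z) ->
  holo (fun w => csum (fun k => F k w) m) z.
Proof.
  induction m; intros H; simpl; [apply holo_const|].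
  apply holo_plus; [apply IHm; intros; apply H; lia | apply H; lia].
Qed.

Lemma csum_single (F : nat -> C) (m k0 : nat) : (1 <= k0 <= m)%nat ->
  (forall k, (1 <= k <= m)%nat -> k <> k0 -> F k = 0) -> csum F m = F k0.
Proof.
  induction m; intros Hk H; [lia|]. simpl. destruct (Nat.eq_dec (S m) k0) as [<-|N].
  - rewrite (csum_ext F (fun _ => RtoC 0)), csum_0; [ring|]. intros k Hk'. apply H; lia.
  - rewrite IHm, (H (S m)); [ring|lia|exact N|lia|]. intros k Hk' Nk. apply H; [lia|exact Nk].
Qed.

Lemma closed_bound (F : C -> C) z0 B : @continuous C_UniformSpace C_UniformSpace F z0 ->
  (exists d, 0 < d /\ forall z, z <> z0 -> Cmod (z - z0) < d -> Cmod (F z) <= B) -> Cmod (F z0) <= B.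
Proof.
  intros Hc (d & Pd & D). apply Rnot_lt_le. intros Hlt.
  apply continuous_Cmod with (e := (Cmod (F z0) - B)%R) in Hc; [|lra].
  apply locally_Cmod in Hc. destruct Hc as (d' & Pd' & D').
  set (e := (Rmin d d' / 2)%R).
  assert (Pe : 0 < e) by (unfold e; assert (0 < Rmin d d') by (now apply Rmin_pos); lra).
  assert (e < d) by (unfold e in *; assert (Q := Rmin_l d d'); lra).
  assert (e < d') by (unfold e in *; assert (Q := Rmin_r d d'); lra).
  assert (E : Cmod (z0 + RtoC e - z0) = e).
  { replace (z0 + e - z0)%C with (RtoC e) by ring. rewrite Cmod_R, Rabs_pos_eq; lra. }
  assert (A : Cmod (F (z0 + RtoC e)%C) <= B).
  { apply D; [|lra]. intros E0. rewrite E0, Cmod_center in E. lra. }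
  assert (A' := D' (z0 + RtoC e)%C ltac:(lra)).
  assert (T := Cmod_sub_ge (F z0) (F (z0 + RtoC e)%C)). rewrite Cmod_sub_sym in T. lra.
Qed.

(* [diff_quot f w] is the difference quotient z |-> (f z - f w) / (z - w), with the
   derivative as its value at w. *)
Definition diff_quot_spec (f : C -> C) (w : C) (q : C -> C) : Prop :=
  (forall z, holo f z -> holo q z) /\ q w = der f w /\ forall z, (f z - f w = (z - w) * q z)%C.

Definition diff_quot (f : C -> C) (w : C) : C -> C := epsilon (inhabits (fun _ => RtoC 0)) (diff_quot_spec f w).

Lemma der_ext f g z : near z (fun w => f w = g w) ->
  holo f z -> der f z = der g z.
Proof.
  intros E H. symmetry. apply Cderive_der. eapply Cderive_ext; [exact E|]. apply Hol_Cderive, holo_der, H.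
Qed.

Lemma diff_quot_correct f w : holo f w -> diff_quot_spec f w (diff_quot f w).
Proof.
  intros H. unfold diff_quot. apply epsilon_spec.
  assert (H' := Hol_plus f (der f) (fun _ => - f w)%C (fun _ => RtoC 0) w (holo_der _ _ H) (Hol_const _ w)).
  destruct (holo_divide (fun z => f z + - f w)%C w) as (q & Q1 & Q2 & Q3).
  - eexists; exact H'.
  - ring.
  - exists q. repeat split.
    + intros z Hz. apply Q1. apply holo_plus; [auto|apply holo_const].
    + rewrite Q2. apply Hol_der in H'. rewrite H'. ring.
    + intros z. exact (Q3 z).
Qed.

(** This is also the derivative of [diff_quot f w z] in w: differentiating (f z - f w) / (z - w)
    gives ((f z - f w) / (z - w) - f' w) / (z - w). *)
Definition diff_quot2 (f : C -> C) (w : C) : C -> C := diff_quot (diff_quot f w) w.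

Lemma diff_quot2_correct f w : holo f w ->
  (forall z, holo f z -> holo (diff_quot2 f w) z) /\
  forall z, (diff_quot f w z - der f w = (z - w) * diff_quot2 f w z)%C.
Proof.
  intros H. destruct (diff_quot_correct f w H) as (A1 & A2 & A3).
  destruct (diff_quot_correct (diff_quot f w) w (A1 w H)) as (B1 & B2 & B3).
  split; [auto|]. intros z. rewrite <- B3, A2. reflexivity.
Qed.

Lemma diff_quot_far f w0 (B r1 : R) : holo f w0 -> 0 < r1 -> exists r M, 0 < r /\ 0 <= M /\
  forall z w w', Cmod (f z) <= B -> r1 <= Cmod (z - w0) -> Cmod (w - w0) < r -> Cmod (w' - w0) < r ->
  Cmod (diff_quot f w' z - diff_quot f w z - diff_quot2 f w z * (w' - w)) <= M * Cmod (w' - w) ^ 2.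
Proof.
  intros H Pr1. destruct (Hol_nice _ _ _ (holo_der _ _ H)) as (r0 & M & Pr0 & PM & HB & HL).
  destruct (holo_near _ _ H) as (r2 & Pr2 & Hh).
  set (d := (r1 / 2)%R). assert (Pd : 0 < d) by (unfold d; lra).
  set (r := Rmin (Rmin r0 r2) d).
  set (L := ((Rabs B + M) / d / d + M / d)%R).
  exists r, ((L + M) / d)%R. split; [unfold r; repeat apply Rmin_pos; auto|].
  assert (PL : 0 <= L).
  { unfold L. assert (Q := Rabs_pos B). assert (0 < / d) by now apply Rinv_0_lt_compat.
    unfold Rdiv. apply Rplus_le_le_0_compat; repeat apply Rmult_le_pos; lra. }
  split.
  { apply Rmult_le_pos; [lra|]. left; now apply Rinv_0_lt_compat. }
  intros z w w' HfB Hz Hw Hw'.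
  assert (R1 : r <= r0) by (unfold r; eapply Rle_trans; [apply Rmin_l|apply Rmin_l]).
  assert (R2 : r <= r2) by (unfold r; eapply Rle_trans; [apply Rmin_l|apply Rmin_r]).
  assert (R3 : r <= d) by (unfold r; apply Rmin_r).
  destruct (diff_quot_correct f w) as (_ & _ & D1); [apply Hh; lra|].
  destruct (diff_quot_correct f w') as (_ & _ & D1'); [apply Hh; lra|].
  destruct (diff_quot2_correct f w) as (_ & D2); [apply Hh; lra|].
  assert (Dw : d <= Cmod (z - w)).
  { assert (T := Cmod_sub_triangle z w w0). unfold d in *; lra. }
  assert (Dw' : d <= Cmod (z - w')).
  { assert (T := Cmod_sub_triangle z w' w0). unfold d in *; lra. }
  destruct (HL w w' ltac:(lra) ltac:(lra)) as (_ & _ & He).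
  destruct (HB w ltac:(lra)) as [B1 B2].
  set (h := (w' - w)%C) in *. set (e := (f w' - f w - der f w * h)%C) in *.
  set (E := (diff_quot f w' z - diff_quot f w z - diff_quot2 f w z * h)%C).
  assert (Nw : (z - w)%C <> 0) by (apply Cmod_gt_0; lra).
  assert (Nw' : (z - w')%C <> 0) by (apply Cmod_gt_0; lra).
  assert (X1 : diff_quot f w z = ((f z - f w) / (z - w))%C) by (rewrite D1; field; auto).
  assert (X1' : diff_quot f w' z = ((f z - f w') / (z - w'))%C) by (rewrite D1'; field; auto).
  assert (X2 : diff_quot2 f w z = ((f z - f w) / (z - w) / (z - w) - der f w / (z - w))%C).
  { replace (diff_quot2 f w z) with ((diff_quot f w z - der f w) / (z - w))%C by (rewrite D2; field; auto).
    rewrite X1. field. auto. }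
  (* The denominator is at least d in modulus, so the error is controlled by h^2 times a bounded
     function and by e, the quadratic error of f at w. *)
  assert (Id : E = ((h ^ 2 * diff_quot2 f w z - e) / (z - w'))%C).
  { unfold E, e. rewrite X1, X1', X2. unfold h. simpl. field. auto. }
  assert (BL : Cmod (diff_quot2 f w z) <= L).
  { rewrite X2. eapply Rle_trans; [apply Cmod_sub_le|]. rewrite !Cmod_div by auto.
    assert (I : / Cmod (z - w) <= / d) by (apply Rinv_le_contravar; lra).
    assert (Pi : 0 < / Cmod (z - w)) by (apply Rinv_0_lt_compat; lra).
    assert (Q := Rle_abs B).
    assert (Y := Cmod_sub_le (f z) (f w)). assert (Y0 := Cmod_ge_0 (f z - f w)).
    assert (Y1 := Cmod_ge_0 (der f w)).
    unfold L, Rdiv. apply Rplus_le_compat.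
    - apply Rmult_le_compat; try lra; [apply Rmult_le_pos; lra|].
      apply Rmult_le_compat; lra.
    - apply Rmult_le_compat; lra. }
  rewrite Id, Cmod_div by auto.
  replace ((L + M) / d * Cmod h ^ 2)%R with (((L + M) * Cmod h ^ 2) / d)%R by (field; lra).
  apply Rmult_le_compat; [apply Cmod_ge_0| | |apply Rinv_le_contravar; lra].
  - left; apply Rinv_0_lt_compat; lra.
  - eapply Rle_trans; [apply Cmod_sub_le|]. rewrite Cmod_mult, Cmod_pow.
    assert (Q := pow2_ge_0 (Cmod h)). nra.
Qed.

(* The error term is holomorphic in z, so the bound on a circle around w0
   extends to the disc. *)
Lemma diff_quot_near f w0 : holo f w0 -> exists r1 r M, 0 < r1 /\ 0 < r /\ 0 <= M /\
  forall z w w', Cmod (z - w0) < r1 -> Cmod (w - w0) < r -> Cmod (w' - w0) < r ->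
  Cmod (diff_quot f w' z - diff_quot f w z - diff_quot2 f w z * (w' - w)) <= M * Cmod (w' - w) ^ 2.
Proof.
  intros H. destruct (holo_near _ _ H) as (R0 & PR & Hh).
  set (rho := (R0 / 2)%R). assert (Hr : 0 < rho < R0) by (unfold rho; lra).
  destruct (Ccont_bounded (fun t => f (circ w0 rho t)) 0 1) as (B & PB & HB).
  { intros t _. apply (cont_comp f); [apply holo_cont, Hh; rewrite circ_mod; lra|apply circ_cont]. }
  destruct (diff_quot_far f w0 B rho H ltac:(lra)) as (r & M & Pr & PM & HF).
  (* On the disc of half the radius [disc_bound] costs at most a factor 2. *)
  exists (rho / 2)%R, (Rmin r R0), (2 * M)%R. split; [lra|]. split; [apply Rmin_pos; lra|]. split; [lra|].
  intros z w w' Hz Hw Hw'. destruct (lt_Rmin _ _ _ Hw) as [W1 W2]. destruct (lt_Rmin _ _ _ Hw') as [W1' W2'].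
  destruct (diff_quot_correct f w (Hh w W2)) as (K1 & _).
  destruct (diff_quot_correct f w' (Hh w' W2')) as (K2 & _).
  destruct (diff_quot2_correct f w (Hh w W2)) as (K3 & _).
  set (q := (M * Cmod (w' - w) ^ 2)%R).
  assert (Pq : 0 <= q) by (apply Rmult_le_pos; [lra|apply pow2_ge_0]).
  assert (D := disc_bound (fun z => diff_quot f w' z - diff_quot f w z - diff_quot2 f w z * (w' - w))%C w0 rho R0 q z Hr).
  eapply Rle_trans; [apply D; [| |lra]|].
  - intros v Hv. assert (Hv' := Hh v Hv).
    apply holo_minus; [apply holo_minus|apply holo_mult; [|apply holo_const]]; auto.
  - intros t Ht. apply HF; auto. rewrite circ_mod; lra.
  - replace (2 * M * Cmod (w' - w) ^ 2)%R with (2 * q)%R by (unfold q; ring).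
    apply Rmult_le_compat_r; [exact Pq|].
    apply Rmult_le_reg_r with (rho - Cmod (z - w0))%R; [lra|].
    unfold Rdiv. rewrite Rmult_assoc, Rinv_l by lra. lra.
Qed.

Lemma diff_quot_integral_holo f g g' w0 : closed_path g g' ->
  (forall t, 0 <= t <= 1 -> holo f (g t)) -> holo f w0 ->
  holo (fun w => Cint (fun t => diff_quot f w (g t) * g' t)%C 0 1) w0.
Proof.
  intros Hg Hfg H.
  destruct (diff_quot_near f w0 H) as (r0 & r1 & M1 & Pr0 & Pr1 & PM1 & H1).
  destruct (Ccont_bounded (fun t => f (g t)) 0 1) as (B & PB & HB).
  { intros t Ht. apply (cont_comp f); [apply holo_cont; auto|eapply cp_gcont; eauto]. }
  destruct (diff_quot_far f w0 B r0 H Pr0) as (r2 & M2 & Pr2 & PM2 & H2).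
  destruct (Ccont_bounded g' 0 1 (cp_cont _ _ Hg)) as (B' & PB' & HB').
  destruct (holo_near _ _ H) as (r3 & Pr3 & Hh).
  set (r := Rmin r1 (Rmin r2 r3)).
  assert (R1 : r <= r1) by apply Rmin_l.
  assert (R2 : r <= r2) by (eapply Rle_trans; [apply Rmin_r|apply Rmin_l]).
  assert (R3 : r <= r3) by (eapply Rle_trans; [apply Rmin_r|apply Rmin_r]).
  exists (fun w => Cint (fun t => diff_quot2 f w (g t) * g' t)%C 0 1).
  apply (Hol_param (fun t w => diff_quot f w (g t) * g' t)%C (fun t w => diff_quot2 f w (g t) * g' t)%C w0 r
    ((M1 + M2) * B')).
  - unfold r; repeat apply Rmin_pos; auto.
  - apply Rmult_le_pos; lra.
  - intros t w Ht Hw.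
    destruct (diff_quot_correct f w) as (K1 & _); [apply Hh; lra|].
    destruct (diff_quot2_correct f w) as (K2 & _); [apply Hh; lra|].
    split; (apply cont_mult; [|now apply (cp_cont _ _ Hg)]).
    + apply (cont_comp (diff_quot f w)); [apply holo_cont; auto|eapply cp_gcont; eauto].
    + apply (cont_comp (diff_quot2 f w)); [apply holo_cont; auto|eapply cp_gcont; eauto].
  - intros t w w' Ht Hw Hw'.
    replace (diff_quot f w' (g t) * g' t - diff_quot f w (g t) * g' t - diff_quot2 f w (g t) * g' t * (w' - w))%C with
     ((diff_quot f w' (g t) - diff_quot f w (g t) - diff_quot2 f w (g t) * (w' - w)) * g' t)%C by ring.
    rewrite Cmod_mult.
    replace ((M1 + M2) * B' * Cmod (w' - w) ^ 2)%R with ((M1 + M2) * Cmod (w' - w) ^ 2 * B')%R by ring.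
    assert (Q := pow2_ge_0 (Cmod (w' - w))).
    apply Rmult_le_compat; auto using Cmod_ge_0.
    (* The curve may pass through w0, so its points near w0 and far from w0 are estimated with
       different constants. *)
    destruct (Rlt_le_dec (Cmod (g t - w0)) r0) as [Hn|Hn].
    + eapply Rle_trans; [apply H1; lra|]. nra.
    + eapply Rle_trans; [apply H2; auto; lra|]. nra.
Qed.

Section Dixon.
Variables (m : nat) (g g' : nat -> R -> C) (S : C -> Prop).
Hypothesis Hg : forall k, (1 <= k <= m)%nat -> closed_path (g k) (g' k).
Hypothesis HgS : forall k t, (1 <= k <= m)%nat -> S (g k t).
Hypothesis HSo : forall z, ~ S z -> near z (fun w => ~ S w).
Hypothesis HSb : exists M, forall z, S z -> Cmod z <= M.
Hypothesis Hwind : forall w, ~ S w -> csum (fun k => wind (g k) (g' k) w) m = 0.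

Definition oint (m : nat) (g g' : nat -> R -> C) (F : C -> C) : C :=
  csum (fun k => Cint (fun t => F (g k t) * g' k t)%C 0 1) m.

(** Dixon's entire function. The first formula is holomorphic near S, the second one off S, where it
    also decays at infinity. At a point off S where f is holomorphic they differ by f w times the
    total winding number, which [Hwind] makes 0. *)
Definition dixon (f : C -> C) (w : C) : C :=
  if excluded_middle_informative (S w) then oint m g g' (diff_quot f w)
  else csum (fun k => cauchy_int (g k) (fun t => f (g k t) * g' k t)%C 1 w) m.

Variable f : C -> C.
Hypothesis Hf : forall z, S z -> holo f z.

Lemma path_integrand_cont k t : (1 <= k <= m)%nat -> 0 <= t <= 1 -> Ccont (fun t => f (g k t) * g' k t)%C t.
Proof.
  intros Hk Ht. apply cont_mult; [|now apply (cp_cont _ _ (Hg k Hk))].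
  apply (cont_comp f); [apply holo_cont, Hf; auto|eapply cp_gcont; eauto].
Qed.

Lemma dixon_in w : holo f w -> dixon f w = oint m g g' (diff_quot f w).
Proof.
  intros H. unfold dixon. destruct (excluded_middle_informative (S w)) as [HS|HS]; [reflexivity|].
  destruct (diff_quot_correct f w H) as (D1 & _ & D3).
  (* Writing f on the curve as f w + (z - w) [diff_quot f w z] splits the Cauchy integral. *)
  transitivity (csum (fun k => (Cint (fun t => diff_quot f w (g k t) * g' k t)%C 0 1) + f w * wind (g k) (g' k) w)%C m).
  - apply csum_ext. intros k Hk. unfold wind, cauchy_int.
    assert (N : forall t, (g k t - w)%C <> 0).
    { intros t. apply Cminus_eq_contra. intros <-. apply HS; auto. }
    assert (I1 : @ex_RInt C_R_NormedModule (fun t => g' k t / (g k t - w) ^ 1)%C 0 1).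
    { apply ex_Cint_le; [lra|]. intros t Ht.
      apply cont_cauchy_kernel; [eapply cp_gcont; eauto|now apply (cp_cont _ _ (Hg k Hk))|].
      intros Eq. apply (N t). rewrite Eq. ring. }
    rewrite <- Cint_mult by exact I1. rewrite <- Cint_plus.
    + apply Cint_ext; [lra|]. intros t Ht.
      replace (f (g k t)) with (f w + (g k t - w) * diff_quot f w (g k t))%C by (rewrite <- D3; ring).
      rewrite !Cpow_1_r. field. auto.
    + apply ex_Cint_le; [lra|]. intros t Ht.
      apply cont_mult; [|now apply (cp_cont _ _ (Hg k Hk))].
      apply (cont_comp (diff_quot f w)); [apply holo_cont; auto|eapply cp_gcont; eauto].
    + destruct I1 as [l Hl]. exists (f w * l)%C. now apply is_Cint_mult.
  - rewrite csum_plus, csum_mult, Hwind by auto. unfold oint. ring.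
Qed.

Lemma dixon_holo w : holo (dixon f) w.
Proof.
  destruct (classic (S w)) as [HS|HS].
  - destruct (holo_near f w (Hf w HS)) as (d & Pd & D).
    (* Every neighbourhood of w may contain points off S; near w the first formula holds there too,
       by [dixon_in]. *)
    apply (holo_ext (fun v => oint m g g' (diff_quot f v))).
    { exists d; split; [auto|]. intros v Hv. symmetry. now apply dixon_in, D. }
    unfold oint. apply (csum_holo (fun k v => Cint (fun t => diff_quot f v (g k t) * g' k t)%C 0 1)).
    intros k Hk. apply diff_quot_integral_holo; auto.
  - destruct (HSo w HS) as (d & Pd & D).
    apply (holo_ext (fun v => csum (fun k => cauchy_int (g k) (fun t => f (g k t) * g' k t)%C 1 v) m)).
    { exists d; split; [auto|]. intros v Hv. unfold dixon.
      destruct (excluded_middle_informative (S v)) as [HSv|_]; [|reflexivity].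
      exfalso; revert HSv; now apply D. }
    apply (csum_holo (fun k => cauchy_int (g k) (fun t => f (g k t) * g' k t)%C 1)).
    intros k Hk. eexists. apply cauchy_int_Hol.
    + intros; eapply cp_gcont; eauto.
    + intros; now apply path_integrand_cont.
    + intros t Ht E. apply HS. rewrite <- E. auto.
Qed.

Lemma cauchy_int_decay (g0 phi : R -> C) M : (forall t, 0 <= t <= 1 -> Ccont g0 t) ->
  (forall t, 0 <= t <= 1 -> Ccont phi t) -> 0 <= M ->
  (forall t, 0 <= t <= 1 -> Cmod (g0 t) <= M) ->
  exists K, 0 <= K /\ forall z, 2 * M < Cmod z -> Cmod (cauchy_int g0 phi 1 z) <= K / Cmod z.
Proof using.
  intros Hc Hp PM HM. destruct (Ccont_bounded phi 0 1 Hp) as (B & PB & HB).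
  exists (2 * B)%R. split; [lra|]. intros z Hz. unfold cauchy_int.
  assert (D : forall t, 0 <= t <= 1 -> Cmod z / 2 <= Cmod (g0 t - z)).
  { intros t Ht. assert (Q := HM t Ht). assert (T := Cmod_sub_ge z (g0 t)).
    rewrite Cmod_sub_sym in T. lra. }
  replace (2 * B / Cmod z)%R with ((1 - 0) * (B / (Cmod z / 2)))%R by (field; lra).
  apply Cint_bound; [lra| |].
  - apply ex_Cint_le; [lra|]. intros t Ht.
    apply cont_cauchy_kernel; auto. intros Eq. assert (Q := D t Ht). rewrite Eq, Cmod_center in Q. lra.
  - intros t Ht. assert (Q := D t Ht). rewrite Cpow_1_r, Cmod_div by (apply Cmod_gt_0; lra).
    apply Rmult_le_compat; auto using Cmod_ge_0.
    + left; apply Rinv_0_lt_compat; lra.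
    + apply Rinv_le_contravar; lra.
Qed.

(** The densities are arbitrary because there are two uses: f times g' for [dixon_0], and g' alone
    for the winding number at infinity. *)
Lemma csum_decay (phi : nat -> R -> C) :
  (forall k t, (1 <= k <= m)%nat -> 0 <= t <= 1 -> Ccont (phi k) t) ->
  exists K M, forall z, M < Cmod z -> ~ S z /\ Cmod (csum (fun k => cauchy_int (g k) (phi k) 1 z) m) <= K / Cmod z.
Proof using HSb Hg HgS.
  intros Hp. destruct HSb as [M0 HM0].
  set (M := Rmax M0 0). assert (PM : 0 <= M) by apply Rmax_r.
  assert (HM : forall z, S z -> Cmod z <= M) by (intros z Hz; eapply Rle_trans; [now apply HM0|apply Rmax_l]).
  assert (A : forall j, (j <= m)%nat -> exists K, 0 <= K /\ forall z, 2 * M < Cmod z ->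
     Cmod (csum (fun k => cauchy_int (g k) (phi k) 1 z) j) <= K / Cmod z).
  { induction j; intros Hj.
    - exists 0. split; [lra|]. intros z Hz. simpl. rewrite Cmod_0. unfold Rdiv. lra.
    - destruct IHj as (K & PK & HK); [lia|].
      destruct (cauchy_int_decay (g (Datatypes.S j)) (phi (Datatypes.S j)) M) as (K' & PK' & HK').
      + intros t Ht. eapply cp_gcont; [apply Hg; lia|auto].
      + intros t Ht. apply Hp; [lia|auto].
      + auto.
      + intros t Ht. apply HM, HgS; lia.
      + exists (K + K')%R. split; [lra|]. intros z Hz. simpl.
        eapply Rle_trans; [apply Cmod_triangle|].
        unfold Rdiv. rewrite Rmult_plus_distr_r. apply Rplus_le_compat; auto. }
  destruct (A m ltac:(lia)) as (K & _ & HK).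
  exists K, (2 * M)%R. intros z Hz. split; [|auto].
  intros HS. apply HM in HS. lra.
Qed.

Lemma dixon_0 w : dixon f w = 0.
Proof.
  destruct (csum_decay (fun k t => f (g k t) * g' k t)%C) as (K & M & HK).
  { intros; now apply path_integrand_cont. }
  apply (liouville (dixon f) K M); [apply dixon_holo|].
  intros z Hz. destruct (HK z Hz) as [HS HB]. unfold dixon.
  destruct (excluded_middle_informative (S z)) as [H|_]; [contradiction|exact HB].
Qed.
End Dixon.

(* The homology form of Cauchy's theorem, by Dixon's argument applied to
   (z - a) f(z). *)
Lemma cauchy_theorem (m : nat) (g g' : nat -> R -> C) (S : C -> Prop) (f : C -> C) (a : C) :
  (forall k, (1 <= k <= m)%nat -> closed_path (g k) (g' k)) ->
  (forall k t, (1 <= k <= m)%nat -> S (g k t)) ->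
  (forall z, ~ S z -> near z (fun w => ~ S w)) ->
  (exists M, forall z, S z -> Cmod z <= M) ->
  (forall w, ~ S w -> csum (fun k => wind (g k) (g' k) w) m = 0) ->
  (forall z, S z -> holo f z) ->
  S a -> (forall k, (1 <= k <= m)%nat -> off (g k) a) ->
  oint m g g' f = 0.
Proof.
  intros Hg HgS HSo HSb Hw Hf Ha Hoff.
  set (F := fun z => ((z - a) * f z)%C).
  assert (HF : forall z, S z -> holo F z).
  { intros z Hz. apply holo_mult; auto. apply holo_minus; [apply holo_id|apply holo_const]. }
  assert (E := dixon_0 m g g' S Hg HgS HSo HSb Hw F HF a).
  rewrite (dixon_in m g g' S Hg HgS Hw F HF a (HF a Ha)) in E. rewrite <- E.
  (* Because F a = 0, the difference quotient of F at a equals f at every other point, in particular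
     on the curves. *)
  unfold oint. apply csum_ext. intros k Hk. apply Cint_ext; [lra|]. intros t Ht. f_equal.
  destruct (diff_quot_correct F a (HF a Ha)) as (_ & _ & D).
  assert (N : (g k t - a)%C <> 0) by (apply Cminus_eq_contra; apply (Hoff k Hk t Ht)).
  assert (E2 := D (g k t)). unfold F in E2 at 1 2.
  replace (f (g k t)) with (((g k t - a) * f (g k t) - (a - a) * f a) / (g k t - a))%C by (field; auto).
  rewrite E2. field. auto.
Qed.

(** * The jump of the winding number across a curve *)

(** The denominator differs from N = tau^2 + s^2 by e (2 tau + e), which is at most 3 eps tau^2 <=
    (3/8) N in modulus, so it is at least N / 2. The numerator of the difference is at most 4 eps N;
    together this gives 8 eps / N. *)
Lemma jump_kernel (e e1 : C) (tau s eps : R) : 0 < s -> 0 <= eps <= 1 / 8 ->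
  Cmod e <= eps * Rabs tau -> Cmod e1 <= eps ->
  ((RtoC tau + e) * (RtoC tau + e) + RtoC s * RtoC s)%C <> 0 /\
  Cmod ((1 + e1) / ((RtoC tau + e) * (RtoC tau + e) + RtoC s * RtoC s)
        - RtoC (/ (tau * tau + s * s))) <= 8 * eps / (tau * tau + s * s).
Proof.
  intros Ps He H H1.
  set (N := tau * tau + s * s). assert (PN : 0 < N) by (unfold N; nra).
  set (Z := ((RtoC tau + e) * (RtoC tau + e) + RtoC s * RtoC s)%C).
  assert (EZ : Z = (RtoC N + e * (2 * RtoC tau + e))%C).
  { unfold Z, N. rewrite RtoC_plus, !RtoC_mult. ring. }
  assert (PA := Rabs_pos tau).
  assert (T2 : Rabs tau * Rabs tau = tau * tau) by (rewrite <- Rabs_mult; apply Rabs_pos_eq; nra).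
  assert (Bq : Cmod (e * (2 * RtoC tau + e)) <= 3 * eps * (tau * tau)).
  { rewrite Cmod_mult. assert (Q := Cmod_triangle (2 * RtoC tau) e).
    rewrite Cmod_mult, !Cmod_R, (Rabs_pos_eq 2) in Q by lra.
    assert (Q0 := Cmod_ge_0 e). rewrite <- T2.
    apply Rle_trans with ((eps * Rabs tau) * (3 * Rabs tau)); [|right; ring].
    apply Rmult_le_compat; auto using Cmod_ge_0. nra. }
  assert (LZ : N / 2 <= Cmod Z).
  { assert (Q := Cmod_sub_ge (RtoC N) (- (e * (2 * RtoC tau + e)))).
    rewrite Cmod_opp, Cmod_R, Rabs_pos_eq in Q by lra.
    replace (RtoC N - - (e * (2 * RtoC tau + e)))%C with Z in Q by (rewrite EZ; ring).
    assert (3 * eps * (tau * tau) <= N / 2) by (unfold N; nra). lra. }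
  assert (NZ : Z <> 0) by (apply Cmod_gt_0; lra).
  split; [exact NZ|].
  assert (NN : RtoC N <> 0) by (apply RtoC_nz; lra).
  rewrite RtoC_inv by lra.
  replace ((1 + e1) / Z - / RtoC N)%C with ((RtoC N * e1 - e * (2 * RtoC tau + e)) / (Z * RtoC N))%C.
  2:{ replace (RtoC N * e1 - e * (2 * RtoC tau + e))%C with ((1 + e1) * RtoC N - Z)%C by (rewrite EZ; ring).
      field. auto. }
  rewrite Cmod_div, Cmod_mult by (now apply Cmult_neq_0).
  assert (MN : Cmod (RtoC N) = N) by (rewrite Cmod_R, Rabs_pos_eq; lra). rewrite MN.
  assert (Num : Cmod (RtoC N * e1 - e * (2 * RtoC tau + e)) <= 4 * eps * N).
  { eapply Rle_trans; [apply Cmod_sub_le|]. rewrite Cmod_mult, MN.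
    assert (N * Cmod e1 <= N * eps) by (apply Rmult_le_compat_l; lra).
    assert (3 * eps * (tau * tau) <= 3 * eps * N) by (unfold N; nra). lra. }
  replace (8 * eps / N) with ((4 * eps * N) * / ((N / 2) * N)) by (field; lra).
  apply Rmult_le_compat; [apply Cmod_ge_0| |exact Num|].
  - left; apply Rinv_0_lt_compat. apply Rmult_lt_0_compat; [apply Cmod_gt_0; auto|auto].
  - apply Rinv_le_contravar; [nra|]. apply Rmult_le_compat_r; lra.
Qed.

Lemma atan_scaled_derive (t0 s t : R) : s <> 0 ->
  is_derive (fun u => atan ((u - t0) / s)) t (s * / ((t - t0) * (t - t0) + s * s)).
Proof.
  intros Hs. evar_last.
  - apply (is_derive_comp (K := R_AbsRing) atan (fun u => (u - t0) / s)).
    + apply is_derive_atan.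
    + instantiate (1 := / s). auto_derive; auto; field; auto.
  - unfold scal; simpl; unfold mult; simpl. unfold Rsqr.
    assert (0 < s * s) by nra. assert (0 <= (t - t0) * (t - t0)) by apply (Rle_0_sqr (t - t0)).
    field. repeat split; try exact Hs; nra.
Qed.

Lemma atan_le_id (x : R) : 0 <= x -> atan x <= x.
Proof.
  intros Hx. destruct (MVT_gen atan 0 x (fun x => / (1 + x²))) as (c & _ & E).
  - intros y _. apply is_derive_atan.
  - intros y _. apply derivable_continuous_pt, derivable_pt_atan.
  - rewrite atan_0 in E. rewrite Rminus_0_r, Rminus_0_r in E. rewrite E.
    assert (/ (1 + c²) <= 1); [|nra].
    rewrite <- Rinv_1. apply Rinv_le_contravar; [lra|]. assert (Q := Rle_0_sqr c). lra.
Qed.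

Lemma atan_large (d s : R) : 0 < d -> 0 < s -> PI / 2 - s / d <= atan (d / s) < PI / 2.
Proof.
  intros Pd Ps. split; [|apply atan_bound].
  replace (d / s) with (/ (s / d)) by (field; lra).
  assert (0 < s / d) by (now apply Rdiv_lt_0_compat).
  rewrite atan_inv by auto. assert (Q := atan_le_id (s / d) ltac:(lra)). lra.
Qed.

(** The integrand of the difference of [wind] at z + i s T and z - i s T. With T the tangent at z, i
    T points to the left of the curve, which is inwards for a [smooth_domain]. *)
Definition jump (c c' : R -> C) (z T : C) (s t : R) : C :=
  (c' t / (c t - (z + Ci * (RtoC s * T))) ^ 1 - c' t / (c t - (z + Ci * (RtoC (- s) * T))) ^ 1)%C.

Lemma jump_cont c c' z T s t : Ccont c t -> Ccont c' t ->
  c t <> (z + Ci * (RtoC s * T))%C -> c t <> (z + Ci * (RtoC (- s) * T))%C ->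
  Ccont (jump c c' z T s) t.
Proof.
  intros Hc Hc' N1 N2. unfold jump.
  apply cont_minus; apply cont_cauchy_kernel; assumption.
Qed.

(** The kernels 1 / A and 1 / A' differ by (A' - A) / (A A') with A' - A = 2 i s T, so at a distance
    from z the difference is of order s. *)
Lemma jump_outer (c c' : R -> C) (z T : C) a b : a <= b ->
  (forall t, a <= t <= b -> Ccont c t) -> (forall t, a <= t <= b -> Ccont c' t) ->
  (forall t, a <= t <= b -> c t <> z) ->
  exists K e, 0 < e /\ 0 <= K /\ forall s, 0 < s < e -> Cmod (Cint (jump c c' z T s) a b) <= K * s.
Proof.
  intros Hab Hc Hc' Hz.
  destruct (Ccont_away c a b z Hc Hz) as (d & Pd & D).
  destruct (Ccont_bounded c' a b Hc') as (B & PB & HB).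
  set (L := (Cmod T + 1)%R). assert (PL : 0 < L) by (unfold L; assert (Q := Cmod_ge_0 T); lra).
  exists ((b - a) * (B * (2 * L) / (d / 2 * (d / 2)))), (d / 2 / L).
  assert (P0 : 0 < d / 2 * (d / 2)) by nra.
  split; [repeat apply Rdiv_lt_0_compat; lra|]. split.
  { apply Rmult_le_pos; [lra|]. left. apply Rdiv_lt_0_compat; [|auto]. apply Rmult_lt_0_compat; lra. }
  intros s Hs.
  assert (HsL : s * L < d / 2).
  { replace (d / 2) with (d / 2 / L * L) by (field; lra). apply Rmult_lt_compat_r; lra. }
  assert (Far : forall r t, Rabs r = s -> a <= t <= b -> d / 2 <= Cmod (c t - (z + Ci * (RtoC r * T)))).
  { intros r t Hr Ht. assert (Q := D t Ht).
    assert (T1 := Cmod_sub_ge (c t - z) (Ci * (RtoC r * T))).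
    rewrite !Cmod_mult, Cmod_Ci, Cmod_R, Hr in T1.
    replace (c t - z - Ci * (r * T))%C with (c t - (z + Ci * (r * T)))%C in T1 by ring.
    assert (s * Cmod T <= s * L) by (apply Rmult_le_compat_l; unfold L; lra). lra. }
  assert (As : Rabs s = s) by (apply Rabs_pos_eq; lra).
  assert (Ams : Rabs (- s) = s) by (rewrite Rabs_Ropp; auto).
  rewrite Rmult_assoc. apply Cint_bound; [lra| |].
  - apply ex_Cint_le; [lra|]. intros t Ht.
    apply jump_cont; auto.
    + assert (Q := Far s t As Ht). intros E; apply Ceq_minus in E; rewrite E, Cmod_0 in Q; lra.
    + assert (Q := Far (- s) t Ams Ht). intros E; apply Ceq_minus in E; rewrite E, Cmod_0 in Q; lra.
  - intros t Ht. assert (Q1 := Far s t As Ht). assert (Q2 := Far (- s) t Ams Ht).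
    unfold jump. rewrite !Cpow_1_r.
    set (A := (c t - (z + Ci * (s * T)))%C) in *. set (A' := (c t - (z + Ci * (RtoC (- s) * T)))%C) in *.
    assert (NA : A <> 0) by (apply Cmod_gt_0; lra). assert (NA' : A' <> 0) by (apply Cmod_gt_0; lra).
    replace (c' t / A - c' t / A')%C with (c' t * (2 * s * (Ci * T)) / (A * A'))%C.
    2:{ replace (2 * s * (Ci * T))%C with (A' - A)%C by (unfold A, A'; rewrite RtoC_opp; ring). field. auto. }
    rewrite Cmod_div by (now apply Cmult_neq_0). rewrite !Cmod_mult, Cmod_Ci, !Cmod_R, As, (Rabs_pos_eq 2) by lra.
    unfold Rdiv. replace (B * (2 * L) * / (d * / 2 * (d * / 2)) * s) with (B * (2 * s * (1 * L)) * / (d / 2 * (d / 2))) by (field; lra).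
    assert (PT := Cmod_ge_0 T).
    apply Rmult_le_compat.
    + apply Rmult_le_pos; [apply Cmod_ge_0|]. apply Rmult_le_pos; lra.
    + left; apply Rinv_0_lt_compat. apply Rmult_lt_0_compat; lra.
    + apply Rmult_le_compat; auto using Cmod_ge_0; [apply Rmult_le_pos; lra|].
      apply Rmult_le_compat_l; [lra|]. unfold L; lra.
    + apply Rinv_le_contravar; [lra|]. apply Rmult_le_compat; lra.
Qed.

(* With zeta = (c t - c t0) / c' t0 = t - t0 + o(t - t0), [jump] is
   2 i s zeta' / (zeta^2 + s^2), which is compared with 2 i s / ((t - t0)^2 + s^2). *)
Lemma jump_inner (c c' : R -> C) (t0 eps : R) :
  (forall t, Cder c t (c' t)) -> (forall t, Ccont c' t) -> c' t0 <> 0 -> 0 < eps <= 1 / 8 ->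
  exists d1, 0 < d1 /\ forall d s, 0 < d < d1 -> 0 < s ->
    Cmod (Cint (jump c c' (c t0) (c' t0) s) (t0 - d) (t0 + d) - 4 * Ci * RtoC (atan (d / s))) <= 16 * PI * eps.
Proof.
  intros Hc Hc' HT He. set (T := c' t0) in *. set (z := c t0).
  assert (PT := proj1 (Cmod_gt_0 _) HT).
  assert (Pe : 0 < eps * Cmod T) by (apply Rmult_lt_0_compat; lra).
  destruct (proj1 (Cder_Cmod _ _ _) (Hc t0) _ Pe) as (d1 & Pd1 & D1).
  destruct (proj1 (continuous_Cmod _ _ _) (Hc' t0) _ Pe) as (d2 & D2).
  exists (Rmin d1 d2). split; [apply Rmin_pos; [auto|apply cond_pos]|].
  intros d s Hd Hs.
  assert (M1 := Rmin_l d1 d2). assert (M2 := Rmin_r d1 d2).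
  (* [e] and [e1] are the errors of c and c' against their linearisation at t0, relative to T. *)
  assert (Data : forall t, t0 - d <= t <= t0 + d -> exists e e1,
     Cmod e <= eps * Rabs (t - t0) /\ Cmod e1 <= eps /\ (c t - z = T * (RtoC (t - t0) + e))%C /\ (c' t = T * (1 + e1))%C).
  { intros t Ht. assert (Hab : Rabs (t - t0) <= d) by (apply Rabs_le; lra).
    exists ((c t - z - RtoC (t - t0) * T) / T)%C, ((c' t - T) / T)%C.
    repeat split.
    - rewrite Cmod_div by auto. apply Rmult_le_reg_r with (Cmod T); [auto|].
      unfold Rdiv. rewrite Rmult_assoc, Rinv_l, Rmult_1_r by lra.
      eapply Rle_trans; [apply D1; lra|]. right; fold T; ring.
    - rewrite Cmod_div by auto. apply Rmult_le_reg_r with (Cmod T); [auto|].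
      unfold Rdiv. rewrite Rmult_assoc, Rinv_l, Rmult_1_r by lra.
      left. apply (D2 t). change (Rabs (t - t0) < d2). lra.
    - field; auto.
    - field; auto. }
  assert (Pt : forall t, t0 - d <= t <= t0 + d ->
     c t <> (z + Ci * (RtoC s * T))%C /\ c t <> (z + Ci * (RtoC (- s) * T))%C /\
     Cmod (jump c c' z T s t - 2 * Ci * RtoC (s * / ((t - t0) * (t - t0) + s * s)))
       <= 16 * eps * (s * / ((t - t0) * (t - t0) + s * s))).
  { intros t Ht. destruct (Data t Ht) as (e & e1 & B1 & B2 & E1 & E2).
    destruct (jump_kernel e e1 (t - t0) s eps Hs ltac:(lra) B1 B2) as [NZ BZ].
    set (tau := t - t0) in *. set (zeta := (RtoC tau + e)%C) in *.
    (* Up to the factor T, the two factors are the differences of c t to the two points, so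
       nonvanishing of the product keeps both points off the arc. *)
    assert (Fac : (zeta * zeta + RtoC s * RtoC s = (zeta - Ci * RtoC s) * (zeta + Ci * RtoC s))%C).
    { assert (Ci2 : (Ci * Ci = - (1))%C) by (apply injective_projections; simpl; ring).
      replace ((zeta - Ci * s) * (zeta + Ci * s))%C with (zeta * zeta - (Ci * Ci) * (s * s))%C by ring.
      rewrite Ci2. ring. }
    assert (N1 : (zeta - Ci * RtoC s)%C <> 0) by (intros E0; apply NZ; rewrite Fac, E0; ring).
    assert (N2 : (zeta + Ci * RtoC s)%C <> 0) by (intros E0; apply NZ; rewrite Fac, E0; ring).
    assert (X1 : (c t - (z + Ci * (RtoC s * T)) = T * (zeta - Ci * RtoC s))%C).
    { replace (c t - (z + Ci * (s * T)))%C with ((c t - z) - Ci * s * T)%C by ring. rewrite E1. ring. }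
    assert (X2 : (c t - (z + Ci * (RtoC (- s) * T)) = T * (zeta + Ci * RtoC s))%C).
    { replace (c t - (z + Ci * (RtoC (- s) * T)))%C with ((c t - z) + Ci * s * T)%C by (rewrite RtoC_opp; ring).
      rewrite E1. ring. }
    split; [|split].
    - intros E0. apply Ceq_minus in E0. rewrite X1 in E0. revert E0. now apply Cmult_neq_0.
    - intros E0. apply Ceq_minus in E0. rewrite X2 in E0. revert E0. now apply Cmult_neq_0.
    - unfold jump. rewrite X1, X2, E2, !Cpow_1_r.
      replace (T * (1 + e1) / (T * (zeta - Ci * s)) - T * (1 + e1) / (T * (zeta + Ci * s))
          - 2 * Ci * RtoC (s * / (tau * tau + s * s)))%C with
        (2 * Ci * s * ((1 + e1) / (zeta * zeta + s * s) - RtoC (/ (tau * tau + s * s))))%C.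
      + rewrite !Cmod_mult, Cmod_Ci, !Cmod_R, (Rabs_pos_eq 2), (Rabs_pos_eq s) by lra.
        apply Rle_trans with (2 * 1 * s * (8 * eps / (tau * tau + s * s))).
        * apply Rmult_le_compat_l; [lra|exact BZ].
        * right; unfold Rdiv; ring.
      + rewrite Fac, RtoC_mult. field. auto. }
  assert (CJ : forall t, t0 - d <= t <= t0 + d -> Ccont (jump c c' z T s) t).
  { intros t Ht. destruct (Pt t Ht) as (N1 & N2 & _). apply jump_cont; auto. exact (Cder_cont _ _ _ (Hc t)). }
  set (q := fun t => s * / ((t - t0) * (t - t0) + s * s)).
  assert (Cq : forall t, continuous q t).
  { intros t. apply (ex_derive_continuous (V := R_NormedModule)). unfold q.
    assert (K : (t - t0) * (t - t0) + s * s <> 0).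
    { assert (Q0 := Rle_0_sqr (t - t0)). unfold Rsqr in Q0. assert (0 < s * s) by (now apply Rmult_lt_0_compat). lra. }
    auto_derive. exact K. }
  assert (Iq : is_RInt q (t0 - d) (t0 + d) (2 * atan (d / s))).
  { replace (2 * atan (d / s)) with (minus (atan ((t0 + d - t0) / s)) (atan ((t0 - d - t0) / s))).
    - apply (is_RInt_derive (V := R_CompleteNormedModule) (fun u => atan ((u - t0) / s)) q); intros t _; [|apply Cq].
      apply atan_scaled_derive. lra.
    - unfold minus, plus, opp; simpl. replace ((t0 - d - t0) / s) with (- (d / s)) by (field; lra).
      rewrite atan_opp. replace (t0 + d - t0) with d by ring. ring. }
  assert (ICq : Cint (fun t => 2 * Ci * RtoC (q t))%C (t0 - d) (t0 + d) = (4 * Ci * RtoC (atan (d / s)))%C).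
  { apply Cint_unique. replace (4 * Ci * RtoC (atan (d / s)))%C with (2 * Ci * RtoC (2 * atan (d / s)))%C
      by (rewrite RtoC_mult; ring).
    apply is_Cint_mult.
    apply (is_RInt_fct_extend_pair (U:=R_NormedModule) (V:=R_NormedModule)); simpl; [exact Iq|].
    evar_last; [apply (is_RInt_const (V := R_NormedModule))|]. apply Rmult_0_r. }
  assert (ExJ : @ex_RInt C_R_NormedModule (jump c c' z T s) (t0 - d) (t0 + d)).
  { apply ex_Cint_le; [lra|]. exact CJ. }
  assert (Exq : @ex_RInt C_R_NormedModule (fun t => 2 * Ci * RtoC (q t))%C (t0 - d) (t0 + d)).
  { apply ex_Cint. intros t _. apply cont_mult; [apply continuous_const|]. apply cont_RtoC, Cq. }
  rewrite <- ICq, <- Cint_minus by auto.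
  assert (Iq2 := is_RInt_scal (V := R_NormedModule) q (t0 - d) (t0 + d) (16 * eps) _ Iq).
  apply Rle_trans with (scal (16 * eps) (2 * atan (d / s))).
  - rewrite <- norm_C.
    apply (norm_RInt_le (V := C_R_NormedModule) (fun t => jump c c' z T s t - 2 * Ci * RtoC (q t))%C
      (fun t => scal (16 * eps) (q t)) (t0 - d) (t0 + d)); [lra| |apply Cint_correct|exact Iq2].
    + intros t Ht. rewrite norm_C. apply (Pt t Ht).
    + apply (ex_RInt_minus (V := C_R_NormedModule)); auto.
  (* The comparison kernel has mass 2 atan (d / s) < pi for every s, so the bound is uniform in
     s. *)
  - unfold scal; simpl; unfold mult; simpl. assert (Q := atan_bound (d / s)). nra.
Qed.

Lemma Cint_period (h : R -> C) a : (forall t, Ccont h t) -> (forall t, h (t + 1) = h t) ->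
  Cint h a (a + 1) = Cint h 0 1.
Proof.
  intros Hc Hp.
  assert (I : forall u v, @ex_RInt C_R_NormedModule h u v) by (intros; apply ex_Cint; auto).
  assert (E : Cint h 0 a = Cint h 1 (a + 1)).
  { replace (Cint h 1 (a + 1)) with (Cint h (1 * 0 + 1) (1 * a + 1)) by (f_equal; ring).
    rewrite <- (RInt_comp_lin (V := C_R_CompleteNormedModule) h 1 1 0 a) by apply I.
    apply (RInt_ext (V := C_R_CompleteNormedModule)). intros t _.
    rewrite scal_C, Rmult_1_l, Hp. Ceq; ring. }
  assert (A := RInt_Chasles (V := C_R_CompleteNormedModule) h 0 a (a + 1) (I _ _) (I _ _)).
  assert (B := RInt_Chasles (V := C_R_CompleteNormedModule) h 0 1 (a + 1) (I _ _) (I _ _)).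
  rewrite <- E in B. rewrite <- A in B.
  change (Cint h 0 1 + Cint h 0 a = Cint h 0 a + Cint h a (a + 1))%C in B.
  set (x := Cint h 0 1) in *; set (y := Cint h a (a + 1)) in *; set (w := Cint h 0 a) in *.
  Ceq. replace y with (w + y - w)%C by ring. rewrite <- B. ring.
Qed.

(** * Zeros *)

Fixpoint cprod (l : list C) (z : C) : C :=
  match l with nil => RtoC 1 | a :: l' => ((z - a) * cprod l' z)%C end.

Lemma cprod_app l l' z : cprod (l ++ l') z = (cprod l z * cprod l' z)%C.
Proof. induction l; simpl; [ring|]. rewrite IHl. ring. Qed.

Lemma cprod_holo l z : holo (cprod l) z.
Proof.
  induction l; simpl; [apply holo_const|].
  apply (holo_mult (fun w => w - a)%C); [|exact IHl].
  apply holo_minus; [apply holo_id|apply holo_const].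
Qed.

Lemma cprod_filter p l z : cprod l z = (cprod (filter p l) z * cprod (filter (fun x => negb (p x)) l) z)%C.
Proof. induction l as [|a l IH]; simpl; [ring|]. destruct (p a); simpl; rewrite IH; ring. Qed.

Lemma cprod_nz l z : (forall a, In a l -> z <> a) -> cprod l z <> 0.
Proof.
  induction l; intros H; simpl; [apply C1_nz|].
  apply Cmult_neq_0; [apply Cminus_eq_contra, H; now left|apply IHl; intros; apply H; now right].
Qed.

Lemma cprod_le l z r : 0 <= r -> (forall a, In a l -> Cmod (z - a) <= r) -> Cmod (cprod l z) <= r ^ length l.
Proof.
  intros Hr. induction l; intros H; simpl; [rewrite Cmod_1; lra|].
  rewrite Cmod_mult. apply Rmult_le_compat; auto using Cmod_ge_0.
  - apply H; now left.
  - apply IHl; intros; apply H; now right.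
Qed.

Lemma cprod_ge l z r : 0 <= r -> (forall a, In a l -> r <= Cmod (z - a)) -> r ^ length l <= Cmod (cprod l z).
Proof.
  intros Hr. induction l; intros H; simpl; [rewrite Cmod_1; lra|].
  rewrite Cmod_mult. apply Rmult_le_compat; auto using pow_le.
  - apply H; now left.
  - apply IHl; intros; apply H; now right.
Qed.

(** Multiplicities are repetitions in l. The cofactor G1 may have further zeros, also at points of
    l. *)
Definition factor (G : C -> C) (l : list C) (G1 : C -> C) : Prop :=
  (forall z, holo G z -> holo G1 z) /\ forall z, G z = (cprod l z * G1 z)%C.

Definition vanish (G : C -> C) (a : C) : Prop := near a (fun z => G z = 0).

(* k zeros near a force |G| <= K (2/3)^k on a fixed disc around a. *)
Lemma factor_zero_bound G a R0 : 0 < R0 -> (forall z, Cmod (z - a) < 2 * R0 -> holo G z) ->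
  (forall k, exists l G1, length l = k /\ (forall x, In x l -> Cmod (x - a) < R0 / 4) /\ factor G l G1) ->
  forall z, Cmod (z - a) < R0 / 4 -> G z = 0.
Proof.
  intros PR HG Hk z Hz.
  destruct (Ccont_bounded (fun t => G (circ a R0 t)) 0 1) as (B & PB & HB).
  { intros t _. apply (cont_comp G); [apply holo_cont, HG; rewrite circ_mod; lra|apply circ_cont]. }
  assert (Main : forall k, Cmod (G z) <= 4 / 3 * B * (2 / 3) ^ k).
  { intros k. destruct (Hk k) as (l & G1 & Hl & Hin & HF & E).
    (* For x within R0 / 4 of a, the distance to x is at least 3/4 R0 from the circle and at most
       1/2 R0 from z, which gives the ratio 2/3. The factor 4/3 is the loss of [disc_bound] at
       distance R0 / 4. *)
    set (q := (3 / 4 * R0) ^ k). assert (Pq : 0 < q) by (apply pow_lt; lra).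
    assert (D := disc_bound G1 a R0 (2 * R0) (B / q) z ltac:(lra)).
    assert (D1 : Cmod (G1 z) <= R0 / (R0 - Cmod (z - a)) * (B / q)).
    { apply D; [auto| |lra]. intros t Ht.
      assert (Lo : q <= Cmod (cprod l (circ a R0 t))).
      { unfold q. rewrite <- Hl. apply cprod_ge; [lra|]. intros x Hx.
        assert (T := Cmod_sub_triangle (circ a R0 t) x a). rewrite circ_mod in T by lra.
        assert (Q := Hin x Hx). lra. }
      assert (Q := HB t Ht). rewrite E, Cmod_mult in Q.
      apply Rmult_le_reg_r with q; [auto|]. replace (B / q * q) with B by (field; lra).
      eapply Rle_trans; [|exact Q]. rewrite Rmult_comm. apply Rmult_le_compat_r; [apply Cmod_ge_0|auto]. }
    assert (Q0 := Cmod_ge_0 (z - a)).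
    assert (Up : Cmod (cprod l z) <= (1 / 2 * R0) ^ k).
    { rewrite <- Hl. apply cprod_le; [lra|]. intros x Hx.
      assert (T := Cmod_sub_triangle z a x). rewrite (Cmod_sub_sym a x) in T.
      assert (Q := Hin x Hx). lra. }
    rewrite E, Cmod_mult.
    assert (F : R0 / (R0 - Cmod (z - a)) <= 4 / 3).
    { apply Rmult_le_reg_r with (R0 - Cmod (z - a)); [lra|].
      replace (R0 / (R0 - Cmod (z - a)) * (R0 - Cmod (z - a))) with R0 by (field; lra). lra. }
    replace (4 / 3 * B * (2 / 3) ^ k) with ((1 / 2 * R0) ^ k * (4 / 3 * (B / q))).
    - apply Rmult_le_compat; auto using Cmod_ge_0. eapply Rle_trans; [exact D1|].
      apply Rmult_le_compat_r; [|exact F]. left; now apply Rdiv_lt_0_compat.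
    - replace ((1 / 2 * R0) ^ k) with ((2 / 3) ^ k * q).
      + field; lra.
      + unfold q. rewrite <- Rpow_mult_distr. f_equal. field. }
  apply Cmod_eq_0. apply Rle_antisym; [|apply Cmod_ge_0]. apply Rnot_lt_le. intros Hlt.
  destruct (pow_lt_1_zero (2 / 3) ltac:(rewrite Rabs_pos_eq; lra) (Cmod (G z) / (2 * B))) as (n & Hn).
  { apply Rdiv_lt_0_compat; lra. }
  assert (Q := Hn n (le_n n)). rewrite Rabs_pos_eq in Q by (apply pow_le; lra).
  assert (Q2 := Main n).
  apply (Rmult_lt_compat_l (2 * B)) in Q; [|lra].
  replace (2 * B * (Cmod (G z) / (2 * B))) with (Cmod (G z)) in Q by (field; lra).
  assert (0 <= B * (2 / 3) ^ n) by (apply Rmult_le_pos; [lra|apply pow_le; lra]). lra.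
Qed.

(** Since repetitions count, a zero of infinite order and a limit of distinct zeros fall under the
    same notion. *)
Definition accum (G : C -> C) (a : C) : Prop := forall r k, 0 < r ->
  exists l G1, length l = k /\ (forall x, In x l -> Cmod (x - a) < r) /\ factor G l G1.

Lemma accum_vanish G a : holo G a -> accum G a -> vanish G a.
Proof.
  intros H HA. destruct (holo_near _ _ H) as (d & Pd & D).
  exists (d / 2 / 4)%R. split; [lra|]. apply factor_zero_bound; [lra| |].
  - intros z Hz. apply D. lra.
  - intros k. apply HA. lra.
Qed.

(** Division by z - b can be repeated forever because the quotient again vanishes near b. A point
    around which G vanishes thus supplies arbitrarily long lists to [accum] at its neighbours. *)
Lemma vanish_factor G b k : holo G b -> vanish G b ->
  exists G1, factor G (repeat b k) G1 /\ vanish G1 b.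
Proof.
  intros H HV. induction k as [|k (G1 & [HF E] & (d & Pd & D))].
  - exists G. split; [|auto]. split; [auto|]. intros z; simpl; ring.
  - assert (H1 := HF b H).
    destruct (holo_divide G1 b H1) as (G2 & A1 & A2 & A3).
    { apply D. rewrite Cmod_center; lra. }
    exists G2. split; [split|].
    + auto.
    + intros z. rewrite E, A3. simpl. ring.
    + assert (Z : forall z, z <> b -> Cmod (z - b) < d -> G2 z = 0).
      { intros z N Hz. assert (Q := A3 z). rewrite D in Q by auto.
        assert (N' : (z - b)%C <> 0) by (now apply Cminus_eq_contra).
        replace (G2 z) with (((z - b) * G2 z) / (z - b))%C by (field; auto). rewrite <- Q.
        unfold Cdiv. ring. }
      exists d. split; [auto|]. intros z Hz. destruct (Ceq_dec z b) as [->|N]; [|auto].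
      (* At b itself the equation for G2 says nothing; the value there is 0 by continuity. *)
      apply Cmod_eq_0. apply Rle_antisym; [|apply Cmod_ge_0].
      apply (closed_bound G2 b 0); [apply holo_cont; auto|].
      exists d. split; [auto|]. intros v N Hv. rewrite (Z v N Hv), Cmod_0. lra.
Qed.

Lemma factor_sub G l G1 p : factor G l G1 -> exists G2, factor G (filter p l) G2.
Proof.
  intros [HF E]. exists (fun z => cprod (filter (fun x => negb (p x)) l) z * G1 z)%C. split.
  - intros z Hz. apply (holo_mult (cprod _)); [apply cprod_holo|auto].
  - intros z. rewrite E, (cprod_filter p l z). ring.
Qed.

Lemma factor_firstn G l G1 k : factor G l G1 -> exists G2, factor G (firstn k l) G2.
Proof.
  intros [HF E]. exists (fun z => cprod (skipn k l) z * G1 z)%C. split.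
  - intros z Hz. apply (holo_mult (cprod _)); [apply cprod_holo|auto].
  - intros z. rewrite E. rewrite <- (firstn_skipn k l) at 1. rewrite cprod_app. ring.
Qed.

Definition in_disc (a : C) (r : R) (x : C) : bool := if Rlt_dec (Cmod (x - a)) r then true else false.

Lemma length_cover (l : list C) (L : list (C * (R * nat))) :
  (forall x, In x l -> exists q, In q L /\ in_disc (fst q) (fst (snd q)) x = true) ->
  (forall q, In q L -> (length (filter (in_disc (fst q) (fst (snd q))) l) <= snd (snd q))%nat) ->
  (length l <= list_sum (map (fun q => snd (snd q)) L))%nat.
Proof.
  revert l. induction L as [|q L IH]; intros l Hc Hb.
  - destruct l as [|x l]; [simpl; lia|]. destruct (Hc x) as (q & [] & _). now left.
  - simpl. assert (Q := Hb q ltac:(now left)). set (p := in_disc (fst q) (fst (snd q))) in *.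
    assert (Sp : length l = (length (filter p l) + length (filter (fun x => negb (p x)) l))%nat).
    { clear. induction l; simpl; [lia|]. destruct (p a); simpl; lia. }
    assert (Q2 : (length (filter (fun x => negb (p x)) l) <= list_sum (map (fun q => snd (snd q)) L))%nat).
    { apply IH.
      - intros x Hx. apply filter_In in Hx. destruct Hx as [Hx Hp].
        destruct (Hc x Hx) as (q' & [->|Hq'] & Hi).
        + unfold p in Hp. rewrite Hi in Hp. discriminate.
        + exists q'; auto.
      - intros q' Hq'. eapply Nat.le_trans; [|apply (Hb q'); now right].
        clear. set (p' := in_disc _ _). induction l; simpl; [lia|].
        destruct (p a); simpl; destruct (p' a); simpl; lia. }
    lia.
Qed.

(** Bolzano-Weierstrass with multiplicities. If no point qualified, each point would have a disc
    containing a bounded number of entries of every such list; finitely many of these discs cover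
    the square [-M, M]^2 and would bound the length of all lists. The point found may lie outside S
    but is adherent to it. *)
Lemma bounded_accum (S : C -> Prop) (G : C -> C) M : (forall z, S z -> Cmod z <= M) ->
  (forall k, exists l G1, length l = k /\ (forall x, In x l -> S x) /\ factor G l G1) ->
  exists a, accum G a /\ forall r, 0 < r -> exists x, S x /\ Cmod (x - a) < r.
Proof.
  intros HM Hk. apply NNPP. intros N.
  assert (Loc : forall a : C, exists rk : R * nat, 0 < fst rk /\
    forall l G1, (forall x, In x l -> S x) -> factor G l G1 ->
      (length (filter (in_disc a (fst rk)) l) <= snd rk)%nat).
  { intros a. destruct (classic (accum G a)) as [HA|HA].
    - assert (X : ~ forall r, 0 < r -> exists x, S x /\ Cmod (x - a) < r) by (intros X; apply N; exists a; auto).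
      apply not_all_ex_not in X. destruct X as [r X]. apply imply_to_and in X. destruct X as [Pr X].
      exists (r, 0%nat). simpl. split; [auto|]. intros l G1 Hl _.
      destruct (filter (in_disc a r) l) as [|x l'] eqn:E; [simpl; lia|]. exfalso. apply X.
      assert (Hx : In x (filter (in_disc a r) l)) by (rewrite E; now left).
      apply filter_In in Hx. destruct Hx as [Hx Hp]. exists x. split; [auto|].
      unfold in_disc in Hp. destruct (Rlt_dec (Cmod (x - a)) r); [auto|discriminate].
    - unfold accum in HA. apply not_all_ex_not in HA. destruct HA as [r HA].
      apply not_all_ex_not in HA. destruct HA as [k HA]. apply imply_to_and in HA. destruct HA as [Pr HA].
      exists (r, k). simpl. split; [auto|]. intros l G1 Hl HF. apply Nat.nlt_ge. intros Hlt. apply HA.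
      destruct (factor_sub G l G1 (in_disc a r) HF) as [G2 HF2].
      destruct (factor_firstn G _ G2 k HF2) as [G3 HF3].
      exists (firstn k (filter (in_disc a r) l)), G3. split; [|split; [|exact HF3]].
      + rewrite length_firstn. lia.
      + intros x Hx. assert (Hx' : In x (filter (in_disc a r) l)).
        { rewrite <- (firstn_skipn k). apply in_or_app. now left. }
        apply filter_In in Hx'. destruct Hx' as [_ Hp].
        unfold in_disc in Hp. destruct (Rlt_dec (Cmod (x - a)) r); [auto|discriminate]. }
  (* The cover is described by a gauge, a function of the point, so radius and bound have to be
     chosen. *)
  set (pick := fun a : C => proj1_sig (constructive_indefinite_description _ (Loc a))).
  assert (Hp : forall a, 0 < fst (pick a) /\
    forall l G1, (forall x, In x l -> S x) -> factor G l G1 ->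
      (length (filter (in_disc a (fst (pick a))) l) <= snd (pick a))%nat).
  { intros a. exact (proj2_sig (constructive_indefinite_description _ (Loc a))). }
  (* Half the radius, because the cover is by squares and [Cmod] is at most the sum of the absolute
     coordinates. *)
  assert (Pd : forall x : Compactness.Tn 2 R, 0 < fst (pick (fst x, fst (snd x))) / 2).
  { intros x. destruct (Hp (fst x, fst (snd x))). lra. }
  apply (compactness_list 2 (- M, (- M, tt)) (M, (M, tt)) (fun x => mkposreal _ (Pd x))).
  intros [L HL].
  set (L' := map (fun x : Compactness.Tn 2 R => ((fst x, fst (snd x)) : C, pick (fst x, fst (snd x)))) L).
  destruct (Hk (Datatypes.S (list_sum (map (fun q => snd (snd q)) L')))) as (l & G1 & Hlen & Hl & HF).
  assert (B := length_cover l L'). rewrite Hlen in B.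
  apply (Nat.nle_succ_diag_l (list_sum (map (fun q => snd (snd q)) L'))). apply B.
  - intros x Hx. destruct (HL (fst x, (snd x, tt))) as (t & Ht & _ & Hc).
    { assert (Q := HM x (Hl x Hx)). assert (Q1 := fst_le_Cmod x). assert (Q2 := snd_le_Cmod x).
      simpl. assert (R1 := Rabs_le_between (fst x) (Cmod x)). assert (R2 := Rabs_le_between (snd x) (Cmod x)).
      apply R1 in Q1. apply R2 in Q2. repeat split; lra. }
    exists ((fst t, fst (snd t)) : C, pick (fst t, fst (snd t))). split.
    + apply in_map_iff. exists t; auto.
    + simpl. unfold in_disc. destruct (Rlt_dec _ _) as [_|Hn]; [reflexivity|]. exfalso. apply Hn.
      destruct t as [t1 [t2 []]]. simpl in *. destruct Hc as (C1 & C2 & _).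
      eapply Rle_lt_trans; [apply Cmod_le_Rabs|]. simpl.
      change (Rabs (fst x - t1) + Rabs (snd x - t2) < fst (pick (t1, t2))). lra.
  - intros q Hq. apply in_map_iff in Hq. destruct Hq as (x & <- & _). simpl.
    destruct (Hp (fst x, fst (snd x))) as [_ Hq]. eapply Hq; eauto.
Qed.

(** * Smooth domains *)

Lemma enorm_Cmod (z : R * R) : enorm z = Cmod z.
Proof. reflexivity. Qed.

Lemma closure_open_compl (S : R * R -> Prop) (z : C) : ~ closure S z ->
  near z (fun w => ~ closure S w).
Proof.
  intros H. apply not_all_ex_not in H. destruct H as [V HV].
  apply imply_to_and in HV. destruct HV as [HV HN].
  apply locally_Cmod in HV. destruct HV as (d & Pd & D).
  exists d; split; [auto|]. intros w Hw Hcl.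
  destruct (Hcl (fun v => Cmod (v - z) < d)) as (v & Hv & HS).
  - apply locally_Cmod. exists (d - Cmod (w - z))%R. split; [lra|].
    intros v Hv. assert (T := Cmod_sub_triangle v w z). lra.
  - apply HN. exists v; auto.
Qed.

Lemma closure_self (S : R * R -> Prop) z : S z -> closure S z.
Proof. intros H V HV. exists z. split; [exact (locally_singleton _ _ HV)|exact H]. Qed.

Lemma open_Cmod (S : R * R -> Prop) (z : C) : open S -> S z -> near z S.
Proof. intros H HS. apply locally_Cmod. exact (H z HS). Qed.

Lemma open_not_boundary (S : R * R -> Prop) z : open S -> S z -> ~ boundary S z.
Proof.
  intros Ho HS [_ Hb]. destruct (Hb S (Ho z HS)) as (w & H1 & H2). auto.
Qed.

Lemma closure_cases (S : R * R -> Prop) z : closure S z -> S z \/ boundary S z.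
Proof.
  intros Hc. destruct (classic (S z)) as [HS|HS]; [auto|right]. split; [auto|].
  now apply closure_self.
Qed.

Lemma closure_bounded (S : R * R -> Prop) M : (forall z, S z -> Cmod z <= M) -> forall z, closure S z -> Cmod z <= M.
Proof.
  intros H z Hz. apply Rnot_lt_le. intros Hlt.
  destruct (Hz (fun v => Cmod (v - z) < Cmod z - M)) as (v & Hv & HS).
  - apply locally_Cmod. exists (Cmod z - M)%R. split; [lra|auto].
  - assert (A := H v HS). assert (T := Cmod_sub_ge z v). rewrite Cmod_sub_sym in T. lra.
Qed.

Definition seg (a b : C) (s : R) : C := (a + RtoC s * (b - a))%C.

Lemma seg_0 a b : seg a b 0 = a.
Proof. unfold seg. ring. Qed.
Lemma seg_1 a b : seg a b 1 = b.
Proof. unfold seg. ring. Qed.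
Lemma seg_diff a b s t : Cmod (seg a b s - seg a b t) = (Rabs (s - t) * Cmod (b - a))%R.
Proof.
  unfold seg. replace (a + s * (b - a) - (a + t * (b - a)))%C with (RtoC (s - t) * (b - a))%C
    by (rewrite RtoC_minus; ring).
  now rewrite Cmod_mult, Cmod_R.
Qed.

(** Without a boundary point on the segment, the indicator of S would be locally constant along it,
    hence of derivative 0 and constant. *)
Lemma seg_boundary (S : R * R -> Prop) (a b : C) : open S -> S a -> ~ S b ->
  exists s, 0 <= s <= 1 /\ boundary S (seg a b s).
Proof.
  intros Ho Ha Hb. apply NNPP. intros N.
  set (f := fun s => if excluded_middle_informative (S (seg a b s)) then 0 else 1).
  assert (E : f 0 = f 1).
  { apply (eq_is_derive (V := R_NormedModule) f 0 1); [|lra]. intros s Hs.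
    apply (is_derive_ext_loc (V := R_NormedModule) (fun _ => f s)); [|apply (is_derive_const (V := R_NormedModule))].
    assert (Hc : Ccont (seg a b) s).
    { apply cont_plus; [apply continuous_const|]. apply cont_mult; [|apply continuous_const].
      apply cont_RtoC, continuous_id. }
    assert (Loc : near (seg a b s) (fun w => S w <-> S (seg a b s))).
    { destruct (classic (S (seg a b s))) as [HS|HS].
      - apply (near_imp _ S); [tauto|]. exact (open_Cmod S _ Ho HS).
      - apply (near_imp _ (fun w => ~ closure S w)).
        + intros w Hw. assert (Q := closure_self S w). tauto.
        + apply closure_open_compl. intros HC. apply N. exists s. split; [exact Hs|].
          destruct (closure_cases S _ HC); [contradiction|assumption]. }
    generalize (Hc _ (proj2 (locally_Cmod _ _) Loc)). unfold filtermap. apply filter_imp.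
    intros r Hr. unfold f. do 2 destruct (excluded_middle_informative _); tauto. }
  unfold f in E. rewrite seg_0, seg_1 in E.
  destruct (excluded_middle_informative (S a)); [|contradiction].
  destruct (excluded_middle_informative (S b)); [contradiction|lra].
Qed.

Lemma sq_derive (f : R -> R) (a l t : R) : is_derive f t l ->
  is_derive (fun s => (f s - a) ^ 2) t (2 * (f t - a) * l).
Proof.
  intros H. auto_derive; [now exists l|]. replace (Derive (fun x : R => f x) t) with l by (symmetry; now apply is_derive_unique). ring.
Qed.

(** Since w - z is orthogonal to T, it is a real multiple of i T; the coefficient is the cross
    product divided by |T|^2. *)
Lemma normal_foot (z T w : C) : Cmod T ^ 2 <> 0 ->
  (fst z - fst w) * fst T + (snd z - snd w) * snd T = 0 ->
  w = (z + Ci * (RtoC (((snd w - snd z) * fst T - (fst w - fst z) * snd T) / Cmod T ^ 2) * T))%C.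
Proof.
  intros HN HP. set (s := _ / _). set (A := (snd w - snd z) * fst T - (fst w - fst z) * snd T) in *.
  assert (E2 : s * (fst T ^ 2 + snd T ^ 2) - A = 0).
  { replace (fst T ^ 2 + snd T ^ 2) with (Cmod T ^ 2) by apply Cmod2_alt. unfold s. field. intros E; apply HN; rewrite E; ring. }
  assert (HN' : fst T ^ 2 + snd T ^ 2 <> 0).
  { intros E. apply HN. rewrite Cmod2_alt. exact E. }
  clearbody s.
  apply injective_projections; simpl; apply Rmult_eq_reg_r with (fst T ^ 2 + snd T ^ 2)%R; try exact HN';
    apply Rminus_diag_uniq.
  - transitivity (snd T * (s * (fst T ^ 2 + snd T ^ 2) - A)
       - fst T * ((fst z - fst w) * fst T + (snd z - snd w) * snd T))%R;
      [unfold A; ring|rewrite E2, HP; ring].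
  - transitivity (- fst T * (s * (fst T ^ 2 + snd T ^ 2) - A)
       - snd T * ((fst z - fst w) * fst T + (snd z - snd w) * snd T))%R;
      [unfold A; ring|rewrite E2, HP; ring].
Qed.

Section SmoothDomain.
Variables (Omega : R * R -> Prop) (m : nat) (g : nat -> R -> R * R).
Hypothesis HO : smooth_domain Omega m g.

Definition tg (k : nat) (t : R) : C := tangent (g k) t.

Lemma sd_Cder k t : (1 <= k <= m)%nat -> Cder (g k) t (tg k t).
Proof.
  intros Hk. apply Cder_pair. unfold tg, tangent; simpl.
  destruct (sd_smooth _ _ _ HO k Hk 1%nat t) as [H1 H2]. simpl in H1, H2.
  split; now apply Derive_correct.
Qed.

Lemma sd_tg_cont k t : (1 <= k <= m)%nat -> Ccont (tg k) t.
Proof.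
  intros Hk. apply continuous_pair. unfold tg, tangent; simpl.
  destruct (sd_smooth _ _ _ HO k Hk 2%nat t) as [H1 H2]. simpl in H1, H2.
  split; now apply (ex_derive_continuous (V := R_NormedModule)).
Qed.

Lemma sd_cont k t : (1 <= k <= m)%nat -> Ccont (g k) t.
Proof. intros Hk. exact (Cder_cont _ _ _ (sd_Cder k t Hk)). Qed.

Lemma sd_path k : (1 <= k <= m)%nat -> closed_path (g k) (tg k).
Proof.
  intros Hk. split; intros.
  - now apply sd_Cder.
  - now apply sd_tg_cont.
  - rewrite <- (sd_periodic _ _ _ HO k Hk 0). now rewrite Rplus_0_l.
Qed.

Lemma sd_period_Z k t z : (1 <= k <= m)%nat -> g k (t + IZR z) = g k t.
Proof.
  intros Hk. assert (P : forall j t, g k (t + INR j) = g k t).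
  { induction j; intros u; [simpl; now rewrite Rplus_0_r|].
    rewrite S_INR, <- Rplus_assoc, (sd_periodic _ _ _ HO k Hk). apply IHj. }
  destruct (Z.le_gt_cases 0 z) as [H|H].
  - rewrite <- (Z2Nat.id z H), <- INR_IZR_INZ. apply P.
  - rewrite <- (P (Z.to_nat (- z)) (t + IZR z)%R).
    rewrite INR_IZR_INZ, Z2Nat.id, opp_IZR by lia. f_equal. ring.
Qed.

Lemma frac_range t : 0 <= frac_part t < 1.
Proof. destruct (base_fp t); lra. Qed.

Lemma sd_frac k t : (1 <= k <= m)%nat -> g k (frac_part t) = g k t.
Proof.
  intros Hk. rewrite <- (sd_period_Z k (frac_part t) (Int_part t) Hk).
  f_equal. unfold frac_part. ring.
Qed.

(** [sd_simple] speaks of parameters in [0, 1); fractional parts extend it to all parameters modulo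
    the period. *)
Lemma sd_inj k l s t : (1 <= k <= m)%nat -> (1 <= l <= m)%nat -> g k s = g l t ->
  k = l /\ exists z, s - t = IZR z.
Proof.
  intros Hk Hl E. rewrite <- (sd_frac k s Hk), <- (sd_frac l t Hl) in E.
  destruct (sd_simple _ _ _ HO k l _ _ Hk Hl (frac_range s) (frac_range t) E) as [-> E2].
  split; [auto|]. exists (Int_part s - Int_part t)%Z. rewrite minus_IZR.
  unfold frac_part in E2. lra.
Qed.

Lemma sd_on_boundary k t : (1 <= k <= m)%nat -> boundary Omega (g k t).
Proof. intros Hk. apply (sd_boundary _ _ _ HO). exists k, t; auto. Qed.

Lemma sd_bounded_cl : exists M, forall z, closure Omega z -> Cmod z <= M.
Proof.
  destruct (sd_bounded _ _ _ HO) as [M HM]. exists M. apply closure_bounded. exact HM.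
Qed.

(** A segment from a point of Omega to one beyond its bound crosses the boundary, so there is a
    curve. *)
Lemma sd_m_pos : (1 <= m)%nat.
Proof.
  destruct (sd_nonempty _ _ _ HO) as [a Ha]. destruct (sd_bounded _ _ _ HO) as [M HM].
  destruct (seg_boundary Omega a (RtoC (Rabs M + 1))) as (s & _ & Hb).
  - apply (sd_open _ _ _ HO).
  - exact Ha.
  - intros H. assert (A := HM _ H). rewrite enorm_Cmod, Cmod_R in A.
    assert (Q := Rle_abs M). rewrite Rabs_pos_eq in A; [lra|]. assert (Q2 := Rabs_pos M). lra.
  - apply (sd_boundary _ _ _ HO) in Hb. destruct Hb as (k & t & Hk & _). lia.
Qed.

Lemma curve_nearest (c : R -> C) (w : C) : (forall t, Ccont c t) ->
  exists t0, 0 <= t0 <= 1 /\ forall t, 0 <= t <= 1 -> Cmod (c t0 - w) <= Cmod (c t - w).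
Proof using.
  intros Hc. destruct (continuity_ab_min (fun t => Cmod (c t - w)) 0 1) as (t0 & H1 & H2); [lra| |].
  - intros t _. apply continuity_pt_filterlim.
    apply filterlim_locally. intros e.
    assert (A := proj1 (continuous_Cmod _ c t) (Hc t) e (cond_pos e)).
    revert A. apply filter_imp. intros s Hs.
    change (Rabs (Cmod (c s - w) - Cmod (c t - w)) < e).
    apply Rabs_def1.
    + assert (T := Cmod_sub_triangle (c s) (c t) w). lra.
    + assert (T := Cmod_sub_triangle (c t) (c s) w). rewrite (Cmod_sub_sym (c t) (c s)) in T. lra.
  - exists t0. split; [exact H2|exact H1].
Qed.

Lemma sd_nearest (w : C) : exists k0 t0, (1 <= k0 <= m)%nat /\
  forall z, boundary Omega z -> Cmod (g k0 t0 - w) <= Cmod ((z : C) - w).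
Proof.
  assert (A : forall j, (1 <= j <= m)%nat -> exists k0 t0, (1 <= k0 <= m)%nat /\
    forall k t, (1 <= k <= j)%nat -> Cmod (g k0 t0 - w) <= Cmod (g k t - w)).
  { assert (B : forall k, (1 <= k <= m)%nat -> exists t0, forall t, Cmod (g k t0 - w) <= Cmod (g k t - w)).
    { intros k Hk. destruct (curve_nearest (g k) w) as (t0 & _ & H0); [intros; now apply sd_cont|].
      exists t0. intros t. rewrite <- (sd_frac k t Hk). apply H0. assert (Q := frac_range t). lra. }
    induction j; intros Hj; [lia|].
    destruct (B (S j) Hj) as (t1 & H1).
    destruct j.
    - exists 1%nat, t1. split; [lia|]. intros k t Hk. replace k with 1%nat by lia. auto.
    - destruct IHj as (k0 & t0 & Hk0 & H0); [lia|].
      destruct (Rle_lt_dec (Cmod (g k0 t0 - w)) (Cmod (g (S (S j)) t1 - w))) as [H|H].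
      + exists k0, t0. split; [auto|]. intros k t Hk.
        destruct (Nat.eq_dec k (S (S j))) as [->|N].
        * eapply Rle_trans; [exact H|auto].
        * apply H0; lia.
      + exists (S (S j)), t1. split; [lia|]. intros k t Hk.
        destruct (Nat.eq_dec k (S (S j))) as [->|N]; [auto|].
        eapply Rle_trans; [left; exact H|]. apply H0; lia. }
  assert (M1 := sd_m_pos).
  destruct (A m ltac:(lia)) as (k0 & t0 & Hk0 & H0).
  exists k0, t0. split; [auto|]. intros z Hz. apply (sd_boundary _ _ _ HO) in Hz.
  destruct Hz as (k & t & Hk & ->). now apply H0.
Qed.

(** First-order condition for a minimum of the squared distance. *)
Lemma sd_perp k0 t0 (w : C) : (1 <= k0 <= m)%nat ->
  (forall t, Cmod (g k0 t0 - w) <= Cmod (g k0 t - w)) ->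
  (fst (g k0 t0) - fst w) * fst (tg k0 t0) + (snd (g k0 t0) - snd w) * snd (tg k0 t0) = 0.
Proof.
  intros Hk H. assert (D := sd_Cder k0 t0 Hk). apply Cder_pair in D. destruct D as [D1 D2].
  set (F := fun t => (fst (g k0 t) - fst w) ^ 2 + (snd (g k0 t) - snd w) ^ 2).
  assert (DF : is_derive F t0 (2 * ((fst (g k0 t0) - fst w) * fst (tg k0 t0) + (snd (g k0 t0) - snd w) * snd (tg k0 t0)))).
  { replace (2 * ((fst (g k0 t0) - fst w) * fst (tg k0 t0) + (snd (g k0 t0) - snd w) * snd (tg k0 t0)))
      with (2 * (fst (g k0 t0) - fst w) * fst (tg k0 t0) + 2 * (snd (g k0 t0) - snd w) * snd (tg k0 t0)) by ring.
    exact (is_derive_plus (V := R_NormedModule) _ _ _ _ _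
      (sq_derive _ _ _ _ D1) (sq_derive _ _ _ _ D2)). }
  apply is_derive_Reals in DF.
  assert (E := deriv_minimum F (t0 - 1) (t0 + 1) t0 (exist _ _ DF) ltac:(lra) ltac:(lra)).
  simpl in E. assert (E' : 2 * ((fst (g k0 t0) - fst w) * fst (tg k0 t0) + (snd (g k0 t0) - snd w) * snd (tg k0 t0)) = 0).
  { apply E. intros t _ _. unfold F.
    assert (Q := H t). assert (Q0 := Cmod_ge_0 (g k0 t0 - w)).
    assert (Q2 : Cmod (g k0 t0 - w) ^ 2 <= Cmod (g k0 t - w) ^ 2) by (apply pow_incr; lra).
    rewrite !Cmod2_alt in Q2. exact Q2. }
  lra.
Qed.

(* The point of the normal at [g k t] at signed distance
   [s * enorm (tangent (g k) t)] inwards. *)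
Definition nrm (k : nat) (t s : R) : C := ((g k t : C) + Ci * (RtoC s * tg k t))%C.

Lemma nrm_0 k t : nrm k t 0 = g k t.
Proof. apply injective_projections; unfold nrm; simpl; ring. Qed.

Lemma tg_pos k t : (1 <= k <= m)%nat -> 0 < Cmod (tg k t).
Proof. intros Hk. apply Cmod_gt_0. apply (sd_regular _ _ _ HO k Hk t). Qed.

Lemma nrm_outward k t : (1 <= k <= m)%nat -> exists eps, 0 < eps /\
  forall s, 0 < s < eps -> Omega (nrm k t s) /\ ~ closure Omega (nrm k t (- s)).
Proof.
  intros Hk. destruct (sd_outward _ _ _ HO k Hk t) as (e & Pe & H).
  assert (PT := tg_pos k t Hk). set (L := Cmod (tg k t)) in *.
  exists (e / L)%R. split; [now apply Rdiv_lt_0_compat|]. intros s Hs.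
  destruct (H (s * L)%R) as [H1 H2].
  { split; [apply Rmult_lt_0_compat; lra|]. replace e with (e / L * L)%R by (field; lra).
    apply Rmult_lt_compat_r; lra. }
  unfold normal in H1, H2. rewrite enorm_Cmod in H1, H2. fold (tg k t) in H1, H2. fold L in H1, H2.
  simpl fst in H1, H2; simpl snd in H1, H2.
  split.
  - replace (nrm k t s) with (fst (g k t) - s * L * (snd (tg k t) / L), snd (g k t) - s * L * (- fst (tg k t) / L)).
    + exact H1.
    + unfold nrm. apply injective_projections; simpl; field; lra.
  - replace (nrm k t (- s)) with (fst (g k t) + s * L * (snd (tg k t) / L), snd (g k t) + s * L * (- fst (tg k t) / L)).
    + exact H2.
    + unfold nrm. apply injective_projections; simpl; field; lra.
Qed.

Lemma nrm_sub k t s s' : Cmod (nrm k t s - nrm k t s') = (Rabs (s - s') * Cmod (tg k t))%R.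
Proof.
  unfold nrm. replace (g k t + Ci * (s * tg k t) - (g k t + Ci * (s' * tg k t)))%C with
    (Ci * (RtoC (s - s') * tg k t))%C by (rewrite RtoC_minus; ring).
  rewrite !Cmod_mult, Cmod_R, Cmod_Ci. ring.
Qed.

Lemma nrm_seg k t s s' u : seg (nrm k t s) (nrm k t s') u = nrm k t (s + u * (s' - s)).
Proof. unfold seg, nrm. rewrite RtoC_plus, RtoC_mult, RtoC_minus. ring. Qed.

(* Every point off the boundary lies on the normal at its nearest boundary
   point, and on the side prescribed by the orientation. *)
Lemma sd_foot (w : C) : ~ boundary Omega w -> exists k t s, (1 <= k <= m)%nat /\ w = nrm k t s /\
  (Omega w -> 0 < s) /\ (~ closure Omega w -> s < 0) /\
  forall u, 0 < u <= 1 -> ~ boundary Omega (nrm k t (u * s)).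
Proof.
  intros Hw. destruct (sd_nearest w) as (k & t & Hk & Hn).
  assert (HP := sd_perp k t w Hk (fun t' => Hn _ (sd_on_boundary k t' Hk))).
  assert (PT := tg_pos k t Hk).
  set (T := tg k t) in *. set (z0 := g k t) in *.
  set (s := ((snd w - snd z0) * fst T - (fst w - fst z0) * snd T) / Cmod T ^ 2).
  assert (PT2 : 0 < Cmod T ^ 2) by (apply pow_lt; auto).
  assert (Ew : w = nrm k t s) by exact (normal_foot z0 T w (Rgt_not_eq _ _ PT2) HP).
  assert (N0 : nrm k t 0 = z0) by apply nrm_0.
  assert (Hs0 : s <> 0).
  { intros E. apply Hw. rewrite Ew, E, N0. now apply sd_on_boundary. }
  (* Points of the normal that are strictly nearer to w than the foot are off the boundary, because
     the foot is nearest. *)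
  assert (Hnb : forall s', Rabs (s' - s) < Rabs s -> ~ boundary Omega (nrm k t s')).
  { intros s' Hs' Hb. assert (A := Hn _ Hb). fold z0 in A. rewrite <- N0 in A. rewrite Ew in A.
    rewrite !nrm_sub in A. fold T in A. replace (0 - s) with (- s) in A by ring. rewrite Rabs_Ropp in A.
    apply Rmult_le_reg_r in A; [lra|auto]. }
  destruct (nrm_outward k t Hk) as (e & Pe & He).
  (* At v the sides of the curve are known, and v < |s| keeps the point closer to the foot than w
     is. *)
  set (v := (Rmin e (Rabs s) / 2)%R).
  assert (PA := Rabs_pos_lt _ Hs0).
  assert (Pm : 0 < Rmin e (Rabs s)) by (apply Rmin_pos; auto).
  assert (Mv1 := Rmin_l e (Rabs s)). assert (Mv2 := Rmin_r e (Rabs s)).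
  assert (Pv : 0 < v < e) by (unfold v; lra). assert (Pv2 : v < Rabs s) by (unfold v; lra).
  destruct (He v Pv) as [V1 V2].
  exists k, t, s. split; [auto|]. split; [auto|]. split; [|split].
  - intros HOw. apply Rnot_le_lt. intros Hle.
    assert (Hsl : s < 0) by lra. rewrite (Rabs_left s Hsl) in Pv2.
    (* If w lay on the wrong side, the normal between w and the exterior point at - v would contain
       a boundary point nearer to w than the foot. *)
    destruct (seg_boundary Omega w (nrm k t (- v))) as (u & Hu & Hb).
    + apply (sd_open _ _ _ HO).
    + exact HOw.
    + intros H. apply V2. now apply closure_self.
    + rewrite Ew, nrm_seg in Hb. revert Hb. apply Hnb. rewrite (Rabs_left s) by lra.
      replace (s + u * (- v - s) - s)%R with (u * (- v - s))%R by ring.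
      rewrite Rabs_pos_eq by nra. nra.
  - intros HOw. apply Rnot_le_lt. intros Hle.
    assert (Hsl : 0 < s) by lra. rewrite (Rabs_pos_eq s) in Pv2 by lra.
    destruct (seg_boundary Omega (nrm k t v) w) as (u & Hu & Hb).
    + apply (sd_open _ _ _ HO).
    + exact V1.
    + intros H. apply HOw. now apply closure_self.
    + rewrite Ew, nrm_seg in Hb. revert Hb. apply Hnb. rewrite (Rabs_pos_eq s) by lra.
      replace (v + u * (s - v) - s)%R with (- ((1 - u) * (s - v)))%R by ring.
      rewrite Rabs_Ropp, Rabs_pos_eq by nra. nra.
  - intros u Hu. destruct (Req_dec u 1) as [->|Nu].
    + rewrite Rmult_1_l, <- Ew. exact Hw.
    + apply Hnb. replace (u * s - s)%R with ((u - 1) * s)%R by ring.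
      rewrite Rabs_mult, (Rabs_left1 (u - 1)) by lra. nra.
Qed.

(** * The winding number of the whole boundary *)

Definition total_wind (w : C) : C := csum (fun k => wind (g k) (tg k) w) m.

Lemma total_wind_segment a b : (forall s, 0 <= s <= 1 -> ~ boundary Omega (seg a b s)) -> total_wind a = total_wind b.
Proof.
  intros H. unfold total_wind. apply csum_ext. intros k Hk. apply wind_segment; [now apply sd_path|].
  intros s Hs t Ht E. apply (H s Hs). unfold seg. rewrite <- E. now apply sd_on_boundary.
Qed.

Lemma total_wind_const a b : Omega a -> Omega b -> total_wind a = total_wind b.
Proof.
  intros Ha Hb.
  assert (Loc : forall z : C, Omega z -> near z (fun w => Omega w /\ total_wind w = total_wind z)).
  { intros z Hz. destruct (open_Cmod Omega z (sd_open _ _ _ HO) Hz) as (d & Pd & D).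
    exists d; split; [auto|]. intros w Hw. split; [auto|]. symmetry. apply total_wind_segment.
    intros s Hs. apply open_not_boundary; [apply (sd_open _ _ _ HO)|]. apply D.
    assert (A := seg_diff z w s 0). rewrite seg_0, Rminus_0_r, Rabs_pos_eq in A by lra. rewrite A.
    assert (Q := Cmod_ge_0 (w - z)). nra. }
  apply NNPP. intros N.
  destruct (sd_connected _ _ _ HO (fun z => Omega z /\ total_wind z = total_wind a) (fun z => Omega z /\ total_wind z <> total_wind a)) as (z & _ & [_ H1] & [_ H2]).
  - intros z [Hz E]. destruct (Loc z Hz) as (d & Pd & D). apply locally_Cmod. exists d; split; [auto|].
    intros w Hw. destruct (D w Hw). split; congruence.
  - intros z [Hz E]. destruct (Loc z Hz) as (d & Pd & D). apply locally_Cmod. exists d; split; [auto|].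
    intros w Hw. destruct (D w Hw). split; congruence.
  - intros z Hz. destruct (classic (total_wind z = total_wind a)) as [E|E]; [left|right]; split; assumption.
  - exists a; auto.
  - exists b. split; [assumption|]. split; [assumption|]. intros E. apply N. symmetry. exact E.
  - exact (H2 H1).
Qed.

Lemma off_boundary_ne k t w : (1 <= k <= m)%nat -> ~ boundary Omega w -> g k t <> w.
Proof. intros Hk Hw E. apply Hw. rewrite <- E. now apply sd_on_boundary. Qed.

Lemma wind_jump k k0 t0 s : (1 <= k <= m)%nat ->
  ~ boundary Omega (nrm k0 t0 s) -> ~ boundary Omega (nrm k0 t0 (- s)) ->
  (wind (g k) (tg k) (nrm k0 t0 s) - wind (g k) (tg k) (nrm k0 t0 (- s)))%C =
  Cint (jump (g k) (tg k) (g k0 t0) (tg k0 t0) s) 0 1.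
Proof.
  intros Hk B1 B2. unfold wind, cauchy_int, jump. rewrite <- Cint_minus; [reflexivity| |];
    (apply ex_Cint; intros t _; apply cont_cauchy_kernel;
      [now apply sd_cont|now apply sd_tg_cont|now apply off_boundary_ne]).
Qed.

Lemma tg_periodic k t : (1 <= k <= m)%nat -> tg k (t + 1) = tg k t.
Proof.
  intros Hk. assert (D := sd_Cder k (t + 1) Hk). assert (D0 := sd_Cder k t Hk).
  apply Cder_pair in D; apply Cder_pair in D0. destruct D as [D1 D2]. destruct D0 as [E1 E2].
  assert (Sh : is_derive (fun s => s + 1) t 1) by (auto_derive; auto).
  assert (F1 := is_derive_comp (K := R_AbsRing) (fun s => fst (g k s)) (fun s => s + 1) t _ _ D1 Sh).
  assert (F2 := is_derive_comp (K := R_AbsRing) (fun s => snd (g k s)) (fun s => s + 1) t _ _ D2 Sh).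
  apply (is_derive_ext _ (fun s => fst (g k s))) in F1; [|intros s; now rewrite (sd_periodic _ _ _ HO k Hk)].
  apply (is_derive_ext _ (fun s => snd (g k s))) in F2; [|intros s; now rewrite (sd_periodic _ _ _ HO k Hk)].
  apply injective_projections.
  - rewrite <- (is_derive_unique _ _ _ E1), (is_derive_unique _ _ _ F1). symmetry. apply Rmult_1_l.
  - rewrite <- (is_derive_unique _ _ _ E2), (is_derive_unique _ _ _ F2). symmetry. apply Rmult_1_l.
Qed.

(** One period centred at t0 is cut into the arc within d of t0, where [jump_inner] gives about 4 i
    atan (d / s), and two outer arcs, where the integral is of order s. As s tends to 0, atan (d /
    s) tends to pi / 2; the eps that remains is the one that determined d. *)
Lemma jump_limit k0 t0 eps : (1 <= k0 <= m)%nat -> 0 < eps <= 1 / 8 ->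
  exists K e, 0 < e /\ 0 <= K /\ forall s, 0 < s < e ->
    Cmod (total_wind (nrm k0 t0 s) - total_wind (nrm k0 t0 (- s)) - 2 * PI * Ci) <= K * s + 16 * PI * eps.
Proof.
  intros Hk0 He.
  destruct (nrm_outward k0 t0 Hk0) as (e0 & Pe0 & H0).
  assert (NB : forall s, 0 < s < e0 -> ~ boundary Omega (nrm k0 t0 s) /\ ~ boundary Omega (nrm k0 t0 (- s))).
  { intros s Hs. destruct (H0 s Hs) as [A B]. split.
    - apply open_not_boundary; [apply (sd_open _ _ _ HO)|exact A].
    - intros [C _]. exact (B C). }
  set (z := g k0 t0). set (T := tg k0 t0).
  destruct (jump_inner (g k0) (tg k0) t0 eps) as (d1 & Pd1 & Hin).
  { intros; now apply sd_Cder. }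
  { intros; now apply sd_tg_cont. }
  { apply Cmod_gt_0. now apply tg_pos. }
  { exact He. }
  set (d := (Rmin d1 (1 / 2) / 2)%R).
  assert (Pm : 0 < Rmin d1 (1 / 2)) by (apply Rmin_pos; lra).
  assert (M1 := Rmin_l d1 (1 / 2)). assert (M2 := Rmin_r d1 (1 / 2)).
  assert (Hd : 0 < d < d1) by (unfold d; lra). assert (Hd2 : d < 1 / 2) by (unfold d; lra).
  (* Within half a period a simple closed curve is at its point of parameter t0 only at t0. *)
  assert (Near : forall t, Rabs (t - t0) <= 1 / 2 -> t <> t0 -> g k0 t <> z).
  { intros t Ht Nt E. apply sd_inj in E; auto. destruct E as (_ & n & En).
    rewrite En in Ht. rewrite <- abs_IZR in Ht.
    assert (Hz : (Z.abs n < 1)%Z) by (apply lt_IZR; lra).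
    assert (n = 0%Z) as -> by lia. apply Nt. lra. }
  destruct (jump_outer (g k0) (tg k0) z T (t0 - 1 / 2) (t0 - d)) as (K2 & e2 & Pe2 & PK2 & H2); [lra| | | |].
  { intros; now apply sd_cont. }
  { intros; now apply sd_tg_cont. }
  { intros t Ht. apply Near; [apply Rabs_le|]; lra. }
  destruct (jump_outer (g k0) (tg k0) z T (t0 + d) (t0 + 1 / 2)) as (K3 & e3 & Pe3 & PK3 & H3); [lra| | | |].
  { intros; now apply sd_cont. }
  { intros; now apply sd_tg_cont. }
  { intros t Ht. apply Near; [apply Rabs_le|]; lra. }
  exists (K2 + K3 + 4 / d)%R, (Rmin e0 (Rmin e2 e3)).
  split; [repeat apply Rmin_pos; auto|]. split.
  { assert (0 < 4 / d) by (apply Rdiv_lt_0_compat; lra). lra. }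
  intros s Hs.
  destruct (lt_Rmin _ _ _ (proj2 Hs)) as [S0 S23]. destruct (lt_Rmin _ _ _ S23) as [S2 S3].
  destruct (NB s ltac:(lra)) as [B1 B2].
  (* The other curves miss the short normal segment, its foot included, so only curve k0
     contributes. *)
  assert (EW : (total_wind (nrm k0 t0 s) - total_wind (nrm k0 t0 (- s)))%C = Cint (jump (g k0) (tg k0) z T s) 0 1).
  { unfold total_wind. rewrite <- csum_minus, (csum_single _ m k0 Hk0); [now apply wind_jump|].
    intros k Hk Nk.
    rewrite (wind_segment _ _ (sd_path k Hk) (nrm k0 t0 s) (nrm k0 t0 (- s))); [ring|].
    intros v Hv t _. change (g k t <> seg (nrm k0 t0 s) (nrm k0 t0 (- s)) v). rewrite nrm_seg.
    set (r := s + v * (- s - s)). assert (Hr : - s <= r <= s) by (unfold r; nra).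
    destruct (Req_dec r 0) as [->|Nr].
    - rewrite nrm_0. intros Eg. apply sd_inj in Eg; auto. now destruct Eg.
    - apply (off_boundary_ne k t _ Hk). destruct (Rlt_le_dec 0 r) as [Pr|Pr].
      + exact (proj1 (NB r ltac:(lra))).
      + rewrite <- (Ropp_involutive r). exact (proj2 (NB (- r) ltac:(lra))). }
  assert (CJ : forall t, Ccont (jump (g k0) (tg k0) z T s) t).
  { intros t. apply jump_cont; [now apply sd_cont|now apply sd_tg_cont| |].
    - exact (off_boundary_ne k0 t _ Hk0 B1).
    - exact (off_boundary_ne k0 t _ Hk0 B2). }
  assert (I : forall u v, @ex_RInt C_R_NormedModule (jump (g k0) (tg k0) z T s) u v) by (intros; apply ex_Cint; auto).
  assert (EP : Cint (jump (g k0) (tg k0) z T s) 0 1 =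
     (Cint (jump (g k0) (tg k0) z T s) (t0 - 1 / 2) (t0 - d) + Cint (jump (g k0) (tg k0) z T s) (t0 - d) (t0 + d)
      + Cint (jump (g k0) (tg k0) z T s) (t0 + d) (t0 + 1 / 2))%C).
  { rewrite <- (Cint_period _ (t0 - 1 / 2)); [|exact CJ|].
    - replace (t0 - 1 / 2 + 1) with (t0 + 1 / 2) by field.
      rewrite <- (RInt_Chasles (V := C_R_CompleteNormedModule) _ _ (t0 + d) _ (I _ _) (I _ _)).
      rewrite <- (RInt_Chasles (V := C_R_CompleteNormedModule) _ _ (t0 - d) (t0 + d) (I _ _) (I _ _)).
      reflexivity.
    - intros t. unfold jump. rewrite (tg_periodic k0 t Hk0), (sd_periodic _ _ _ HO k0 Hk0). reflexivity. }
  assert (Q2 := H2 s ltac:(lra)). assert (Q3 := H3 s ltac:(lra)).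
  assert (Q4 := Hin d s Hd ltac:(lra)). fold z T in Q4.
  rewrite EW, EP.
  set (X2 := Cint _ (t0 - 1 / 2) (t0 - d)) in *. set (X3 := Cint _ (t0 - d) (t0 + d)) in *.
  set (X4 := Cint _ (t0 + d) (t0 + 1 / 2)) in *.
  replace (X2 + X3 + X4 - 2 * PI * Ci)%C with (X2 + X4 + (X3 - 4 * Ci * RtoC (atan (d / s)))
     + 4 * Ci * RtoC (atan (d / s) - PI / 2))%C.
  2:{ rewrite RtoC_minus, RtoC_div by lra. field. }
  assert (Q5 : Cmod (4 * Ci * RtoC (atan (d / s) - PI / 2)) <= 4 / d * s).
  { rewrite !Cmod_mult, Cmod_Ci, !Cmod_R, (Rabs_pos_eq 4) by lra.
    assert (Q := atan_large d s ltac:(lra) ltac:(lra)). rewrite Rabs_left by lra.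
    replace (4 / d * s) with (4 * 1 * (s / d)) by (field; lra). lra. }
  eapply Rle_trans; [apply Cmod_triangle|].
  eapply Rle_trans; [apply Rplus_le_compat_r, Cmod_triangle|].
  eapply Rle_trans; [apply Rplus_le_compat_r, Rplus_le_compat_r, Cmod_triangle|].
  lra.
Qed.

(** The jump does not depend on s, because the winding number is constant on Omega and along the
    outer part of the normal. The estimate of [jump_limit] at ever smaller s' therefore applies to
    the jump at s and makes it exact. *)
Lemma total_wind_jump k0 t0 : (1 <= k0 <= m)%nat -> exists e, 0 < e /\ forall s, 0 < s < e ->
  Omega (nrm k0 t0 s) /\ ~ closure Omega (nrm k0 t0 (- s)) /\
  (total_wind (nrm k0 t0 s) - total_wind (nrm k0 t0 (- s)))%C = (2 * PI * Ci)%C.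
Proof.
  intros Hk0. destruct (nrm_outward k0 t0 Hk0) as (e0 & Pe0 & H0).
  exists e0. split; [auto|]. intros s Hs. destruct (H0 s Hs) as [A B].
  split; [auto|]. split; [auto|].
  apply Ceq_minus, Cmod_eq_0. apply Rle_antisym; [|apply Cmod_ge_0]. apply Rnot_lt_le. intros Hlt.
  set (D := Cmod _) in Hlt.
  assert (PP := PI_RGT_0).
  (* [eps] and [s'] make each of the two errors at most D / 4, which contradicts D > 0. *)
  set (eps := Rmin (1 / 8) (D / 4 / (16 * PI))).
  assert (Peps : 0 < eps) by (unfold eps; apply Rmin_pos; [lra|repeat apply Rdiv_lt_0_compat; lra]).
  assert (M1 : eps <= 1 / 8) by apply Rmin_l.
  assert (M2 : eps <= D / 4 / (16 * PI)) by apply Rmin_r.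
  destruct (jump_limit k0 t0 eps Hk0 ltac:(lra)) as (K & e & Pe & PK & H).
  set (s' := (Rmin (Rmin e e0) (D / 4 / (K + 1)) / 2)%R).
  assert (Pq : 0 < D / 4 / (K + 1)) by (repeat apply Rdiv_lt_0_compat; lra).
  assert (Pm : 0 < Rmin (Rmin e e0) (D / 4 / (K + 1))) by (repeat apply Rmin_pos; auto).
  assert (R1 := Rmin_l (Rmin e e0) (D / 4 / (K + 1))). assert (R2 := Rmin_r (Rmin e e0) (D / 4 / (K + 1))).
  assert (R3 := Rmin_l e e0). assert (R4 := Rmin_r e e0).
  assert (Hs' : 0 < s' < e /\ s' < e0 /\ s' < D / 4 / (K + 1)) by (unfold s'; lra).
  destruct Hs' as (Hs1 & Hs2 & Hs3).
  destruct (H0 s' ltac:(lra)) as [A' B'].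
  assert (E1 : total_wind (nrm k0 t0 s) = total_wind (nrm k0 t0 s')) by (apply total_wind_const; auto).
  assert (E2 : total_wind (nrm k0 t0 (- s)) = total_wind (nrm k0 t0 (- s'))).
  { apply total_wind_segment. intros u Hu. rewrite nrm_seg.
    replace (- s + u * (- s' - - s)) with (- ((1 - u) * s + u * s')) by ring.
    intros [Hc _]. revert Hc. apply H0. split.
    2:{ apply Rle_lt_trans with (Rmax s s'); [|apply Rmax_lub_lt; lra].
        assert (X1 := Rmult_le_compat_l (1 - u) _ _ ltac:(lra) (Rmax_l s s')).
        assert (X2 := Rmult_le_compat_l u _ _ ltac:(lra) (Rmax_r s s')). lra. }
    destruct (Rle_lt_or_eq_dec 0 u ltac:(lra)) as [Pu|<-]; [|lra].
    assert (0 < u * s') by (apply Rmult_lt_0_compat; lra). assert (0 <= (1 - u) * s) by (apply Rmult_le_pos; lra). lra. }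
  assert (Q := H s' Hs1). rewrite <- E1, <- E2 in Q. fold D in Q.
  assert (K * s' <= D / 4).
  { apply Rle_trans with ((K + 1) * (D / 4 / (K + 1))); [|right; field; lra]. apply Rmult_le_compat; lra. }
  assert (16 * PI * eps <= D / 4).
  { apply Rle_trans with (16 * PI * (D / 4 / (16 * PI))); [|right; field; lra]. apply Rmult_le_compat_l; lra. }
  lra.
Qed.

Lemma total_wind_outside_const a w : Omega a -> ~ closure Omega w -> total_wind w = (total_wind a - 2 * PI * Ci)%C.
Proof.
  intros Ha Hw.
  assert (Nb : ~ boundary Omega w) by (intros [H _]; auto).
  destruct (sd_foot w Nb) as (k & t & s & Hk & E & _ & Hs & Hu).
  assert (Ns := Hs Hw). destruct (total_wind_jump k t Hk) as (e & Pe & He).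
  (* Scaling by u moves w along the normal into the range e of the jump at the foot. *)
  set (u := (Rmin 1 (e / - s) / 2)%R).
  assert (Pq : 0 < e / - s) by (apply Rdiv_lt_0_compat; lra).
  assert (Pm : 0 < Rmin 1 (e / - s)) by (apply Rmin_pos; lra).
  assert (M1 := Rmin_l 1 (e / - s)). assert (M2 := Rmin_r 1 (e / - s)).
  assert (Hu1 : 0 < u < 1) by (unfold u; lra). assert (Hu2 : u < e / - s) by (unfold u; lra).
  assert (Hv : 0 < u * - s < e).
  { split; [apply Rmult_lt_0_compat; lra|]. replace e with (e / - s * - s) by (field; lra).
    apply Rmult_lt_compat_r; lra. }
  destruct (He _ Hv) as (A & _ & J). replace (- (u * - s)) with (u * s) in J by ring.
  rewrite (total_wind_const _ a A Ha) in J.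
  assert (Ew : total_wind w = total_wind (nrm k t (u * s))).
  { rewrite E at 1. apply total_wind_segment. intros r Hr. rewrite nrm_seg.
    replace (s + r * (u * s - s)) with ((1 - r * (1 - u)) * s) by ring. apply Hu. nra. }
  rewrite Ew, <- J. ring.
Qed.

Lemma total_wind_outside w : ~ closure Omega w -> total_wind w = 0.
Proof.
  intros Hw. destruct (sd_nonempty _ _ _ HO) as [a Ha].
  destruct (csum_decay m g tg (closure Omega)) with (phi := tg) as (K & M & HK).
  - intros; now apply sd_path.
  - intros k t Hk. apply (sd_on_boundary k t Hk).
  - apply sd_bounded_cl.
  - intros; now apply sd_tg_cont.
  - apply Cmod_eq_0. apply Rle_antisym; [|apply Cmod_ge_0]. apply Rnot_lt_le. intros Hlt.
    set (D := Cmod (total_wind w)) in *.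
    (* A real point off the closure, so far out that K / X < D; the winding number there is the same
       as at w. *)
    set (X := (Rabs M + Rabs K / D + 1)%R).
    assert (Q1 := Rabs_pos M). assert (Q2 := Rabs_pos K). assert (Q3 := Rle_abs M). assert (Q4 := Rle_abs K).
    assert (PQ : 0 <= Rabs K / D) by (apply Rmult_le_pos; [lra|left; now apply Rinv_0_lt_compat]).
    assert (PX : 0 < X) by (unfold X; lra).
    assert (MX : Cmod (RtoC X) = X) by (rewrite Cmod_R, Rabs_pos_eq; lra).
    destruct (HK (RtoC X)) as [HS HB]; [rewrite MX; unfold X; lra|].
    change (Cmod (total_wind (RtoC X)) <= K / Cmod (RtoC X)) in HB.
    rewrite (total_wind_outside_const a _ Ha HS), <- (total_wind_outside_const a w Ha Hw), MX in HB. fold D in HB.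
    apply (Rmult_le_compat_r X) in HB; [|lra]. replace (K / X * X) with K in HB by (field; lra).
    assert (D * X = D * Rabs M + Rabs K + D) by (unfold X; field; lra). nra.
Qed.

Lemma total_wind_inside w : Omega w -> total_wind w = (2 * PI * Ci)%C.
Proof.
  intros Hw.
  destruct (total_wind_jump 1 0) as (e & Pe & He).
  { split; [lia|]. apply sd_m_pos. }
  destruct (He (e / 2) ltac:(lra)) as (A & B & J).
  rewrite (total_wind_outside _ B), (total_wind_const _ w A Hw) in J. rewrite <- J. ring.
Qed.

Lemma cauchy_domain f : (forall z, closure Omega z -> holo f z) -> oint m g tg f = 0.
Proof.
  intros Hf. destruct (sd_nonempty _ _ _ HO) as [a Ha].
  apply (cauchy_theorem m g tg (closure Omega) f a).
  - intros; now apply sd_path.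
  - intros k t Hk. apply (sd_on_boundary k t Hk).
  - apply closure_open_compl.
  - apply sd_bounded_cl.
  - apply total_wind_outside.
  - exact Hf.
  - now apply closure_self.
  - intros k Hk t _. apply off_boundary_ne; auto. apply open_not_boundary; auto. apply (sd_open _ _ _ HO).
Qed.

Lemma oint_pole a : Omega a -> oint m g tg (fun z => / (z - a))%C = (2 * PI * Ci)%C.
Proof.
  intros Ha. rewrite <- (total_wind_inside a Ha). unfold oint, total_wind. apply csum_ext. intros k Hk.
  unfold wind, cauchy_int. apply Cint_ext; [lra|]. intros t _. rewrite Cpow_1_r. unfold Cdiv. ring.
Qed.

(** * The argument principle *)

(** If zeros could be split off forever, G would vanish around some point of the closure. On the
    boundary this is excluded; inside, connectedness makes G vanish on all of Omega, and continuity
    carries this to a boundary point. *)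
Lemma finite_zeros (G : C -> C) : (forall z, closure Omega z -> holo G z) ->
  (forall z, boundary Omega z -> G z <> 0) ->
  exists l G1, (forall x, In x l -> Omega x) /\ factor G l G1 /\ forall z, Omega z -> G1 z <> 0.
Proof.
  intros HG Hb. apply NNPP. intros N.
  assert (Hk : forall k, exists l G1, length l = k /\ (forall x, In x l -> Omega x) /\ factor G l G1).
  { induction k as [|k (l & G1 & Hl & Hin & HF & E)].
    - exists nil, G. split; [auto|]. split; [intros x []|]. split; [auto|]. intros z; simpl; ring.
    - assert (X : exists a, Omega a /\ G1 a = 0).
      { apply NNPP. intros X. apply N. exists l, G1. split; [auto|]. split; [split; auto|].
        intros z Hz E0. apply X. exists z; auto. }
      destruct X as (a & Ha & E0).
      destruct (holo_divide G1 a) as (G2 & A1 & _ & A3); [apply HF, HG; now apply closure_self|auto|].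
      exists (a :: l), G2. split; [simpl; auto|]. split.
      + intros x [<-|Hx]; auto.
      + split; [auto|]. intros z. rewrite E, A3. simpl. ring. }
  destruct (sd_bounded _ _ _ HO) as [M HM].
  destruct (bounded_accum Omega G M HM Hk) as (a & HA & Hcl).
  assert (Ca : closure Omega a).
  { intros V HV. apply locally_Cmod in HV. destruct HV as (d & Pd & D).
    destruct (Hcl d Pd) as (x & Hx & Hd). exists x; auto. }
  assert (Va := accum_vanish G a (HG a Ca) HA).
  assert (Van0 : forall z, vanish G z -> G z = 0).
  { intros z Hz. exact (near_self _ _ Hz). }
  destruct (closure_cases _ _ Ca) as [Oa|Ba]; [|now apply (Hb a Ba), Van0].
  assert (All : forall b, Omega b -> vanish G b).
  { intros b Ob. apply NNPP. intros Nb.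
    destruct (sd_connected _ _ _ HO (fun z => Omega z /\ vanish G z) (fun z => Omega z /\ ~ vanish G z))
      as (z & _ & [_ H1] & [_ H2]).
    - intros z [Oz Vz]. apply locally_Cmod.
      apply near_and; [exact (open_Cmod _ _ (sd_open _ _ _ HO) Oz)|exact (near_near _ _ Vz)].
    - intros z [Oz Nz].
      assert (NA : ~ accum G z) by (intros HA'; apply Nz, accum_vanish; [apply HG; now apply closure_self|auto]).
      unfold accum in NA. apply not_all_ex_not in NA. destruct NA as [r NA].
      apply not_all_ex_not in NA. destruct NA as [k NA]. apply imply_to_and in NA. destruct NA as [Pr NA].
      apply locally_Cmod.
      apply (near_imp z (fun w => Omega w /\ Cmod (w - z) < r));
        [|apply near_and; [exact (open_Cmod _ _ (sd_open _ _ _ HO) Oz)|exists r; auto]].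
      intros w [Ow Hw]. split; [exact Ow|]. intros Vw. apply NA.
      (* k copies of a nearby w would form one of the lists that are missing at z, so the set where
         G does not vanish identically nearby is open as well. *)
      destruct (vanish_factor G w k (HG w (closure_self _ _ Ow)) Vw) as (G1 & HF & _).
      exists (repeat w k), G1. split; [apply repeat_length|]. split; [|exact HF].
      intros x Hx. apply repeat_spec in Hx. subst x. lra.
    - intros z Oz. destruct (classic (vanish G z)) as [V|V]; [left|right]; split; assumption.
    - exists a. auto.
    - exists b. auto.
    - exact (H2 H1). }
  assert (M1 := sd_m_pos).
  assert (B0 : boundary Omega (g 1%nat 0)) by (apply sd_on_boundary; lia).
  apply (Hb _ B0).
  assert (Hc := holo_cont G _ (HG _ (proj1 B0))).
  apply NNPP. intros Nz. assert (Pz := proj1 (Cmod_gt_0 _) Nz).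
  apply continuous_Cmod with (e := Cmod (G (g 1%nat 0))) in Hc; [|exact Pz].
  destruct (proj1 B0 _ Hc) as (w & Hw & Ow).
  rewrite (Van0 w (All w Ow)) in Hw. rewrite Cmod_sub_sym in Hw.
  replace (G (g 1%nat 0) - 0)%C with (G (g 1%nat 0)) in Hw by ring. lra.
Qed.

Definition oint_logder (F : C -> C) : C := oint m g tg (fun z => der F z / F z)%C.

Lemma oint_logder_ext F G : (forall z, boundary Omega z -> holo F z) ->
  (forall z, boundary Omega z -> near z (fun w => F w = G w)) -> oint_logder F = oint_logder G.
Proof.
  intros HF H. unfold oint_logder, oint. apply csum_ext. intros k Hk. apply Cint_ext; [lra|]. intros t _.
  assert (B := sd_on_boundary k t Hk). rewrite (der_ext F G); auto.
  now rewrite (near_self _ _ (H _ B)).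
Qed.

Lemma on_cont f k t : (1 <= k <= m)%nat -> (forall z, boundary Omega z -> holo f z) ->
  Ccont (fun s => f (g k s) * tg k s)%C t.
Proof.
  intros Hk Hf. apply cont_mult; [|now apply sd_tg_cont].
  apply (cont_comp f); [|now apply sd_cont].
  apply holo_cont, Hf. now apply sd_on_boundary.
Qed.

Lemma oint_plus f f' : (forall z, boundary Omega z -> holo f z) -> (forall z, boundary Omega z -> holo f' z) ->
  oint m g tg (fun z => f z + f' z)%C = (oint m g tg f + oint m g tg f')%C.
Proof.
  intros H H'. unfold oint. rewrite <- csum_plus. apply csum_ext. intros k Hk.
  rewrite <- Cint_plus by (apply ex_Cint; intros t _; now apply on_cont).
  apply Cint_ext; [lra|]. intros t _. ring.
Qed.

Lemma oint_logder_cons a F : Omega a -> (forall z, boundary Omega z -> holo F z) ->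
  (forall z, boundary Omega z -> F z <> 0) ->
  oint_logder (fun z => (z - a) * F z)%C = (2 * PI * Ci + oint_logder F)%C.
Proof.
  intros Ha HF Nz. rewrite <- (oint_pole a Ha). unfold oint_logder.
  assert (Na : forall z, boundary Omega z -> (z - a)%C <> 0).
  { intros z Hz. apply Cminus_eq_contra. intros ->. revert Hz. apply open_not_boundary; [apply (sd_open _ _ _ HO)|auto]. }
  rewrite <- oint_plus.
  - unfold oint. apply csum_ext. intros k Hk. apply Cint_ext; [lra|]. intros t _.
    assert (B := sd_on_boundary k t Hk).
    assert (Hd : Hol (fun z => z - a)%C (fun _ => 1 + 0)%C (g k t)).
    { apply (Hol_plus (fun z => z) (fun _ => RtoC 1) (fun _ => - a)%C (fun _ => RtoC 0)); [apply Hol_id|apply Hol_const]. }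
    assert (H := Hol_mult _ _ _ _ _ Hd (holo_der F _ (HF _ B))).
    apply Hol_der in H. rewrite H. field. split; auto.
  - intros z Hz. apply holo_inv; [|auto]. apply holo_minus; [apply holo_id|apply holo_const].
  - intros z Hz. apply holo_div; auto. now apply holo_derivative, HF.
Qed.

Lemma oint_logder_cprod l F : (forall x, In x l -> Omega x) -> (forall z, boundary Omega z -> holo F z) ->
  (forall z, boundary Omega z -> F z <> 0) ->
  oint_logder (fun z => cprod l z * F z)%C = (RtoC (INR (length l)) * (2 * PI * Ci) + oint_logder F)%C.
Proof.
  intros Hl HF Nz. induction l as [|a l IH].
  - simpl. rewrite (oint_logder_ext _ F).
    + ring.
    + intros z Hz. apply holo_mult; [apply holo_const|auto].
    + intros z Hz. exists 1. split; [lra|]. intros w _. ring.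
  - simpl cprod. rewrite (oint_logder_ext _ (fun z => (z - a) * (cprod l z * F z))%C).
    + rewrite oint_logder_cons.
      * rewrite IH by (intros; apply Hl; now right). simpl length. rewrite S_INR, RtoC_plus. ring.
      * apply Hl; now left.
      * intros z Hz. apply (holo_mult (cprod l)); [apply cprod_holo|auto].
      * intros z Hz. apply Cmult_neq_0; [|auto]. apply cprod_nz. intros x Hx ->. revert Hz.
        apply open_not_boundary; [apply (sd_open _ _ _ HO)|]. apply Hl; now right.
    + intros z Hz. apply (holo_mult (cprod (a :: l))); [apply cprod_holo|auto].
    + intros z Hz. exists 1. split; [lra|]. intros w _. ring.
Qed.

Lemma oint_logder_0 G : (forall z, closure Omega z -> holo G z) -> (forall z, closure Omega z -> G z <> 0) -> oint_logder G = 0.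
Proof.
  intros HG Nz. apply cauchy_domain. intros z Hz. apply holo_div; auto. now apply holo_derivative, HG.
Qed.

(* The list l contains the poles of F with multiplicity. *)
Lemma argument_principle F G l : (forall x, In x l -> Omega x) ->
  (forall z, boundary Omega z -> holo F z) -> (forall z, boundary Omega z -> F z <> 0) ->
  (forall z, closure Omega z -> holo G z) ->
  (forall z, boundary Omega z -> near z (fun w => G w = (cprod l w * F w)%C)) ->
  exists n : nat, oint_logder F = (RtoC (INR n - INR (length l)) * (2 * PI * Ci))%C /\
    ((forall z, Omega z -> G z <> 0) -> n = 0%nat).
Proof.
  intros Hl HF Nz HG E.
  assert (Nl : forall (l : list C) z, (forall x, In x l -> Omega x) -> boundary Omega z -> cprod l z <> 0).
  { intros l0 z H0 Hz. apply cprod_nz. intros x Hx ->. revert Hz.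
    apply open_not_boundary; [apply (sd_open _ _ _ HO)|auto]. }
  assert (Eb : forall z, boundary Omega z -> G z = (cprod l z * F z)%C).
  { intros z Hz. exact (near_self _ _ (E z Hz)). }
  destruct (finite_zeros G HG) as (l1 & G1 & Hl1 & [HF1 E1] & Nz1).
  { intros z Hz. rewrite Eb by auto. apply Cmult_neq_0; auto. }
  exists (length l1). split.
  (* The logarithmic derivative of G is integrated in two ways: from G = [cprod l] F near the
     boundary, and from G = [cprod l1] G1, where G1 has no zeros in the closure. *)
  - assert (A := oint_logder_cprod l F Hl HF Nz).
    assert (Nz1b : forall z, boundary Omega z -> G1 z <> 0).
    { intros z Hz E0. assert (Q := Eb z Hz). rewrite E1, E0 in Q.
      assert (K : (cprod l z * F z)%C <> 0) by (apply Cmult_neq_0; auto). apply K. rewrite <- Q. ring. }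
    assert (A1 := oint_logder_cprod l1 G1 Hl1 (fun z Hz => HF1 z (HG z (proj1 Hz))) Nz1b).
    rewrite (oint_logder_0 G1) in A1.
    + rewrite <- (oint_logder_ext G) in A1.
      * rewrite <- (oint_logder_ext G) in A.
        -- rewrite RtoC_minus. rewrite A1 in A.
           replace (oint_logder F) with (INR (length l) * (2 * PI * Ci) + oint_logder F - INR (length l) * (2 * PI * Ci))%C by ring.
           rewrite <- A. ring.
        -- intros z Hz. apply HG, Hz.
        -- exact E.
      * intros z Hz. apply HG, Hz.
      * intros z Hz. exists 1. split; [lra|]. intros w _. apply E1.
    + intros z Hz. auto.
    + intros z Hz. destruct (closure_cases _ _ Hz); auto.
  - intros NG. destruct l1 as [|a l1]; [reflexivity|]. exfalso.
    apply (NG a); [apply Hl1; now left|]. rewrite E1. simpl. ring.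
Qed.
End SmoothDomain.

(** * Complex gradients *)

Definition cgrad (u : R -> R -> R) (z : C) : C := (fst (grad u z), - snd (grad u z)).

Lemma Cmod_cgrad u z : Cmod (cgrad u z) ^ 2 = grad_sq u z.
Proof.
  unfold cgrad, grad_sq. change (enorm (grad u z)) with (Cmod (grad u z)). rewrite !Cmod2_alt. unfold Re, Im.
  cbn [fst snd]. ring.
Qed.

(** The prescribed partial derivatives are the Cauchy-Riemann equations for A + i B with derivative
    a + i b. *)
Lemma Cderive_of_real (A B : R -> R -> R) (a b : R) (z : C) :
  differentiable_pt_lim A (fst z) (snd z) a (- b) -> differentiable_pt_lim B (fst z) (snd z) b a ->
  is_Cderive (fun w => (A (fst w) (snd w), B (fst w) (snd w)) : C) z (a, b).
Proof.
  intros HA HB e He. assert (Pe : 0 < e / 2) by lra.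
  destruct (HA (mkposreal _ Pe)) as [d1 D1]. destruct (HB (mkposreal _ Pe)) as [d2 D2].
  simpl in D1, D2.
  exists (Rmin d1 d2). split; [apply Rmin_pos; apply cond_pos|]. intros w Hw.
  assert (M1 := Rmin_l d1 d2). assert (M2 := Rmin_r d1 d2).
  assert (F1 := fst_le_Cmod (w - z)). assert (F2 := snd_le_Cmod (w - z)).
  change (Rabs (fst w - fst z) <= Cmod (w - z)) in F1.
  change (Rabs (snd w - snd z) <= Cmod (w - z)) in F2.
  assert (E1 := D1 (fst w) (snd w) ltac:(lra) ltac:(lra)).
  assert (E2 := D2 (fst w) (snd w) ltac:(lra) ltac:(lra)).
  assert (Mx : Rmax (Rabs (fst w - fst z)) (Rabs (snd w - snd z)) <= Cmod (w - z)) by (apply Rmax_lub; auto).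
  eapply Rle_trans; [apply Cmod_le_Rabs|].
  match goal with |- Rabs ?x + Rabs ?y <= _ =>
    replace x with (A (fst w) (snd w) - A (fst z) (snd z) - (a * (fst w - fst z) + - b * (snd w - snd z))) by (simpl; ring);
    replace y with (B (fst w) (snd w) - B (fst z) (snd z) - (b * (fst w - fst z) + a * (snd w - snd z))) by (simpl; ring)
  end.
  assert (e / 2 * Rmax (Rabs (fst w - fst z)) (Rabs (snd w - snd z)) <= e / 2 * Cmod (w - z))
    by (apply Rmult_le_compat_l; lra).
  lra.
Qed.

Lemma C1_differentiable (f : R -> R -> R) x y d : 0 < d ->
  (forall x' y', Rabs (x' - x) < d -> Rabs (y' - y) < d -> ex_derive (fun s => f s y') x') ->
  ex_derive (fun s => f x s) y ->
  continuity_2d_pt (fun x y => Derive (fun s => f s y) x) x y ->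
  differentiable_pt_lim f x y (Derive (fun s => f s y) x) (Derive (fun s => f x s) y).
Proof.
  intros Pd Hx Hy Hc. apply filterdiff_differentiable_pt_lim.
  apply (is_derive_filterdiff f x y (fun x y => Derive (fun s => f s y) x) (Derive (fun s => f x s) y)).
  - exists (mkposreal d Pd). intros [x' y'] [B1 B2]. apply Derive_correct. now apply Hx.
  - now apply Derive_correct.
  - now apply continuity_2d_pt_filterlim in Hc.
Qed.

Definition harmonic_at (h : R -> R -> R) (z : R * R) : Prop :=
  ex_diff_n h 2 (fst z) (snd z) /\
  partial_derive 2 0 h (fst z) (snd z) + partial_derive 0 2 h (fst z) (snd z) = 0.

(** For h_x - i h_y one Cauchy-Riemann equation is Laplace's equation and the other is the symmetry
    of the mixed derivatives. *)
Lemma harmonic_holo h (z : C) d : 0 < d -> (forall w, Cmod (w - z) < d -> harmonic_at h w) ->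
  holo (cgrad h) z.
Proof.
  intros Pd H.
  set (hx := fun x y => Derive (fun s => h s y) x). set (hy := fun x y => Derive (fun s => h x s) y).
  set (hxx := fun x y => Derive (fun s => hx s y) x). set (hxy := fun x y => Derive (fun s => hx x s) y).
  set (hyx := fun x y => Derive (fun s => hy s y) x). set (hyy := fun x y => Derive (fun s => hy x s) y).
  assert (Box : forall w : C, Cmod (w - z) < d -> exists e, 0 < e /\ forall x' y',
     Rabs (x' - fst w) < e -> Rabs (y' - snd w) < e -> harmonic_at h (x', y')).
  { intros w Hw. exists ((d - Cmod (w - z)) / 2)%R. split; [lra|]. intros x' y' Hx Hy. apply H.
    assert (T := Cmod_sub_triangle (x', y') w z).
    assert (T2 := Cmod_le_Rabs ((x', y') - w)).
    change (Cmod ((x', y') - w) <= Rabs (x' - fst w) + Rabs (y' - snd w)) in T2. lra. }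
  assert (HH : forall x y, harmonic_at h (x, y) ->
    (ex_derive (fun s => hx s y) x /\ ex_derive (fun s => hx x s) y /\
     ex_derive (fun s => hy s y) x /\ ex_derive (fun s => hy x s) y) /\
    (continuity_2d_pt hxx x y /\ continuity_2d_pt hxy x y /\ continuity_2d_pt hyx x y /\ continuity_2d_pt hyy x y) /\
    (ex_derive (fun s => h s y) x /\ ex_derive (fun s => h x s) y) /\ hxx x y + hyy x y = 0).
  { intros x y [Hd Hl]. simpl in Hd, Hl. unfold partial_derive in Hl. simpl in Hl.
    destruct Hd as (_ & A1 & A2 & (_ & B1 & B2 & (B3 & _) & (B4 & _)) & (_ & C1 & C2 & (C3 & _) & (C4 & _))).
    repeat split; try assumption. }
  apply (C1_holo _ (fun w => (hxx (fst w) (snd w), - hyx (fst w) (snd w)) : C) z d Pd).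
  - intros w Hw. destruct (Box w Hw) as (e & Pe & He).
    assert (Hw0 := HH (fst w) (snd w)).
    destruct Hw0 as ((D1 & D2 & D3 & D4) & (K1 & K2 & K3 & K4) & _ & L).
    { apply He; rewrite Rminus_diag, Rabs_R0; auto. }
    assert (Sw : hyx (fst w) (snd w) = hxy (fst w) (snd w)).
    { unfold hyx, hxy, hx, hy. apply Schwarz.
      - exists (mkposreal e Pe). intros x' y' Hx Hy. destruct (HH x' y' (He x' y' Hx Hy)) as ((E1 & E2 & E3 & E4) & _ & (E5 & E6) & _).
        repeat split; assumption.
      - exact K3.
      - exact K2. }
    change (is_Cderive (fun v => (hx (fst v) (snd v), (fun x y => - hy x y) (fst v) (snd v)) : C) w (hxx (fst w) (snd w), - hyx (fst w) (snd w))).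
    apply Cderive_of_real.
    + rewrite Ropp_involutive, Sw. apply (C1_differentiable hx _ _ e Pe); auto.
      intros x' y' Hx Hy. now destruct (HH x' y' (He x' y' Hx Hy)) as ((E1 & _) & _).
    + replace (hxx (fst w) (snd w)) with (- hyy (fst w) (snd w)) by lra.
      assert (Q : differentiable_pt_lim hy (fst w) (snd w) (hyx (fst w) (snd w)) (hyy (fst w) (snd w))).
      { apply (C1_differentiable hy _ _ e Pe); auto.
        intros x' y' Hx Hy. now destruct (HH x' y' (He x' y' Hx Hy)) as ((_ & _ & E3 & _) & _). }
      intros eps. destruct (Q eps) as [dd Hdd]. exists dd. intros x' y' Hx Hy.
      specialize (Hdd x' y' Hx Hy).
      replace (- hy x' y' - - hy (fst w) (snd w) -
        (- hyx (fst w) (snd w) * (x' - fst w) + - hyy (fst w) (snd w) * (y' - snd w))) with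
        (- (hy x' y' - hy (fst w) (snd w) -
        (hyx (fst w) (snd w) * (x' - fst w) + hyy (fst w) (snd w) * (y' - snd w)))) by ring.
      rewrite Rabs_Ropp. exact Hdd.
  - intros w Hw. destruct (HH (fst w) (snd w)) as (_ & (K1 & K2 & K3 & K4) & _).
    { destruct w; apply H; exact Hw. }
    apply continuous_pair. simpl. destruct w as [x y]. split.
    + now apply continuity_2d_pt_filterlim in K1.
    + apply (continuous_opp (V := R_NormedModule)). now apply continuity_2d_pt_filterlim in K3.
Qed.

Lemma inv_pow_Hol (c : C) (k : nat) (z : C) : z <> RtoC 0 ->
  Hol (fun w => c / w ^ k)%C (fun w => - (RtoC (INR k) * c) / w ^ (S k))%C z.
Proof.
  intros Nz. assert (Near := near_ne z 0 Nz).
  destruct Near as (d & Pd & D).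
  induction k as [|k IH].
  - apply (Hol_ext (fun _ => c) (fun _ => RtoC 0)); [|apply Hol_const].
    exists d. split; [auto|]. intros w Hw. assert (N := D w Hw). split; simpl; field; auto using C1_nz.
  - assert (Hi := Hol_inv (fun w => w) (fun _ => RtoC 1) z (Hol_id z) Nz).
    assert (Hm := Hol_mult _ _ _ _ z IH Hi).
    eapply Hol_ext; [|exact Hm].
    exists d. split; [auto|]. intros w Hw. assert (N := D w Hw).
    assert (Nk := Cpow_nz w k N). cbv beta. rewrite S_INR, RtoC_plus, !Cpow_S. split; field; auto.
Qed.

(** l encodes the gradient as f_x - i f_y, hence the sign; in contrast to [cgrad], existence of the
    partial derivatives is asserted. *)
Definition has_grad (f : R -> R -> R) (z l : C) : Prop :=
  is_derive (fun s => f s (snd z)) (fst z) (fst l) /\ is_derive (fun s => f (fst z) s) (snd z) (- snd l).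

Lemma has_grad_ext_loc f h (z l : C) :
  near z (fun w => f (fst w) (snd w) = h (fst w) (snd w)) ->
  has_grad f z l -> has_grad h z l.
Proof.
  intros (d & Pd & D) [A B]. split.
  - eapply (is_derive_ext_loc (V := R_NormedModule)); [|exact A].
    exists (mkposreal d Pd). intros s Hs. apply (D (s, snd z)).
    eapply Rle_lt_trans; [apply Cmod_le_Rabs|]. simpl.
    replace (snd z + - snd z) with 0 by ring. rewrite Rabs_R0, Rplus_0_r. exact Hs.
  - eapply (is_derive_ext_loc (V := R_NormedModule)); [|exact B].
    exists (mkposreal d Pd). intros s Hs. apply (D (fst z, s)).
    eapply Rle_lt_trans; [apply Cmod_le_Rabs|]. simpl.
    replace (fst z + - fst z) with 0 by ring. rewrite Rabs_R0, Rplus_0_l. exact Hs.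
Qed.

(** For f = Re h one has f_x = Re h' and f_y = Re (i h') = - Im h', so f_x - i f_y is h' itself. *)
Lemma has_grad_Re (h : C -> C) (f : R -> R -> R) z l : is_Cderive h z l ->
  near z (fun w => fst (h w) = f (fst w) (snd w)) -> has_grad f z l.
Proof.
  intros H E. apply (has_grad_ext_loc (fun x y => fst (h (x, y)))).
  { destruct E as (d & Pd & D). exists d. split; [auto|]. intros [w1 w2] Hw. exact (D _ Hw). }
  assert (X : Cder (fun s => (s, snd z) : C) (fst z) (RtoC 1)).
  { apply Cder_pair; simpl. split; auto_derive; auto. }
  assert (Y : Cder (fun s => (fst z, s) : C) (snd z) Ci).
  { apply Cder_pair; simpl. split; auto_derive; auto. }
  assert (HX := Cderive_curve h z l (fun s => (s, snd z) : C) (fst z) _ H ltac:(now destruct z) X).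
  assert (HY := Cderive_curve h z l (fun s => (fst z, s) : C) (snd z) _ H ltac:(now destruct z) Y).
  apply Cder_pair in HX; apply Cder_pair in HY. split.
  - replace (fst l) with (fst (l * 1)%C) by (simpl; ring). apply HX.
  - replace (- snd l) with (fst (l * Ci)%C) by (simpl; ring). apply HY.
Qed.

Lemma has_grad_cgrad f z l : has_grad f z l -> cgrad f z = l.
Proof.
  intros [H1 H2]. apply injective_projections; simpl.
  - exact (is_derive_unique _ _ _ H1).
  - rewrite <- (Ropp_involutive (snd l)). f_equal. exact (is_derive_unique _ _ _ H2).
Qed.

Lemma Gamma_grad z : z <> RtoC 0 -> has_grad Gamma z (RtoC (/ (2 * PI)) / z ^ 1)%C.
Proof.
  intros Nz. destruct z as [x y]. assert (PP := PI_RGT_0).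
  assert (N : 0 < x ^ 2 + y ^ 2).
  { assert (Hx := pow2_ge_0 x). assert (Hy := pow2_ge_0 y).
    destruct (Req_dec x 0) as [->|Nx]; [destruct (Req_dec y 0) as [->|Ny]|].
    - exfalso. now apply Nz.
    - assert (0 < y ^ 2) by nra. lra.
    - assert (0 < x ^ 2) by nra. lra. }
  assert (Ps := sqrt_lt_R0 _ N). assert (Es := sqrt_sqrt _ (Rlt_le _ _ N)).
  rewrite Cpow_1_r. unfold has_grad, Gamma, enorm; simpl fst; simpl snd. split.
  - auto_derive; [repeat split; auto|].
    change (x * (x * 1) + y * (y * 1)) with (x ^ 2 + y ^ 2). rewrite <- Es at 3 4.
    set (r := sqrt (x ^ 2 + y ^ 2)) in *. field. lra.
  - auto_derive; [repeat split; auto|].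
    change (x * (x * 1) + y * (y * 1)) with (x ^ 2 + y ^ 2). rewrite <- Es at 3 4.
    set (r := sqrt (x ^ 2 + y ^ 2)) in *. field. lra.
Qed.

(** After one derivative D^alpha Gamma is the real part of c / z^k with k = |alpha| >= 1, so its
    complex gradient is - k c / z^(k+1), with a nonzero constant. An x-derivative is the real part
    of the complex gradient l, a y-derivative that of i l. *)
Lemma D_grad (al : nat * nat) : exists c : C, c <> 0 /\
  forall z, z <> RtoC 0 -> has_grad (Defs.D al Gamma) z (c / z ^ (S (order al)))%C.
Proof.
  destruct al as [a1 a2]. unfold order; simpl fst; simpl snd.
  assert (Step : forall (f : R -> R -> R) (c : C) k, (1 <= k)%nat -> c <> 0 ->
    (forall z : C, z <> 0 -> f (fst z) (snd z) = fst (c / z ^ k)%C) ->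
    exists c' : C, c' <> 0 /\ forall z, z <> RtoC 0 -> has_grad f z (c' / z ^ (S k))%C).
  { intros f c k Hk Nc Hf. exists (- (RtoC (INR k) * c))%C. split.
    - intros E. apply (Cmult_neq_0 (RtoC (INR k)) c); auto.
      + apply RtoC_nz, not_0_INR. lia.
      + replace (RtoC (INR k) * c)%C with (- - (RtoC (INR k) * c))%C by ring. rewrite E. ring.
    - intros z Nz. apply (has_grad_Re (fun w => c / w ^ k)%C).
      + apply (Hol_Cderive _ (fun w => - (RtoC (INR k) * c) / w ^ (S k))%C). now apply inv_pow_Hol.
      + apply (near_imp z (fun w => w <> 0)); [|now apply near_ne]. intros w Nw. symmetry. now apply Hf. }
  (* [partial_derive] differentiates in y first, so the induction on a2 comes before the one on
     a1. *)
  assert (A2 : forall a2, exists c : C, c <> 0 /\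
     forall z, z <> RtoC 0 -> has_grad (Defs.D (0%nat, a2) Gamma) z (c / z ^ (S a2))%C).
  { clear a2. induction a2 as [|a2 (c & Nc & Hc)].
    - exists (RtoC (/ (2 * PI))). split; [|apply Gamma_grad].
      apply RtoC_nz. assert (Q := PI_RGT_0). apply Rinv_neq_0_compat. lra.
    - apply (Step _ (Ci * c)%C); [lia|apply Cmult_neq_0; [apply Ci_nz|auto]|].
      intros z Nz. destruct (Hc z Nz) as [_ H].
      change (Derive (fun s => Defs.D (0%nat, a2) Gamma (fst z) s) (snd z) = fst (Ci * c / z ^ S a2)%C).
      etransitivity; [exact (is_derive_unique _ _ _ H)|].
      replace (Ci * c / z ^ S a2)%C with (Ci * (c / z ^ S a2))%C by (unfold Cdiv; ring).
      set (v := (c / z ^ S a2)%C). destruct v; simpl. ring. }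
  induction a1 as [|a1 (c & Nc & Hc)].
  - apply A2.
  - apply (Step _ c); [lia|auto|].
    intros z Nz. destruct (Hc z Nz) as [H _].
    change (Derive (fun s => Defs.D (a1, a2) Gamma s (snd z)) (fst z) = fst (c / z ^ S (a1 + a2))%C).
    exact (is_derive_unique _ _ _ H).
Qed.

(** * Poles *)

Definition lsum {A : Type} (f : A -> R) (l : list A) : R := fold_right (fun q s => f q + s) 0 l.

Lemma lsum_app {A : Type} (f : A -> R) l l' : lsum f (l ++ l') = lsum f l + lsum f l'.
Proof. induction l; simpl; [ring|]. rewrite IHl. ring. Qed.
Lemma lsum_ext {A : Type} (f h : A -> R) l : (forall a, In a l -> f a = h a) -> lsum f l = lsum h l.
Proof. induction l; intros H; simpl; [reflexivity|]. rewrite H, IHl; auto; [intros; apply H; now right|now left]. Qed.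
Lemma lsum_flat_map {A B : Type} (f : B -> R) (h : A -> list B) l :
  lsum f (flat_map h l) = lsum (fun a => lsum f (h a)) l.
Proof. induction l; simpl; [reflexivity|]. now rewrite lsum_app, IHl. Qed.
Lemma lsum_map {A B : Type} (f : B -> R) (h : A -> B) l : lsum f (map h l) = lsum (fun a => f (h a)) l.
Proof. induction l; simpl; [reflexivity|]. now rewrite IHl. Qed.
Lemma lsum_const {A : Type} c (l : list A) : lsum (fun _ => c) l = c * INR (length l).
Proof. induction l; [simpl; ring|]. simpl length. rewrite S_INR. simpl. rewrite IHl. ring. Qed.

Lemma sum_n_lsum (F : nat -> R) N : sum_n F N = lsum F (seq 0 (S N)).
Proof.
  induction N.
  - rewrite sum_O. simpl. ring.
  - rewrite sum_Sn, IHN, (seq_S (S N)), lsum_app. simpl. unfold plus; simpl. ring.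
Qed.
Lemma sum_n_m_lsum (F : nat -> R) k : sum_n_m F 1 k = lsum F (seq 1 k).
Proof.
  induction k.
  - rewrite sum_n_m_zero by lia. reflexivity.
  - rewrite sum_n_Sm by lia. rewrite IHk, seq_S, lsum_app. simpl. unfold plus; simpl. ring.
Qed.

Definition indices (N : nat) (n : nat * nat -> nat) : list ((nat * nat) * nat) :=
  flat_map (fun a1 => flat_map (fun a2 => map (fun j => ((a1, a2), j)) (seq 1 (n (a1, a2))))
    (seq 0 (S (N - a1)))) (seq 0 (S N)).

Lemma sum_multi_lsum N n (G : nat * nat -> nat -> R) :
  sum_multi N (fun al => sum_n_m (fun j => G al j) 1 (n al)) = lsum (fun q => G (fst q) (snd q)) (indices N n).
Proof.
  unfold sum_multi, indices. rewrite sum_n_lsum, lsum_flat_map. apply lsum_ext. intros a1 _.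
  rewrite sum_n_lsum, lsum_flat_map. apply lsum_ext. intros a2 _.
  rewrite sum_n_m_lsum, lsum_map. reflexivity.
Qed.

Lemma in_indices N n al j : In (al, j) (indices N n) <-> source_index N n al j.
Proof.
  unfold indices, source_index, order. rewrite in_flat_map. split.
  - intros (a1 & H1 & H). apply in_flat_map in H. destruct H as (a2 & H2 & H).
    apply in_map_iff in H. destruct H as (j' & E & H). injection E as <- <-.
    apply in_seq in H1, H2, H. simpl. lia.
  - destruct al as [a1 a2]. cbn [fst snd]. intros [H1 H2]. exists a1. split; [apply in_seq; lia|].
    apply in_flat_map. exists a2. split; [apply in_seq; lia|].
    apply in_map. apply in_seq. lia.
Qed.

(** p recovers from an entry the block it lies in, so different blocks are disjoint. *)
Lemma NoDup_flat_map_proj {A B : Type} (h : A -> list B) (p : B -> A) l : NoDup l ->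
  (forall a, NoDup (h a)) -> (forall a b, In b (h a) -> p b = a) -> NoDup (flat_map h l).
Proof.
  intros Hl Hh Hp. induction Hl as [|a l Na Hl IH]; simpl; [constructor|].
  apply NoDup_app; auto. intros b Hb Hb'. apply in_flat_map in Hb'. destruct Hb' as (a' & Ha' & Hb').
  apply Hp in Hb. apply Hp in Hb'. apply Na. now rewrite <- Hb, Hb'.
Qed.

Lemma NoDup_indices N n : NoDup (indices N n).
Proof.
  apply (NoDup_flat_map_proj _ (fun q => fst (fst q))); [apply seq_NoDup| |].
  - intros a1. apply (NoDup_flat_map_proj _ (fun q => snd (fst q))); [apply seq_NoDup| |].
    + intros a2. apply FinFun.Injective_map_NoDup; [|apply seq_NoDup]. intros i j E. now injection E.
    + intros a2 b Hb. apply in_map_iff in Hb. now destruct Hb as (j & <- & _).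
  - intros a1 b Hb. apply in_flat_map in Hb. destruct Hb as (a2 & _ & Hb).
    apply in_map_iff in Hb. now destruct Hb as (j & <- & _).
Qed.

(** * Sums of principal parts over a common denominator *)

Section PartialFractions.
Context {A : Type} (X : A -> C) (E : A -> nat) (K : A -> C).

Definition psum (L : list A) (z : C) : C := fold_right (fun q s => K q / (z - X q) ^ E q + s)%C (RtoC 0) L.
Definition poles (L : list A) : list C := flat_map (fun q => repeat (X q) (E q)) L.
(** The numerator of [psum] over the common denominator [cprod (poles L)]; its recursion contains no
    division, so it is holomorphic at the poles too. *)
Fixpoint pnum (L : list A) (z : C) : C :=
  match L with
  | nil => RtoC 0
  | q :: L' => (K q * cprod (poles L') z + (z - X q) ^ E q * pnum L' z)%C
  end.

Lemma cprod_repeat a k z : cprod (repeat a k) z = ((z - a) ^ k)%C.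
Proof. induction k; simpl; [reflexivity|]. now rewrite IHk. Qed.

Lemma cprod_poles_cons q L z : cprod (poles (q :: L)) z = ((z - X q) ^ E q * cprod (poles L) z)%C.
Proof. unfold poles; simpl. now rewrite cprod_app, cprod_repeat. Qed.

Lemma sub_holo a z : holo (fun w => w - a)%C z.
Proof. apply holo_minus; [apply holo_id|apply holo_const]. Qed.

Lemma pnum_holo L z : holo (pnum L) z.
Proof.
  induction L as [|q L IH]; simpl; [apply holo_const|].
  apply (holo_plus (fun w => K q * cprod (poles L) w)%C (fun w => (w - X q) ^ E q * pnum L w)%C).
  - apply (holo_mult (fun _ => K q)); [apply holo_const|apply cprod_holo].
  - apply (holo_mult (fun w => (w - X q) ^ E q)%C); [|exact IH]. apply (holo_pow (fun w => w - X q)%C), sub_holo.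
Qed.

Lemma psum_holo L z : (forall q, In q L -> z <> X q) -> holo (psum L) z.
Proof.
  induction L as [|q L IH]; intros H; simpl; [apply holo_const|].
  apply (holo_plus (fun w => K q / (w - X q) ^ E q)%C (psum L)).
  - apply holo_div; [apply holo_const|apply (holo_pow (fun w => w - X q)%C), sub_holo|].
    apply Cpow_nz, Cminus_eq_contra, H. now left.
  - apply IH. intros; apply H; now right.
Qed.

Lemma pnum_psum L z : (forall q, In q L -> z <> X q) -> pnum L z = (cprod (poles L) z * psum L z)%C.
Proof.
  induction L as [|q L IH]; intros H; [simpl; ring|].
  rewrite cprod_poles_cons. simpl. rewrite IH by (intros; apply H; now right).
  field. apply Cpow_nz, Cminus_eq_contra, H. now left.
Qed.

Lemma cprod_poles_0 L q : In q L -> (1 <= E q)%nat -> cprod (poles L) (X q) = 0.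
Proof.
  intros Hq HE. induction L as [|q' L IH]; [destruct Hq|]. rewrite cprod_poles_cons.
  destruct Hq as [->|Hq].
  - destruct (E q); [lia|]. simpl. ring.
  - rewrite IH by auto. ring.
Qed.

(** At X q0 every term but its own contains the factor z - X q0. Its own term is K q0 times the
    remaining factors, which are nonzero because the poles are distinct. *)
Lemma pnum_nz L q0 : In q0 L -> NoDup L -> (forall q, In q L -> (1 <= E q)%nat) ->
  (forall q, In q L -> K q <> 0) ->
  (forall q q', In q L -> In q' L -> X q = X q' -> q = q') -> pnum L (X q0) <> 0.
Proof.
  intros H0 HN HE HK HX. induction HN as [|q L Nq HN IH]; [destruct H0|]. simpl.
  destruct H0 as [->|H0].
  - replace ((X q0 - X q0) ^ E q0)%C with (RtoC 0).
    + replace (K q0 * cprod (poles L) (X q0) + 0 * pnum L (X q0))%C with (K q0 * cprod (poles L) (X q0))%C by ring.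
      apply Cmult_neq_0; [apply HK; now left|]. apply cprod_nz. intros a Ha.
      unfold poles in Ha. apply in_flat_map in Ha. destruct Ha as (q & Hq & Ha).
      apply repeat_spec in Ha. subst a. intros EX. apply HX in EX; [|now left|now right]. subst q. auto.
    + assert (P := HE q0 ltac:(now left)). destruct (E q0); [lia|]. simpl. ring.
  - rewrite (cprod_poles_0 L q0 H0) by (apply HE; now right).
    replace (K q * 0 + (X q0 - X q) ^ E q * pnum L (X q0))%C with ((X q0 - X q) ^ E q * pnum L (X q0))%C by ring.
    apply Cmult_neq_0.
    + apply Cpow_nz, Cminus_eq_contra. intros EX. apply HX in EX; [|now right|now left]. subst q. auto.
    + apply IH; auto; intros; first [apply HE | apply HK | apply HX]; auto; now right.
Qed.

Lemma length_poles L : INR (length (poles L)) = lsum (fun q => INR (E q)) L.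
Proof.
  induction L as [|q L IH]; [reflexivity|]. unfold poles in *; simpl.
  rewrite length_app, repeat_length, plus_INR, IH. reflexivity.
Qed.
End PartialFractions.

Lemma has_grad_plus f h z l k : has_grad f z l -> has_grad h z k ->
  has_grad (fun x y => f x y + h x y) z (l + k)%C.
Proof.
  intros [A B] [A' B']. split.
  - exact (is_derive_plus (V := R_NormedModule) _ _ _ _ _ A A').
  - replace (- snd (l + k)%C) with (- snd l + - snd k) by (simpl; ring).
    exact (is_derive_plus (V := R_NormedModule) _ _ _ _ _ B B').
Qed.

Lemma has_grad_scal c f z l : has_grad f z l -> has_grad (fun x y => c * f x y) z (RtoC c * l)%C.
Proof.
  intros [A B]. split.
  - replace (fst (c * l)%C) with (c * fst l) by (simpl; ring).
    exact (is_derive_scal (fun s => f s (snd z)) _ c _ A).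
  - replace (- snd (c * l)%C) with (c * - snd l) by (simpl; ring).
    exact (is_derive_scal (fun s => f (fst z) s) _ c _ B).
Qed.

Lemma has_grad_shift f (a z l : C) : has_grad f (z - a)%C l ->
  has_grad (fun x y => f (x - fst a) (y - snd a)) z l.
Proof.
  intros [A B].
  assert (S : forall b t : R, is_derive (fun s => s - b) t 1) by (intros; auto_derive; auto; ring).
  split.
  - rewrite <- (Rmult_1_l (fst l)).
    exact (is_derive_comp (K := R_AbsRing) (fun s => f s (snd z - snd a)) (fun s => s - fst a) (fst z) _ _ A (S _ _)).
  - rewrite <- (Rmult_1_l (- snd l)).
    exact (is_derive_comp (K := R_AbsRing) (fun s => f (fst z - fst a) s) (fun s => s - snd a) (snd z) _ _ B (S _ _)).
Qed.

Lemma has_grad_lsum {A : Type} (f : A -> R -> R -> R) (X : A -> C) (E : A -> nat) (K : A -> C) L z :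
  (forall q, In q L -> has_grad (f q) z (K q / (z - X q) ^ E q)%C) ->
  has_grad (fun x y => lsum (fun q => f q x y) L) z (psum X E K L z).
Proof.
  induction L as [|q L IH]; intros H; simpl.
  - split; simpl; [|rewrite Ropp_0]; exact (is_derive_const (V := R_NormedModule) 0 _).
  - apply (has_grad_plus (f q)); [apply H; now left|]. apply IH. intros; apply H; now right.
Qed.

(** The normal is nu = - i T / |T|, and the derivative of |F|^2 along nu is 2 Re (conj F F' nu).
    Divided by 2 |F|^2 this is Re (F'/F nu), and the factor |T| turns it into Re (- i T F'/F) = Im
    (T F'/F). *)
Lemma flux_pointwise u (F : C -> C) (z T : C) : holo F z -> F z <> 0 -> T <> RtoC 0 ->
  near z (fun w => cgrad u w = F w) ->
  dir_derive (grad_sq u) z (snd T / Cmod T, - fst T / Cmod T) / (2 * grad_sq u z) * Cmod T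
  = snd (der F z / F z * T)%C.
Proof.
  intros HF Nz NT (d & Pd & D).
  assert (PT := proj1 (Cmod_gt_0 _) NT).
  set (nu := (snd T / Cmod T, - fst T / Cmod T) : C).
  set (c := fun s : R => (fst z + s * fst nu, snd z + s * snd nu) : C).
  assert (Hc : Cder c 0 nu) by (apply Cder_pair; unfold c; simpl; split; auto_derive; auto; ring).
  assert (c0 : c 0 = z) by (unfold c; destruct z; apply injective_projections; simpl; ring).
  assert (HFc := Cderive_curve F z _ c 0 nu (Hol_Cderive _ _ _ (holo_der _ _ HF)) c0 Hc).
  apply Cder_pair in HFc. destruct HFc as [H1 H2].
  assert (Q1 := sq_derive _ 0 _ _ H1). assert (Q2 := sq_derive _ 0 _ _ H2).
  assert (Q := is_derive_plus (V := R_NormedModule) _ _ _ _ _ Q1 Q2).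
  cbv beta in Q. rewrite c0, !Rminus_0_r in Q.
  assert (Hd : dir_derive (grad_sq u) z nu =
     2 * fst (F z) * fst (der F z * nu)%C + 2 * snd (F z) * snd (der F z * nu)%C).
  { unfold dir_derive. apply is_derive_unique.
    eapply (is_derive_ext_loc (V := R_NormedModule)); [|exact Q].
    assert (Lc := Cder_cont _ _ _ Hc). rewrite continuous_Cmod in Lc.
    generalize (Lc d Pd). apply filter_imp. intros s Hs. rewrite c0 in Hs.
    change (plus ((fst (F (c s)) - 0) ^ 2) ((snd (F (c s)) - 0) ^ 2) = grad_sq u (c s)).
    rewrite <- Cmod_cgrad, D, Cmod2_alt by exact Hs. unfold plus, Re, Im; simpl. ring. }
  fold nu. rewrite Hd.
  rewrite <- Cmod_cgrad, D by (rewrite Cmod_center; auto). rewrite Cmod2_alt. unfold Re, Im.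
  assert (NF : fst (F z) ^ 2 + snd (F z) ^ 2 <> 0).
  { intros E0. apply Nz. apply injective_projections; simpl; nra. }
  unfold nu. destruct (F z) as [a b]. destruct (der F z) as [e f]. simpl in NF |- *.
  field. split; [|lra]. intros E0. apply NF. rewrite <- E0. ring.
Qed.

Lemma csum_snd (F : nat -> C) m : snd (csum F m) = sum_n_m (fun k => snd (F k)) 1 m.
Proof.
  induction m.
  - rewrite sum_n_m_zero by lia. reflexivity.
  - rewrite sum_n_Sm by lia. rewrite <- IHm. reflexivity.
Qed.

Lemma flux_logder Omega m g u F : smooth_domain Omega m g ->
  (forall z, boundary Omega z -> holo F z) -> (forall z, boundary Omega z -> F z <> 0) ->
  (forall z, boundary Omega z -> near z (fun w => cgrad u w = F w)) ->
  arc_integral m g (fun k t => dir_derive (grad_sq u) (g k t) (normal (g k) t) / (2 * grad_sq u (g k t)))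
  = snd (oint_logder m g F).
Proof.
  intros HO HF Nz HD. unfold arc_integral, oint_logder, oint. rewrite csum_snd.
  apply sum_n_m_ext_loc. intros k Hk.
  rewrite Cint_snd.
  - apply RInt_ext. intros t _. assert (B := sd_on_boundary _ _ _ HO k t Hk).
    apply (flux_pointwise u F (g k t) (tg g k t)); auto.
    apply Cmod_gt_0. now apply (tg_pos _ _ _ HO).
  - apply ex_Cint. intros t _. apply (on_cont _ _ _ HO (fun z => der F z / F z)%C); [exact Hk|].
    intros z Hz. apply holo_div; auto. now apply holo_derivative, HF.
Qed.

(** * The zeros and poles of the complex gradient of u *)

Section Main.
Variables (Omega : R * R -> Prop) (m : nat) (g : nat -> R -> R * R).
Hypothesis hOmega : smooth_domain Omega m g.
Variables (N : nat) (n : nat * nat -> nat) (b : nat * nat -> nat -> R) (x : nat * nat -> nat -> R * R).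
Hypothesis hx : forall alpha j, source_index N n alpha j -> Omega (x alpha j).
Variables (u0 u : R -> R -> R).
Hypothesis hu0 : harmonic_near_closure Omega u0.
Hypothesis hu : near_closure Omega (fun z => ~ source N n x z ->
     u (fst z) (snd z) = u0 (fst z) (snd z) + source_potential N n b x z).

Let L := indices N n.
Let X (q : (nat * nat) * nat) : C := x (fst q) (snd q).
Let E (q : (nat * nat) * nat) : nat := S (order (fst q)).
Let c (al : nat * nat) : C := proj1_sig (constructive_indefinite_description _ (D_grad al)).
Let K (q : (nat * nat) * nat) : C := (RtoC (b (fst q) (snd q)) * c (fst q))%C.

Lemma c_spec al : c al <> 0 /\
  forall z, z <> RtoC 0 -> has_grad (Defs.D al Gamma) z (c al / z ^ (S (order al)))%C.
Proof. exact (proj2_sig (constructive_indefinite_description _ (D_grad al))). Qed.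

Definition cgradient (z : C) : C := (cgrad u0 z + psum X E K L z)%C.

Lemma source_iff z : source N n x z <-> exists q, In q L /\ z = X q.
Proof.
  split.
  - intros (al & j & H & ->). exists (al, j). split; [now apply in_indices|reflexivity].
  - intros ([al j] & H & ->). exists al, j. split; [now apply in_indices|reflexivity].
Qed.

Lemma nonsource_open z : ~ source N n x z -> near z (fun w => ~ source N n x w).
Proof.
  intros H.
  apply (near_imp z (fun w => forall q, In q L -> w <> X q)).
  { intros w Hw Hs. apply source_iff in Hs. destruct Hs as (q & Hq & Eq). exact (Hw q Hq Eq). }
  assert (H' : forall q, In q L -> z <> X q) by (intros q Hq Eq; apply H, source_iff; exists q; auto).
  revert H'. generalize L. intros l. induction l as [|q l IH]; intros H'; [now apply near_all|].
  apply (near_imp z (fun w => w <> X q /\ forall q, In q l -> w <> X q)).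
  - intros w [Hw Hl] q' [<-|Hq']; auto.
  - apply near_and; [apply near_ne, H'; now left|]. apply IH. intros; apply H'; now right.
Qed.

Definition regular (w : C) : Prop := harmonic_at u0 w /\
  (~ source N n x w -> u (fst w) (snd w) = u0 (fst w) (snd w) + source_potential N n b x w).

Lemma grad_u z : ~ source N n x z -> near z regular -> cgrad u z = cgradient z.
Proof.
  intros Hs Hn. apply has_grad_cgrad.
  apply (has_grad_ext_loc (fun s t => u0 s t + lsum (fun q => b (fst q) (snd q) *
     Defs.D (fst q) Gamma (s - fst (x (fst q) (snd q))) (t - snd (x (fst q) (snd q)))) L)).
  - apply (near_imp z (fun w => regular w /\ ~ source N n x w));
      [|apply near_and; [exact Hn|now apply nonsource_open]].
    intros w [[_ Ew] Hw]. rewrite Ew by exact Hw.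
    f_equal. unfold source_potential. symmetry.
    apply (sum_multi_lsum N n (fun al j => b al j * Defs.D al Gamma (fst w - fst (x al j)) (snd w - snd (x al j)))).
  - unfold cgradient. apply has_grad_plus.
    + destruct (near_self _ _ Hn) as [[(_ & A1 & A2 & _) _] _].
      split.
      * apply Derive_correct. exact A1.
      * unfold cgrad, grad; cbn [fst snd]. rewrite Ropp_involutive. apply Derive_correct. exact A2.
    + apply (has_grad_lsum (fun q s t => b (fst q) (snd q) *
       Defs.D (fst q) Gamma (s - fst (x (fst q) (snd q))) (t - snd (x (fst q) (snd q))))).
      intros q Hq. unfold K.
      replace (b (fst q) (snd q) * c (fst q) / (z - X q) ^ E q)%C with
        (b (fst q) (snd q) * (c (fst q) / (z - X q) ^ E q))%C by (unfold Cdiv; ring).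
      apply has_grad_scal.
      apply (has_grad_shift (Defs.D (fst q) Gamma) (X q)).
      apply (proj2 (c_spec (fst q))). apply Cminus_eq_contra. intros Eq. apply Hs, source_iff. exists q; auto.
Qed.

Lemma regular_near z : closure Omega z -> near z regular.
Proof. intros Hz. apply near_and; apply locally_Cmod; [exact (hu0 z Hz)|exact (hu z Hz)]. Qed.

Lemma boundary_nonsource z : boundary Omega z -> ~ source N n x z.
Proof.
  intros Hb (al & j & H & ->). revert Hb. apply open_not_boundary; [apply (sd_open _ _ _ hOmega)|now apply hx].
Qed.

Lemma grad_u_near z : closure Omega z -> ~ source N n x z ->
  near z (fun w => cgrad u w = cgradient w).
Proof.
  intros Hz Hs. apply (near_imp z (fun w => ~ source N n x w /\ near w regular)).
  - intros w [H1 H2]. now apply grad_u.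
  - apply near_and; [now apply nonsource_open|now apply near_near, regular_near].
Qed.

Lemma u0_holo z : closure Omega z -> holo (cgrad u0) z.
Proof.
  intros Hz. destruct (regular_near z Hz) as (d & Pd & D). apply (harmonic_holo u0 z d Pd).
  intros w Hw. apply D, Hw.
Qed.

(** The function G of the overview, with the product multiplied out so that it is holomorphic at the
    sources as well. *)
Definition cgradient_num (z : C) : C := (cgrad u0 z * cprod (poles X E L) z + pnum X E K L z)%C.

Lemma Gu_Fu z : ~ source N n x z -> cgradient_num z = (cprod (poles X E L) z * cgradient z)%C.
Proof.
  intros Hs. unfold cgradient_num, cgradient. rewrite (pnum_psum X E K L z); [ring|].
  intros q Hq Eq. apply Hs, source_iff. exists q; auto.
Qed.

Lemma bound_eq : sum_multi N (fun alpha => INR (order alpha + 1) * INR (n alpha)) = INR (length (poles X E L)).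
Proof.
  rewrite length_poles.
  transitivity (sum_multi N (fun al => sum_n_m (fun _ => INR (S (order al))) 1 (n al))).
  2:{ exact (sum_multi_lsum N n (fun al _ => INR (S (order al)))). }
  unfold sum_multi. apply sum_n_ext. intros a1. apply sum_n_ext. intros a2.
  rewrite sum_n_m_lsum, lsum_const, length_seq. f_equal. f_equal. lia.
Qed.

(** The witness k is the number of zeros of [cgradient_num] in Omega with multiplicity. That it is a
    natural number is the inequality. *)
Lemma main_bound : (forall z, boundary Omega z -> 0 < grad_sq u z) ->
  exists k : nat,
  - (1 / (2 * PI)) * arc_integral m g (fun k t => dir_derive (grad_sq u) (g k t) (normal (g k) t) / (2 * grad_sq u (g k t)))
   = sum_multi N (fun alpha => INR (order alpha + 1) * INR (n alpha)) - INR k /\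
  ((forall z, Omega z -> cgradient_num z <> 0) -> k = 0%nat).
Proof.
  intros hp.
  assert (HE : forall z, boundary Omega z -> near z (fun w => cgrad u w = cgradient w))
    by (intros z Hz; apply grad_u_near; [apply Hz|now apply boundary_nonsource]).
  assert (HF : forall z, boundary Omega z -> holo cgradient z).
  { intros z Hz. apply holo_plus; [apply u0_holo, Hz|]. apply psum_holo.
    intros q Hq Eq. apply (boundary_nonsource z Hz), source_iff. exists q; auto. }
  assert (Nz : forall z, boundary Omega z -> cgradient z <> 0).
  { intros z Hz. rewrite <- (near_self _ _ (HE z Hz)).
    intros E0. assert (Q := hp z Hz). rewrite <- Cmod_cgrad, E0, Cmod_0 in Q. lra. }
  destruct (argument_principle Omega m g hOmega cgradient cgradient_num (poles X E L)) as (k & Ek & Hk).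
  - intros a Ha. unfold poles in Ha. apply in_flat_map in Ha. destruct Ha as ([al j] & Hq & Ha).
    apply repeat_spec in Ha. subst a. apply hx. now apply in_indices.
  - exact HF.
  - exact Nz.
  - intros z Hz. apply holo_plus; [|apply pnum_holo].
    apply holo_mult; [now apply u0_holo|apply cprod_holo].
  - intros z Hz. destruct (nonsource_open z (boundary_nonsource z Hz)) as (d & Pd & D).
    exists d. split; [auto|]. intros w Hw. now apply Gu_Fu, D.
  - exists k. split; [|exact Hk]. rewrite (flux_logder Omega m g u cgradient hOmega HF Nz HE), Ek, bound_eq.
    assert (Sn : forall r, snd (RtoC r * (2 * PI * Ci))%C = r * (2 * PI)) by (intros; simpl; ring).
    assert (Id : forall r l, - (1 / (2 * PI)) * ((r - l) * (2 * PI)) = l - r) by (intros; field; apply PI_neq0).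
    rewrite Sn. exact (Id _ _).
Qed.

(** At a source, distinctness leaves a single term with a nonzero coefficient, and [pnum_nz]
    applies. Elsewhere G is the product times the complex gradient, and neither factor vanishes. *)
Lemma Gu_nz : (forall alpha j, source_index N n alpha j -> b alpha j <> 0) ->
   (forall alpha beta i j,
      source_index N n alpha i -> source_index N n beta j ->
      x alpha i = x beta j -> alpha = beta /\ i = j) ->
   (forall z, Omega z -> ~ source N n x z -> grad_sq u z <> 0) ->
   forall z, Omega z -> cgradient_num z <> 0.
Proof.
  intros Hb Hinj Hp z Hz. destruct (classic (source N n x z)) as [Hs|Hs].
  - apply source_iff in Hs. destruct Hs as (q & Hq & ->). unfold cgradient_num.
    assert (HE : forall q, In q L -> (1 <= E q)%nat) by (intros; unfold E; lia).
    rewrite cprod_poles_0 by auto.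
    replace (cgrad u0 (X q) * 0 + pnum X E K L (X q))%C with (pnum X E K L (X q)) by ring.
    apply pnum_nz; auto.
    + apply NoDup_indices.
    + intros [al j] H. apply in_indices in H. unfold K; cbn [fst snd].
      apply Cmult_neq_0; [now apply RtoC_nz, Hb|apply c_spec].
    + intros [al i] [be j] H1 H2 EX. apply in_indices in H1. apply in_indices in H2.
      destruct (Hinj al be i j H1 H2 EX) as [-> ->]. reflexivity.
  - rewrite Gu_Fu by auto. apply Cmult_neq_0.
    + apply cprod_nz. intros a Ha Eq. subst a. apply Hs, source_iff.
      unfold poles in Ha. apply in_flat_map in Ha. destruct Ha as (q & Hq & Ha).
      apply repeat_spec in Ha. exists q; auto.
    + rewrite <- (near_self _ _ (grad_u_near z (closure_self _ _ Hz) Hs)).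
      intros E0. apply (Hp z Hz Hs). rewrite <- Cmod_cgrad, E0, Cmod_0. ring.
Qed.
End Main.

Theorem theorem1
  (Omega : R * R -> Prop) (m : nat) (g : nat -> R -> R * R)
  (hOmega : smooth_domain Omega m g)
  (N : nat) (n : nat * nat -> nat)
  (b : nat * nat -> nat -> R) (x : nat * nat -> nat -> R * R)
  (hx : forall alpha j, source_index N n alpha j -> Omega (x alpha j))
  (u0 u : R -> R -> R)
  (hu0 : harmonic_near_closure Omega u0)
  (hu : near_closure Omega (fun z => ~ source N n x z ->
     u (fst z) (snd z) = u0 (fst z) (snd z) + source_potential N n b x z))
  (hp : forall z, boundary Omega z -> 0 < grad_sq u z) :
  let p := grad_sq u in
  let q := fun k t => dir_derive p (g k t) (normal (g k) t) in
  let I := arc_integral m g (fun k t => q k t / (2 * p (g k t))) in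
  let bound := sum_multi N (fun alpha => INR (order alpha + 1) * INR (n alpha)) in
  - (1 / (2 * PI)) * I <= bound /\
  ((forall alpha j, source_index N n alpha j -> b alpha j <> 0) ->
   (forall alpha beta i j,
      source_index N n alpha i -> source_index N n beta j ->
      x alpha i = x beta j -> alpha = beta /\ i = j) ->
   (forall z, Omega z -> ~ source N n x z -> p z <> 0) ->
   - (1 / (2 * PI)) * I = bound).
Proof.
  intros p q I bound.
  destruct (main_bound Omega m g hOmega N n b x hx u0 u hu0 hu hp) as (k & Ek & Hk).
  change (- (1 / (2 * PI)) * I = bound - INR k) in Ek. rewrite Ek. split.
  - assert (Q := pos_INR k). lra.
  - intros Hb Hinj Hp. rewrite Hk; [simpl; ring|].
    exact (Gu_nz Omega N n b x u0 u hu0 hu Hb Hinj Hp).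
Qed.
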